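(* Let $\mathcal{F}$ be a family of extrapolation pairs on $\mathbb{R}^n$. Suppose that $\mathbb{X}$ is a rearrangement invariant Banach function space over $(\mathbb{R}^n,dx)$ with upper Boyd index $q_{\mathbb{X}}<\infty$. Suppose that for some $p_0\in(0,\infty)$ and for every $w\in A_\infty$, $$\|f\|_{L^{p_0}(w)}\le C\,\|g\|_{L^{p_0}(w)},\qquad (f,g)\in\mathcal{F},$$ where $C$ is independent of $(f,g)$ and depends on $w$ only through its $A_\infty$ characteristic. Then for every $u\in RH_\infty$ and for every $v\in A_\infty$ there is a constant $C$ such that $$\|fu\|_{\mathbb{X}_v}\le C\,\|gu\|_{\mathbb{X}_v},\qquad (f,g)\in\mathcal{F}.$$
   Context: Weights. A weight on $\mathbb{R}^n$ is a measurable $w$ with $0<w<\infty$ a.e.; $w(E)=\int_E w\,dx$; $\|f\|_{L^p(w)}=(\int|f|^p w\,dx)^{1/p}$. The Hardy–Littlewood maximal operator is $Mf(x)=\sup_{Q\ni x}\frac1{|Q|}\int_Q|f|\,dy$ (sup over cubes $Q\ni x$). For $1<p<\infty$, $w\in A_p$ if $[w]_{A_p}=\sup_Q\big(\frac1{|Q|}\int_Q w\big)\big(\frac1{|Q|}\int_Q w^{1-p'}\big)^{p-1}<\infty$, where $1/p+1/p'=1$; $w\in A_1$ if $[w]_{A_1}=\|Mw/w\|_{L^\infty}<\infty$; $A_\infty=\bigcup_{p\ge1}A_p$. A weight $w$ is in $RH_\infty$ if $\sup_Q(\operatorname{ess\,sup}_Q w)\big(\frac1{|Q|}\int_Q w\big)^{-1}<\infty$.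 A constant depends on $w\in A_\infty$ only through its $A_\infty$ characteristic if, for every $q\in[1,\infty)$ and $K\ge1$, the same constant can be taken for all $w$ with $[w]_{A_q}\le K$. A family of extrapolation pairs is a collection of pairs $(f,g)$ of nonnegative measurable functions on $\mathbb{R}^n$. Banach function spaces. Let $\mathbb{M}$ be the set of (classes of) measurable functions on $\mathbb{R}^n$. A function norm is a map $\|\cdot\|:\mathbb{M}\to[0,\infty]$ with: (1) $\|f\|=\||f|\|$, and $\|f\|=0$ iff $f=0$ a.e.; (2) $\|f+g\|\le\|f\|+\|g\|$; (3) $\|\lambda f\|=|\lambda|\|f\|$; (4) $|f|\le|g|$ a.e. implies $\|f\|\le\|g\|$; (5) $|f_j|\uparrow|f|$ a.e. implies $\|f_j\|\uparrow\|f\|$; (6) if $|E|<\infty$ then $\|\mathbf{1}_E\|<\infty$ and $\int_E|f|\,dx\le C_E\|f\|$. Then $\mathbb{X}=\{f:\|f\|<\infty\}$ is a Banach function space (BFS) over $(\mathbb{R}^n,dx)$; functions not in $\mathbb{X}$ have norm $+\infty$. $\mathbb{X}$ is rearrangement invariant if $\|f\|_{\mathbb{X}}=\|g\|_{\mathbb{X}}$ whenever $f,g$ have the same distribution function $\lambda\mapsto|\{|f|>\lambda\}|$. By Luxemburg's theorem there is then a rearrangement invariant BFS $\overline{\mathbb{X}}$ over $[0,\infty)$ with $\|f\|_{\mathbb{X}}=\|f^*\|_{\overline{\mathbb{X}}}$, $f^*$ the decreasing rearrangement. For a weight $w$, put $w_f(\lambda)=w(\{|f|>\lambda\})$, $f_w^*(t)=\inf\{\lambda\ge0:w_f(\lambda)\le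 t\}$; $\mathbb{X}_w=\mathbb{X}(w)$ is the space with norm $\|f\|_{\mathbb{X}_w}=\|f_w^*\|_{\overline{\mathbb{X}}}$. With $D_tf(s)=f(s/t)$ and $h_{\mathbb{X}}(t)=\sup\{\|D_tf\|_{\overline{\mathbb{X}}}:\|f\|_{\overline{\mathbb{X}}}\le1\}$, the upper Boyd index is $q_{\mathbb{X}}=\lim_{t\to0^+}\frac{\log t}{\log h_{\mathbb{X}}(t)}=\inf_{0<t<1}\frac{\log t}{\log h_{\mathbb{X}}(t)}\in[1,\infty]$. *)

(* Defs.v *)
From HB Require Import structures.
From mathcomp Require Import all_boot all_order all_algebra.
From mathcomp Require Import all_classical all_reals all_analysis.
From mathcomp Require Import measurable_realfun ess_sup_inf.

Set Implicit Arguments.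
Unset Strict Implicit.
Unset Printing Implicit Defensive.
Import Order.TTheory GRing.Theory Num.Theory.
Import numFieldNormedType.Exports.

Local Open Scope classical_set_scope.
Local Open Scope ring_scope.
Local Open Scope ereal_scope.

(* Lebesgue measure on R^n is the completion of the n-fold product of the
   one-dimensional Lebesgue measure on n.-tuple R. *)

Section tuple_power.
Context d (T : measurableType d) (R : realType) (n : nat).
Variable m1 : {sigma_finite_measure set T -> \bar R}.
Variable m : {sigma_finite_measure set (n.-tuple T) -> \bar R}.

Definition cons_pair (z : T * n.-tuple T) : n.+1.-tuple T :=
  [the n.+1.-tuple T of z.1 :: z.2].

Lemma measurable_cons_pair : measurable_fun [set: T * n.-tuple T] cons_pair.
Proof. by apply: measurable_cons. Qed.

Definition power_cons : set (n.+1.-tuple T) -> \bar R :=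
  pushforward (m1 \x m) cons_pair.

Let mcons (A : set (n.+1.-tuple T)) :
  measurable A -> measurable (cons_pair @^-1` A).
Proof. by move=> mA; rewrite -[X in measurable X]setTI; apply: measurable_cons_pair. Qed.

Let power_cons0 : power_cons set0 = 0.
Proof. by rewrite /power_cons /pushforward preimage_set0 measure0. Qed.

Let power_cons_ge0 A : 0 <= power_cons A.
Proof. by rewrite /power_cons /pushforward; exact: measure_ge0. Qed.

Let power_cons_sigma_additive : semi_sigma_additive power_cons.
Proof.
move=> F mF tF mUF; rewrite /power_cons /pushforward preimage_bigcup.
apply: measure_semi_sigma_additive.
- by move=> k; exact: mcons.
- apply/trivIsetP => /= i j _ _ ij; rewrite -preimage_setI.
  by move/trivIsetP : tF => /(_ _ _ _ _ ij) ->//; rewrite preimage_set0.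
- by rewrite -preimage_bigcup; exact: mcons.
Qed.

HB.instance Definition _ := isMeasure.Build _ _ _ power_cons
  power_cons0 power_cons_ge0 power_cons_sigma_additive.

Let power_cons_sigma_finite : sigma_finite setT power_cons.
Proof.
have /sigma_finiteP[F [TF ndF Foo]] := sigma_finiteT m1.
have /sigma_finiteP[G [TG ndG Goo]] := sigma_finiteT m.
pose split (t : n.+1.-tuple T) : T * n.-tuple T :=
  (thead t, [tuple of behead t]).
have splitK z : split (cons_pair z) = z.
  by case: z => x t; congr pair => //; apply: val_inj.
have msplit : measurable_fun setT split.
  apply/measurable_fun_pairP; split => /=; first exact: measurable_tnth.
  exact: measurable_behead.
exists (fun k => split @^-1` (F k `*` G k)).
  rewrite -preimage_bigcup (_ : \bigcup_k _ = setT) ?preimage_setT//.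
  rewrite -subTset => -[x y] _.
  have [k _ Fkx] : (\bigcup_k F k) x by rewrite -TF.
  have [l _ Gly] : (\bigcup_k G k) y by rewrite -TG.
  exists (maxn k l) => //; split => /=.
    by move: x Fkx; exact/subsetPset/ndF/leq_maxl.
  by move: y Gly; exact/subsetPset/ndG/leq_maxr.
move=> k; have [? ?] := Foo k; have [? ?] := Goo k; split.
  by rewrite -[X in measurable X]setTI; apply: msplit => //; exact: measurableX.
rewrite /power_cons /pushforward.
rewrite [X in (_ \x _) X](_ : _ = F k `*` G k); last first.
  by apply/funext => z; rewrite /preimage /mkset splitK.
by rewrite product_measure1E// lte_mul_pinfty// ge0_fin_numE.
Qed.

HB.instance Definition _ := Measure_isSigmaFinite.Build _ _ _ power_cons
  power_cons_sigma_finite.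

End tuple_power.

Fixpoint power_measure d (T : measurableType d) (R : realType)
    (m1 : {sigma_finite_measure set T -> \bar R}) (n : nat) :
    {sigma_finite_measure set (n.-tuple T) -> \bar R} :=
  match n with
  | 0 => [the {sigma_finite_measure set _ -> \bar R} of \d_[tuple]]
  | n'.+1 => [the {sigma_finite_measure set _ -> \bar R}
               of power_cons m1 (power_measure m1 n')]
  end.

Definition lebesgue_borel (R : realType) (n : nat) :
    {sigma_finite_measure set (n.-tuple (measurableTypeR R)) -> \bar R} :=
  power_measure lebesgue_measure n.

(* The Lebesgue sigma-algebra: Caratheodory-measurable sets. *)
Definition euclidean (R : realType) (n : nat) : Type :=
  caratheodory_type (mu_ext (lebesgue_borel R n)).
HB.instance Definition _ (R : realType) (n : nat) :=
  Measurable.on (euclidean R n).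

Definition leb (R : realType) (n : nat) : set (euclidean R n) -> \bar R :=
  @completed_measure_extension _ _ _ (lebesgue_borel R n).
Arguments leb R n : clear implicits.
HB.instance Definition _ (R : realType) (n : nat) := Measure.on (leb R n).

(* R with its Lebesgue sigma-algebra.  Functions on [0, oo) are represented by
   functions on R, read modulo null sets of Lebesgue measure restricted to
   [0, oo); their values at negative arguments are thus irrelevant. *)
Definition real_line (R : realType) : Type :=
  caratheodory_type (mu_ext (wlength (@idfun R))).
HB.instance Definition _ (R : realType) := Measurable.on (real_line R).

Lemma measurable_halfline (R : realType) :
  measurable ([set s : R | (0 <= s)%R] : set (real_line R)).
Proof.
have : (measurable : set (set (measurableTypeR R))) [set s : R | (0 <= s)%R].
  by rewrite -set_itvcy; exact: measurable_itv.
exact: sub_caratheodory.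
Qed.

Definition leb_halfline (R : realType) : set (real_line R) -> \bar R :=
  mrestr (@completed_lebesgue_measure R) (@measurable_halfline R).
Arguments leb_halfline R : clear implicits.
HB.instance Definition _ (R : realType) := Measure.on (leb_halfline R).

Section function_norms.
Context d (T : measurableType d) (R : realType).
Variable mu : {measure set T -> \bar R}.
Implicit Types (N : (T -> \bar R) -> \bar R) (f g : T -> \bar R).
Local Notation mfun f := (measurable_fun [set: T] f).

(* [N] is only constrained on measurable functions.  Functions are not
   quotiented by a.e. equality; that [N] factors through the quotient follows
   from [fnorm_abs] and [fnorm_le]. *)
Record function_norm N : Prop := {
  fnorm_ge0 : forall f, mfun f -> 0 <= N f ;
  fnorm_abs : forall f, mfun f -> N f = N (abse \o f) ;
  fnorm_eq0 : forall f, mfun f ->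
    (N f = 0 <-> \forall x \ae mu, f x = 0) ;
  fnormD : forall f g, mfun f -> mfun g -> N (f \+ g) <= N f + N g ;
  fnormZ : forall (a : R) f, mfun f ->
    N (fun x => a%:E * f x) = `|a|%:E * N f ;
  fnorm_le : forall f g, mfun f -> mfun g ->
    (\forall x \ae mu, `|f x| <= `|g x|) -> N f <= N g ;
  fnorm_fatou : forall (F : nat -> T -> \bar R) f,
    (forall j, mfun (F j)) -> mfun f ->
    (\forall x \ae mu, nondecreasing_seq (fun j => `|F j x|) /\
                       `|F j x| @[j --> \oo] --> `|f x|) ->
    nondecreasing_seq (fun j => N (F j)) /\ N (F j) @[j --> \oo] --> N f ;
  fnorm_fin : forall E, measurable E -> mu E < +oo ->
    N (fun x => (\1_E x)%:E) < +oo ;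
  fnorm_integral : forall E, measurable E -> mu E < +oo ->
    exists C : R, forall f, mfun f -> \int[mu]_(x in E) `|f x| <= C%:E * N f
}.

Definition dist_fun f (l : R) : \bar R := mu [set x | l%:E < `|f x|].

Definition rearrangement_invariant N : Prop :=
  forall f g, mfun f -> mfun g ->
    (forall l : R, (0 <= l)%R -> dist_fun f l = dist_fun g l) -> N f = N g.

End function_norms.

(* The generalized inverse t |-> inf {l >= 0 : D l <= t} of a distribution
   function D. *)
Definition rearr (R : realType) (D : R -> \bar R) (t : real_line R) : \bar R :=
  ereal_inf [set l%:E | l in [set l : R | (0 <= l)%R /\ D l <= (t : R)%:E]].

Definition dilation (R : realType) (t : R) (f : real_line R -> \bar R)
    (s : real_line R) : \bar R :=
  f ((s : R) / t)%R.

Definition dilation_norm (R : realType)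
    (N : (real_line R -> \bar R) -> \bar R) (t : R) : \bar R :=
  ereal_sup [set N (dilation t f) | f in
    [set f | measurable_fun [set: real_line R] f /\ N f <= 1]].

(* log t / log h(t), with h(t) = [dilation_norm N t].  For 0 < t < 1 one has 0 < h(t) <= 1, and the quotient is
   +oo when h(t) = 1 (library division by 0 would give log t * +oo = -oo). *)
Definition boyd_quotient (R : realType)
    (N : (real_line R -> \bar R) -> \bar R) (t : R) : \bar R :=
  if dilation_norm N t == 1 then +oo
  else (ln t)%:E / lne (dilation_norm N t).

(* The infimum coincides with the limit as t tends to 0 from the right. *)
Definition upper_boyd_index (R : realType)
    (N : (real_line R -> \bar R) -> \bar R) : \bar R :=
  ereal_inf [set boyd_quotient N t | t in [set t : R | (0 < t < 1)%R]].

Section weights.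
Context (R : realType) (n : nat).
Local Notation Rn := (euclidean R n).
Implicit Types (w f : Rn -> \bar R) (Q : set Rn).

(* Closed cubes with sides parallel to the axes. *)
Definition cubes : set (set Rn) :=
  [set Q | exists (a : 'I_n -> R) (l : R), (0 < l)%R /\
    Q = [set x : Rn | forall i : 'I_n,
          (a i <= tnth (x : n.-tuple R) i <= a i + l)%R]].

Definition avg Q f : \bar R := (\int[leb R n]_(x in Q) f x) / leb R n Q.

Definition maximal f (x : Rn) : \bar R :=
  ereal_sup [set avg Q (abse \o f) | Q in [set Q | cubes Q /\ Q x]].

Definition weight w : Prop :=
  measurable_fun [set: Rn] w /\ \forall x \ae leb R n, 0 < w x < +oo.

(* The constant [w]_{A_q}; only meaningful for 1 <= q. *)
Definition Ap_char (q : R) w : \bar R :=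
  if q == 1%R then Lnorm (leb R n) +oo (fun x => maximal w x / w x)
  else let q' := (q / (q - 1))%R in
    ereal_sup [set avg Q w * avg Q (fun x => w x `^ (1 - q')) `^ (q - 1)
              | Q in cubes].

Definition Ainfty w : Prop :=
  weight w /\ exists q : R, (1 <= q)%R /\ Ap_char q w < +oo.

(* The averages of [w] are required to be finite: otherwise the quotient
   would be +oo / +oo, which is 0 in the library. *)
Definition RHinfty w : Prop :=
  [/\ weight w,
      forall Q, cubes Q -> avg Q w < +oo &
      ereal_sup [set ess_sup (leb R n) (w \_ Q) / avg Q w | Q in cubes] < +oo].

Definition wLp_norm (p : R) w f : \bar R :=
  (\int[leb R n]_x (`|f x| `^ p * w x)) `^ p^-1.

Definition wdist_fun w f (l : R) : \bar R :=
  \int[leb R n]_(x in [set x | l%:E < `|f x|]) w x.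

Definition extrapolation_pairs (F : set ((Rn -> \bar R) * (Rn -> \bar R))) :
    Prop :=
  forall f g, F (f, g) ->
    [/\ measurable_fun [set: Rn] f, measurable_fun [set: Rn] g,
        forall x, 0 <= f x & forall x, 0 <= g x].

(* [Y] is the norm of the space given by Luxemburg's theorem for the
   rearrangement invariant norm [X]. *)
Definition luxemburg (X : (Rn -> \bar R) -> \bar R)
    (Y : (real_line R -> \bar R) -> \bar R) : Prop :=
  [/\ function_norm (leb_halfline R) Y,
      rearrangement_invariant (leb_halfline R) Y &
      forall f, measurable_fun [set: Rn] f ->
        X f = Y (rearr (dist_fun (leb R n) f))].

Definition weighted_norm (Y : (real_line R -> \bar R) -> \bar R) w f : \bar R :=
  Y (rearr (wdist_fun w f)).

End weights.

(* Main.v *)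
Require Import Defs.
From HB Require Import structures.
From mathcomp Require Import all_boot all_order all_algebra.
From mathcomp Require Import all_classical all_reals all_analysis.
From mathcomp Require Import measurable_realfun ess_sup_inf.
From mathcomp Require Import ring lra.
Set Implicit Arguments.
Unset Strict Implicit.
Unset Printing Implicit Defensive.
Import Order.TTheory GRing.Theory Num.Theory.
Import numFieldNormedType.Exports.

Local Open Scope classical_set_scope.
Local Open Scope ring_scope.
Local Open Scope ereal_scope.

(** The conclusion is reached through distribution functions, with neither
    duality nor an iterated maximal operator.

    Write F = f u, G = g u, and let nu be the measure with density v.  A
    weight of class A_infinity makes nu doubling ([Ap_doubling]), so nu has a
    maximal operator M of weak type (1,1).  The heart of the proof is a
    statement about one pair and one height ([distribution_estimate]): if the
    distribution function of G at the heights lam c^-k and lam d^k is at most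
    rho^k tau and rho^-k tau for all k, then nu {F > C lam} <= tau.

    Otherwise let E be a part of {F > C lam} with tau < nu E < oo, put
    phi = (G / lam)^r with r small, and consider
      a = max (1_E, M 1_E)   and   b = max (phi, 1, M (max (phi, 1))).
    The hypothesis on the family is used for the single weight
      w = u^p0 v a^alpha b^-gamma,   gamma = (p0 - r) / r,
    with alpha < 1 close to 1.  On E one has F > C lam and a >= 1, and b is
    bounded on half of E by the weak type inequality; hence the left-hand side
    is at least a constant times C^p0 lam^p0 nu E.  On the right-hand side
    G^p0 b^-gamma <= lam^p0 phi, and the decay of a away from E makes the
    integral of phi a^alpha d nu at most a constant times nu E.  Together these
    bound C ([level_set_estimate]).

    The constant in the hypothesis must not depend on E, G, lam: the weight w
    lies in a fixed class A_q with a fixed bound on its characteristic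
    ([product_weight_uniform]).  Indeed powers less than 1 of maximal
    functions are A_1 weights with respect to nu ([cmax_A1]), so that only
    small negative powers of u and v remain.  Those of v are controlled by the
    Muckenhoupt condition, and those of u by the fact that a weight of class
    RH_infinity is rarely much smaller than its essential supremum on a cube
    ([RHinfty_integral]), which follows from a dyadic stopping time.

    In terms of decreasing rearrangements with respect to nu, the estimate
    says that F^*(s) is at most C times the sum over k of c^k G^*(rho^k s)
    and d^-k G^*(rho^-k s).  A finite upper Boyd index gives a rho for which
    replacing a function of s by its value at rho s contracts the norm by some
    h < 1 ([boyd_contraction]); the inverse dilation acts on decreasing
    functions with some bound B ([up_dilation]).  The parameters are chosen
    with c h < 1 and B < d, and the triangle inequality and the Fatou property
    sum two geometric series ([rearr_comparison]). *)

(** * Measures with a density and sums over layers *)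

Lemma measurable_superlevel (R : realType) d (T : measurableType d) (f : T -> \bar R) :
  (forall a : R, measurable [set x | a%:E < f x]) -> measurable_fun setT f.
Proof.
move=> H; apply: (measurability _ (ErealGenOInfty.measurableE R)).
by move=> /= _ [_ [a ->]] <-; rewrite setTI preimage_itvoy; exact: H.
Qed.

Lemma superlevel_measurable (R : realType) d (T : measurableType d) (f : T -> \bar R)
  (y : \bar R) : measurable_fun setT f -> measurable [set x | y < f x].
Proof.
move=> mf; rewrite -[X in measurable X]setTI.
by apply: emeasurable_fun_o_infty.
Qed.

Lemma abse_superlevel_measurable (R : realType) d (T : measurableType d)
  (f : T -> \bar R) (y : \bar R) :
  measurable_fun setT f -> measurable [set x | y < `|f x|].
Proof. by move=> mf; apply: superlevel_measurable; exact: measurableT_comp. Qed.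

Section density.
Context d (T : measurableType d) (R : realType) (mu : {measure set T -> \bar R}).
Variables (v : T -> R) (mv : measurable_fun setT v) (v0 : forall x, (0 <= v x)%R).

Definition density (A : set T) : \bar R := \int[mu]_(x in A) (v x)%:E.

Let density0 : density set0 = 0. Proof. exact: integral_set0. Qed.

Let density_ge0 A : 0 <= density A.
Proof. by apply: integral_ge0 => x _; rewrite lee_fin. Qed.

Let density_sigma_additive : semi_sigma_additive density.
Proof.
move=> F mF tF mUF; rewrite /density.
rewrite ge0_integral_bigcup//; last 2 first.
- by apply: measurable_funTS; apply/measurable_EFinP.
- by move=> x _; rewrite lee_fin.
have : cvgn (fun m => \sum_(0 <= i < m) density (F i)).
  by apply: is_cvg_nneseries => k _ _; exact: density_ge0.
by [].
Qed.

HB.instance Definition _ := isMeasure.Build _ _ _ density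
  density0 density_ge0 density_sigma_additive.

Definition density_measure : {measure set T -> \bar R} :=
  [the {measure set T -> \bar R} of density].

Lemma density_measureE A : density_measure A = \int[mu]_(x in A) (v x)%:E.
Proof. by []. Qed.

Import HBNNSimple.

(** Simple functions increasing to [f] reduce the identity to indicator
    functions, where it defines [density_measure]. *)
Lemma density_integral (f : T -> \bar R) E : measurable E ->
    (forall x, 0 <= f x) -> measurable_fun E f ->
  \int[density_measure]_(x in E) f x = \int[mu]_(x in E) (f x * (v x)%:E).
Proof.
move=> mE f0 mf.
have mve D : measurable_fun D (fun x => (v x)%:E).
  by apply/measurable_EFinP; exact: measurable_funTS.
pose h := nnsfun_approx mE mf.
have -> : \int[density_measure]_(x in E) f x =
    lim (\int[density_measure]_(x in E) (EFin \o h n) x @[n --> \oo]).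
  have fE x : E x -> f x = lim ((EFin \o h n) x @[n --> \oo]).
    by move=> Ex; apply/esym/cvg_lim => //; exact: cvg_nnsfun_approx.
  under eq_integral => x /[!inE] /fE -> //.
  apply: monotone_convergence => //.
  - by move=> n; apply/measurable_EFinP; exact/measurable_funTS/measurable_funP.
  - by move=> n x Ex //=; rewrite lee_fin.
  - by move=> x Ex a b ab; rewrite lee_fin; exact/lefP/nd_nnsfun_approx.
have -> : \int[mu]_(x in E) (f x * (v x)%:E) =
    lim (\int[mu]_(x in E) ((h n x)%:E * (v x)%:E) @[n --> \oo]).
  have fg x : E x -> f x * (v x)%:E = lim ((h n x)%:E * (v x)%:E @[n --> \oo]).
    move=> Ex; apply/esym/cvg_lim => //; apply: cvgeZr => //.
    exact: cvg_nnsfun_approx.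
  under eq_integral => x /[!inE] /fg -> //.
  apply: monotone_convergence => [//| | |].
  - move=> n; apply/emeasurable_funM => //; apply/measurable_funTS.
    exact/measurable_EFinP.
  - by move=> n x Ex /=; rewrite mule_ge0 ?lee_fin.
  - move=> x Ex a b ab/=; rewrite lee_wpmul2r ?lee_fin//.
    exact/lefP/nd_nnsfun_approx.
suff suf n : \int[density_measure]_(x in E) (EFin \o h n) x =
    \int[mu]_(x in E) ((h n x)%:E * (v x)%:E).
  by under eq_fun do rewrite suf.
have -> : \int[density_measure]_(x in E) (EFin \o h n) x =
   \int[density_measure]_(x in E)
   (\sum_(y \in range (h n)) (y * \1_(h n @^-1` [set y]) x)%:E).
  by apply: eq_integral => t tE; rewrite /= fimfunE -fsumEFin.
have indich m r : measurable_fun E (fun x => (r * \1_(h m @^-1` [set r]) x)%:E).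
  by apply: (measurable_comp measurableT) => //; exact: measurable_funM.
rewrite ge0_integral_fsum//; last by move=> m y Ey; exact: nnfun_muleindic_ge0.
transitivity (\int[mu]_(x in E) (\sum_(y \in range (h n))
    (y * \1_(h n @^-1` [set y]) x)%:E * (v x)%:E)); last first.
  apply: eq_integral => x xE.
  rewrite -ge0_mule_fsuml => [|y]; last exact: nnfun_muleindic_ge0.
  by rewrite fsumEFin // -(fimfunE _ x).
rewrite ge0_integral_fsum//; last 2 first.
  - by move=> y; apply: emeasurable_funM => //; exact: indich.
  - by move=> m y Ey; rewrite mule_ge0 ?lee_fin ?v0// -lee_fin nnfun_muleindic_ge0.
apply: eq_fsbigr => r rhn.
under eq_integral do rewrite EFinM.
under [RHS]eq_integral do rewrite EFinM -muleA.
have r0 : (0 <= r)%R by move: rhn; rewrite inE => -[t _ <-].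
rewrite integralZl_indic_nnsfun// ge0_integralZl//; last 2 first.
- apply: emeasurable_funM => //; exact/measurable_EFinP.
- by move=> t Et; rewrite mule_ge0 ?lee_fin.
congr (_ * _); rewrite integral_indic//.
under eq_integral do rewrite muleC.
rewrite (eq_integral ((EFin \o v) \_ (h n @^-1` [set r]))); last first.
  by move=> x xE; rewrite epatch_indic.
by rewrite -integral_mkcondr setIC.
Qed.

End density.

Section layers.
Context d (T : measurableType d) (R : realType) (mu : {measure set T -> \bar R}).

(** If [h] is above [y 0], let [y j.+1] be the first level that is at least
    [h]: then [y j] is below [h], so [y j.+1] is a term of the series. *)
Lemma layers_bound (y : nat -> R) (h : \bar R) :
  (forall j, (0 <= y j)%R) -> (forall M, exists j, (M <= y j)%R) ->
  h <= (y 0)%:E + \sum_(j <oo) (y j.+1)%:E * (((y j)%:E < h)%E%:R)%:E.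
Proof.
move=> y0 yoo; set S := \sum_(j <oo) _.
have t0 j : 0 <= (y j.+1)%:E * (((y j)%:E < h)%E%:R)%:E.
  by rewrite mule_ge0// lee_fin.
have S0 : 0 <= S by apply: nneseries_ge0 => j _ _.
have Sj j : (y j)%:E < h -> (y j.+1)%:E <= S.
  move=> yjh; rewrite /S (nneseriesD1 (n := j))//=.
  by rewrite yjh mule1 leeDl// nneseries_ge0.
have [hy|yh] := leP h (y 0)%:E; first by rewrite (le_trans hy)// leeDl.
case: h => [r||] in S S0 t0 Sj yh *; last by rewrite leNye.
- have [j rj] := yoo r.
  have ex : exists j, (r <= y j)%R by exists j.
  case: (ex_minnP ex) => -[|k] rk mink; first by move: yh; rewrite lte_fin ltNge rk.
  apply: (@le_trans _ _ (y k.+1)%:E); first by rewrite lee_fin.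
  apply: (@le_trans _ _ S); last by rewrite leeDr// lee_fin.
  apply: Sj; rewrite lte_fin ltNge; apply/negP => /mink; by rewrite ltnn.
- suff -> : S = +oo by rewrite addey// leey.
  apply: eq_infty => M.
  have [[|j] Mj] := yoo (Num.max M (y 0%N + 1)%R).
    by move: Mj; rewrite ge_max gerDl ler10 andbF.
  apply: le_trans (Sj j _); last by rewrite ltey.
  by rewrite lee_fin (le_trans _ Mj)// le_max lexx.
Qed.

(** The layer-cake formula in a discrete form, obtained by integrating
    [layers_bound]. *)
Lemma integral_le_layers (A : set T) (h : T -> \bar R) (y : nat -> R) :
  measurable A -> measurable_fun setT h -> (forall x, 0 <= h x) ->
  (forall j, (0 <= y j)%R) -> (forall M, exists j, (M <= y j)%R) ->
  \int[mu]_(x in A) h x <= (y 0)%:E * mu A +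
    \sum_(j <oo) (y j.+1)%:E * mu (A `&` [set x | (y j)%:E < h x]).
Proof.
move=> mA mh h0 y0 yoo.
pose S j := [set x | (y j)%:E < h x].
have mS j : measurable (S j).
  exact: superlevel_measurable.
have mI j : measurable_fun A (fun x => (\1_(S j) x)%:E).
  by apply/measurable_EFinP; exact: measurable_indic.
have mt j : measurable_fun A
    (fun x => (y j.+1)%:E * (\1_(S j) x)%:E).
  by apply: emeasurable_funM => //; exact: measurable_cst.
have t0 j x : 0 <= (y j.+1)%:E * (\1_(S j) x)%:E.
  by rewrite mule_ge0// lee_fin.
apply: (@le_trans _ _ (\int[mu]_(x in A) ((y 0)%:E +
    \sum_(j <oo) (y j.+1)%:E * (\1_(S j) x)%:E))).
  apply: ge0_le_integral => //.
  - exact: measurable_funTS.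
  - by apply: emeasurable_funD => //; apply: ge0_emeasurable_sum.
  - move=> x _; apply: le_trans (layers_bound (h x) y0 yoo) _.
    rewrite leeD2l//; apply: lee_nneseries => [j _ _|j _].
      by rewrite mule_ge0// lee_fin.
    by rewrite indicE (_ : (x \in S j) = ((y j)%:E < h x))//; apply/idP/idP; rewrite inE.
rewrite ge0_integralD//; last 3 first.
- by move=> x _; rewrite lee_fin.
- by move=> x _; apply: nneseries_ge0 => j _ _.
- exact: ge0_emeasurable_sum.
rewrite integral_cst// integral_nneseries//.
rewrite leeD2l//; apply: lee_nneseries => [j _ _|j _].
  by apply: integral_ge0 => x _; exact: t0.
rewrite ge0_integralZl; [|exact: mA|exact: mI|by move=> x _; rewrite lee_fin|by rewrite lee_fin].
by rewrite integral_indic// setIC.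
Qed.

End layers.

(** * Cubes in Euclidean space *)

(** Cubes and everything built on them depend on the space only through its
    coordinate functions [co], hence make sense on any measurable space that
    has some; they are specialized to the completed sigma-algebra of R^n by
    [ecoord]. *)
Section cubes.
Context (T : Type) (R : realType) (n : nat).
Variable co : 'I_n -> T -> R.

Definition box (B : 'I_n -> set R) : set T := [set x | forall i, B i (co i x)].

Definition cube (a : 'I_n -> R) (l : R) : set T :=
  [set x | forall i, (a i <= co i x <= a i + l)%R].

Lemma cubeE a l : cube a l = box (fun i => `[a i, (a i + l)%R]%classic).
Proof. by apply/seteqP; split => x xa i; have := xa i; rewrite /= in_itv. Qed.

End cubes.

Section measurable_cubes.
Context d (T : measurableType d) (R : realType) (n : nat).
Variable co : 'I_n -> T -> R.
Hypothesis mco : forall i, measurable_fun setT (co i).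

Lemma measurable_box (B : 'I_n -> set R) :
  (forall i, measurable (B i : set (measurableTypeR R))) -> measurable (box co B).
Proof.
move=> mB.
have -> : box co B = \bigcap_(i in [set: 'I_n]) (co i @^-1` B i).
  by apply/seteqP; split => x xB i //=; exact: xB.
apply: fin_bigcap_measurable => // i _; rewrite -[X in measurable X]setTI.
by apply: (mco i) => //; exact: mB.
Qed.

Lemma measurable_cube a l : measurable (cube co a l).
Proof. by rewrite cubeE; apply: measurable_box => i; exact: measurable_itv. Qed.

End measurable_cubes.

Lemma power_measure_box d (T : measurableType d) (R : realType)
    (m1 : {sigma_finite_measure set T -> \bar R}) (l : R) n
    (B : 'I_n -> set T) :
  (forall i, measurable (B i)) -> (forall i, m1 (B i) = l%:E) ->
  power_measure m1 n [set x | forall i, B i (tnth x i)] = (l ^+ n)%:E.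
Proof.
elim: n B => [|n IH] B mB Bl.
  rewrite /= diracE mem_set ?expr0//; by move=> [].
rewrite /= /power_cons /pushforward.
rewrite [X in (_ \x _) X](_ : _ = B ord0 `*`
    [set x | forall i, B (lift ord0 i) (tnth x i)]); last first.
  apply/seteqP; split=> [[x t]/= H|[x t]/= [Bx Ht] i].
    split; first by have := H ord0; rewrite tnth0.
    by move=> i; have := H (lift ord0 i); rewrite tnthS.
  by case: (unliftP ord0 i) => [j ->|->]; rewrite ?tnthS ?tnth0.
have mt : measurable [set x : n.-tuple T | forall i, B (lift ord0 i) (tnth x i)].
  rewrite [X in measurable X](_ : _ = \bigcap_(i in [set: 'I_n])
    ((fun x : n.-tuple T => tnth x i) @^-1` B (lift ord0 i))).
    apply: fin_bigcap_measurable => // i _; rewrite -[X in measurable X]setTI.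
    exact: measurable_tnth.
  by apply/seteqP; split => x xB i //=; exact: xB.
have IHB := IH (fun i => B (lift ord0 i)) (fun i => mB _) (fun i => Bl _).
rewrite product_measure1E// exprS EFinM -(Bl ord0).
by congr (_ * _); exact: IHB.
Qed.

Section euclidean_cubes.
Context (R : realType) (n : nat).
Local Notation Rn := (euclidean R n).
Local Notation Bn := (n.-tuple (measurableTypeR R)).

Definition ecoord (i : 'I_n) (x : Rn) : R := tnth (x : n.-tuple R) i.
Definition bcoord (i : 'I_n) (x : Bn) : R := tnth x i.

Lemma borel_euclidean (A : set Bn) : measurable A -> measurable (A : set Rn).
Proof. exact: caratheodory_measurable_mu_ext. Qed.

Lemma leb_borel (A : set Bn) :
  measurable A -> leb R n A = lebesgue_borel R n A.
Proof. exact: measurable_mu_extE. Qed.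

Lemma measurable_bcoord i : measurable_fun setT (bcoord i).
Proof. exact: measurable_tnth. Qed.

Lemma measurable_ecoord i : measurable_fun setT (ecoord i).
Proof.
move=> _ B mB; rewrite setTI; apply: borel_euclidean.
by rewrite -[X in measurable X]setTI; exact: measurable_bcoord.
Qed.

Lemma leb_box (B : 'I_n -> set R) (l : R) :
  (forall i, measurable (B i : set (measurableTypeR R))) ->
  (forall i, lebesgue_measure (B i) = l%:E) ->
  leb R n (box ecoord B) = (l ^+ n)%:E.
Proof.
move=> mB Bl; rewrite leb_borel.
  exact: (@power_measure_box _ (measurableTypeR R)).
exact: measurable_box measurable_bcoord _ mB.
Qed.

Lemma leb_cube a (l : R) : (0 <= l)%R -> leb R n (cube ecoord a l) = (l ^+ n)%:E.
Proof.
move=> l0; rewrite cubeE; apply: leb_box => i; first exact: measurable_itv.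
rewrite lebesgue_measure_itv/= lte_fin ltrDl -EFinB.
by case: ltgtP l0 => // [_|<-] _; [congr EFin|congr EFin]; ring.
Qed.

End euclidean_cubes.

(** * Geometric series and integrals of small powers *)

Section geometric.
Context (R : realType).

Lemma geometric_nneseries (K q : R) : (0 <= K)%R -> (0 <= q < 1)%R ->
  \sum_(j <oo) (K * q ^+ j)%:E <= (K / (1 - q))%:E.
Proof.
move=> K0 /andP[q0 q1]; apply: lime_le.
  by apply: is_cvg_nneseries => j _ _; rewrite lee_fin mulr_ge0// exprn_ge0.
apply: nearW => k; rewrite sumEFin lee_fin.
have := @geometric_le_lim R k K q K0; rewrite /geometric/= => H.
have [->|qN0] := eqVneq q 0%R.
  rewrite subr0 divr1; case: k {H} => [|k]; first by rewrite big_geq.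
  rewrite big_nat_recl// expr0 mulr1 big1 ?addr0// => i _.
  by rewrite expr0n mulr0.
apply: H; first by rewrite lt_neqAle eq_sym qN0 q0.
by rewrite ger0_norm.
Qed.

Lemma powR_exprn (a x : R) j : (0 <= a)%R -> ((a ^+ j) `^ x = (a `^ x) ^+ j)%R.
Proof.
by move=> a0; rewrite -(powR_mulrn _ a0) -(powR_mulrn _ (powR_ge0 _ _)) powRAC.
Qed.

Lemma gt1_ltr_powR (a x y : R) : (1 < a)%R -> (x < y)%R -> (a `^ x < a `^ y)%R.
Proof.
move=> a1 xy; rewrite /powR gt_eqF ?(lt_trans _ a1)//.
by rewrite ltr_expR ltr_pM2r// ln_gt0.
Qed.

(** By the inequality of Bernoulli, [a ^+ m] is at least [1 + (a - 1) * m]. *)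
Lemma exprn_unbounded (a : R) : (1 < a)%R -> forall M : R, exists j, (M <= a ^+ j)%R.
Proof.
move=> a1 M; have a0 : (0 < a)%R by apply: lt_trans a1.
pose m := Num.bound (Num.max M 0 / (a - 1))%R; exists m.
have Mm : (Num.max M 0 / (a - 1) <= m%:R)%R.
  apply/ltW/archi_boundP/divr_ge0; first by rewrite le_max lexx orbT.
  by rewrite subr_ge0 ltW.
have : (1 + (a - 1) * m%:R <= a ^+ m)%R.
  elim: (m) => [|k IH]; first by rewrite mulr0 addr0 expr0.
  rewrite exprS -natr1 mulrDr mulr1.
  apply: (@le_trans _ _ (a * (1 + (a - 1) * k%:R))%R); last by rewrite ler_pM2l.
  rewrite -subr_ge0 (_ : (_ - _ = (a - 1) ^+ 2 * k%:R)%R); last by ring.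
  by rewrite mulr_ge0// sqr_ge0.
apply: le_trans; move: Mm; rewrite ler_pdivrMr ?subr_gt0// => Mm.
apply: (@le_trans _ _ (Num.max M 0%R)); first by rewrite le_max lexx.
by lra.
Qed.

End geometric.

Section kolmogorov.
Context d (T : measurableType d) (R : realType) (mu : {measure set T -> \bar R}).

Definition kolmogorov_cst (x : R) : R := (1 + 2 `^ x / (1 - 2 `^ (x - 1)))%R.

Lemma kolmogorov_cst_gt0 x : (0 < x < 1)%R -> (0 < kolmogorov_cst x)%R.
Proof.
move=> /andP[x0 x1].
apply: (lt_le_trans ltr01); rewrite lerDl divr_ge0 ?powR_ge0// subr_ge0.
by rewrite -[leRHS](powRr0 2) ler_powR ?ler1n// subr_le0 ltW.
Qed.

(** The inequality of Kolmogorov: on a set of finite measure, a function of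
    weak L^1 has integrable powers of exponent [x < 1].  Layers at the heights
    [(2 ^+ j * c) `^ x] contribute a geometric series of ratio
    [2 `^ (x - 1)]. *)
Lemma kolmogorov (A : set T) (h : T -> \bar R) (x c m : R) :
  measurable A -> measurable_fun setT h -> (forall t, 0 <= h t) ->
  (0 < x < 1)%R -> (0 < c)%R -> mu A = m%:E ->
  (forall y : R, (0 < y)%R -> mu (A `&` [set t | y%:E < h t]) <= (c / y * m)%:E) ->
  \int[mu]_(t in A) h t `^ x <= (kolmogorov_cst x * c `^ x * m)%:E.
Proof.
move=> mA mh h0 /andP[x0 x1] c0 Am weak.
have m0 : (0 <= m)%R by rewrite -lee_fin -Am.
pose y j := ((2 ^+ j * c) `^ x)%R.
have yE j : (y j = (2 `^ x) ^+ j * c `^ x)%R.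
  by rewrite /y powRM ?exprn_ge0// ?powR_exprn// ltW.
have cj0 j : (0 < 2 ^+ j * c)%R by rewrite mulr_gt0// exprn_gt0.
have cx0 : (0 < c `^ x)%R by rewrite powR_gt0.
have x21 : (1 < 2 `^ x :> R)%R.
  by rewrite -[ltLHS](powRr0 2) gt1_ltr_powR// ltr1n.
have : \int[mu]_(t in A) (h t `^ x) <= (y 0)%:E * mu A +
    \sum_(j <oo) (y j.+1)%:E * mu (A `&` [set t | (y j)%:E < h t `^ x]).
  apply: integral_le_layers => //.
  - exact: measurableT_comp (measurable_poweR x) mh.
  - by move=> t; exact: poweR_ge0.
  - by move=> j; exact: powR_ge0.
  move=> M; have [j Mj] := exprn_unbounded x21 (M / c `^ x); exists j.
  by rewrite yE -ler_pdivrMr.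
move=> /le_trans; apply.
have q01 : (0 <= (2 : R) `^ (x - 1) < 1)%R.
  rewrite powR_ge0/= -[ltRHS](powRr0 2) gt1_ltr_powR ?ltr1n//.
  by rewrite subr_lt0.
have K0 : (0 <= 2 `^ x * c `^ x * m)%R.
  by rewrite mulr_ge0// mulr_ge0 ?powR_ge0.
apply: (@le_trans _ _ ((c `^ x * m)%:E +
    \sum_(j <oo) (2 `^ x * c `^ x * m * (2 `^ (x - 1)) ^+ j)%:E)).
  rewrite Am -EFinM leeD//.
    by rewrite yE expr0 mul1r.
  apply: lee_nneseries => [j _ _|j _].
    by rewrite mule_ge0// lee_fin powR_ge0.
  apply: (@le_trans _ _ ((y j.+1)%:E * (c / (2 ^+ j * c) * m)%:E)).
    rewrite lee_wpmul2l ?lee_fin ?powR_ge0//.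
    apply: le_trans (weak _ (cj0 j)).
    rewrite le_measure ?inE//.
    - apply: measurableI => //; rewrite -[X in measurable X]setTI.
      apply: emeasurable_fun_o_infty => //.
      exact: measurableT_comp (measurable_poweR x) mh.
    - by apply: measurableI => //; exact: superlevel_measurable.
    - apply: setIS => t /=; have := h0 t.
      case: (h t) => [r| |]//; last by rewrite ltry.
      rewrite lee_fin poweR_EFin !lte_fin => r0; apply: contraTT.
      by rewrite -!leNgt => rc; rewrite ge0_ler_powR ?nnegrE// ltW.
  rewrite -EFinM lee_fin yE exprS powRB; last by rewrite pnatr_eq0 implybT.
  rewrite powRr1// expr_div_n le_eqVlt; apply/orP; left; apply/eqP.
  by field; rewrite expf_neq0// gt_eqF.
have := geometric_nneseries K0 q01 => /(leeD2l (c `^ x * m)%:E) /le_trans; apply.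
rewrite -EFinD lee_fin /kolmogorov_cst le_eqVlt; apply/orP; left; apply/eqP.
by field; case/andP: q01 => _ q1; rewrite subr_eq0 gt_eqF.
Qed.

End kolmogorov.

(** * Doubling measures and their maximal functions *)

Section cube_geometry.
Context (T : Type) (R : realType) (n : nat) (co : 'I_n -> T -> R).
Local Notation cube := (cube co).
Implicit Types (a b : 'I_n -> R) (l r : R).

Lemma subset_cube a l b r :
  (forall i, (b i <= a i)%R /\ (a i + l <= b i + r)%R) ->
  cube a l `<=` cube b r.
Proof.
move=> H x xa i; have [H1 H2] := H i; have /andP[x1 x2] := xa i.
by apply/andP; split; lra.
Qed.

Definition triple a l : ('I_n -> R) * R := ((fun i => a i - l)%R, (3 * l)%R).

Definition enlarged a l (k : nat) : ('I_n -> R) * R :=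
  iter k (fun c => triple c.1 c.2) (a, l).

Lemma enlargedE a l k :
  enlarged a l k = ((fun i => a i - (3 ^+ k - 1) / 2 * l)%R, (3 ^+ k * l)%R).
Proof.
elim: k => [|k IH].
  by rewrite /enlarged/= expr0 mul1r; congr pair; apply/funext => i; lra.
rewrite /enlarged iterS -/(enlarged a l k) IH /triple/=; congr pair.
  by apply/funext => i; rewrite exprS; field.
by rewrite exprS mulrA.
Qed.

Lemma subset_enlarged a l b r k x : (0 <= l <= (3 ^+ k - 1) / 2 * r)%R ->
  cube a l x -> cube b r x -> cube a l `<=` cube (enlarged b r k).1 (enlarged b r k).2.
Proof.
move=> /andP[l0 lr] xa xb; rewrite enlargedE/=; apply: subset_cube => i.
have /andP[x1 x2] := xa i; have /andP[x3 x4] := xb i.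
have -> : (3 ^+ k * r = 2 * ((3 ^+ k - 1) / 2 * r) + r)%R by field.
by split; lra.
Qed.

Lemma subset_enlargedS a l b r k x : (0 < r)%R -> (0 <= l <= 3 ^+ k * r)%R ->
  cube a l x -> cube b r x ->
  cube a l `<=` cube (enlarged b r k.+1).1 (enlarged b r k.+1).2.
Proof.
move=> r0 /andP[l0 lr] xa xb; apply: subset_enlarged xa xb; rewrite l0/=.
apply: le_trans lr _; rewrite ler_pM2r// exprS.
have : (1 <= 3 ^+ k :> R)%R by rewrite exprn_ege1// ler1n.
by lra.
Qed.

(** Cubes are examined by decreasing side.  One that meets a cube already
    selected is not larger than it, and thus lies in its triple; the other
    ones are selected. *)
Lemma finite_vitali (I : eqType) (c : I -> ('I_n -> R) * R) (s : seq I) :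
  (forall i, (0 < (c i).2)%R) ->
  exists t : seq I, [/\ uniq t, {subset t <= s},
    trivIset [set` t] (fun i => cube (c i).1 (c i).2) &
    forall i, i \in s -> exists2 j, j \in t &
      cube (c i).1 (c i).2 `<=`
      cube (triple (c j).1 (c j).2).1 (triple (c j).1 (c j).2).2].
Proof.
move=> c0; pose B i := cube (c i).1 (c i).2.
pose B3 j := cube (triple (c j).1 (c j).2).1 (triple (c j).1 (c j).2).2.
have BB3 i : B i `<=` B3 i.
  by apply: subset_cube => j; have := c0 i; rewrite /triple/= => ?; split; lra.
pose LE i j := ((c i).2 <= (c j).2)%R.
have LE_trans : transitive LE by move=> x y z; exact: le_trans.
wlog : s / sorted LE s.
  have : sorted LE (sort LE s) by apply: sort_sorted => x y; exact: le_total.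
  move=> /[swap] /[apply] -[t [ut ts tB H]]; exists t; split => //.
  - by move=> x /ts; rewrite mem_sort.
  - by move=> i; rewrite -(mem_sort LE) => /H.
elim: s => [_|i s IH].
  by exists nil; split => //; rewrite set_nil; exact: trivIset_set0.
rewrite /= => pis; have [t [ut ts tB H]] := IH (path_sorted pis).
have [ti|] := pselect (forall j, j \in t -> B i `&` B j = set0).
  have [it|it] := boolP (i \in t).
    exists t; split => //; first by move=> j /ts js; rewrite inE js orbT.
    move=> j /[1!inE] /predU1P[->|/H//].
    by exists i => //; exact: BB3.
  exists (i :: t); split => //=.
  - by rewrite it.
  - by move=> j /[1!inE] /predU1P[->|/ts js]; rewrite inE ?eqxx// js orbT.
  - apply/trivIsetP => j k /=; rewrite !inE => /predU1P[->|jt] /predU1P[->|kt].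
    + by rewrite eqxx.
    + by move=> _; exact: ti.
    + by move=> _; rewrite setIC; exact: ti.
    + by move=> jk; have /trivIsetP := tB; apply.
  - move=> j /[1!inE] /predU1P[->|/H[k kt jk]].
      by exists i; [rewrite inE eqxx|exact: BB3].
    by exists k => //; rewrite inE kt orbT.
move=> /existsNP[j /not_implyP[jt /eqP/set0P[x [xi xj]]]].
exists t; split => //; first by move=> k /ts ks; rewrite inE ks orbT.
move=> k /[1!inE] /predU1P[->|/H//]; exists j => //.
have ij : LE i j by have /allP := order_path_min LE_trans pis; apply; exact: ts.
have := @subset_enlarged (c i).1 (c i).2 (c j).1 (c j).2 1 x.
apply => //; rewrite expr1 ltW ?c0//=; apply: le_trans ij _; lra.
Qed.

(** The cubes with rational corners and sides.  A supremum over countably many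
    cubes is measurable, and these suffice by [rcube_dense]; indices that
    encode no cube are sent to the unit cube. *)
Definition rcube (k : nat) : ('I_n -> R) * R :=
  if @unpickle ({ffun 'I_n -> rat} * rat)%type k is Some (p, q) then
    if (0 < q)%R then ((fun i => ratr (p i)), ratr q) else (fun=> 0%R, 1%R)
  else (fun=> 0%R, 1%R).

Definition rcube_set k : set T := cube (rcube k).1 (rcube k).2.

Lemma rcube_gt0 k : (0 < (rcube k).2)%R.
Proof.
rewrite /rcube; case: unpickle => [[p q]|]//=; case: ifPn => //= q0.
by rewrite ltr0q.
Qed.

Lemma rcube_dense a l : (0 < l)%R ->
  exists k, cube a l `<=` rcube_set k /\ ((rcube k).2 <= 2 * l)%R.
Proof.
move=> l0.
have /choice[p ap] i : exists p : rat, (a i - l / 2 < ratr p < a i)%R.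
  have /rat_in_itvoo[p] : (a i - l / 2 < a i)%R by lra.
  by rewrite in_itv/= => ?; exists p.
have /rat_in_itvoo[q] : (3 / 2 * l < 2 * l)%R by lra.
rewrite in_itv/= => /andP[q1 q2].
have q0 : (0 < q)%R by rewrite -(ltr0q R); lra.
exists (pickle ([ffun i => p i], q)); rewrite /rcube_set /rcube pickleK q0/=.
split; last exact: ltW.
apply: subset_cube => i; rewrite ffunE; have /andP[p1 p2] := ap i.
by split; lra.
Qed.

End cube_geometry.
Arguments rcube {R n}.
Arguments rcube_gt0 {R n}.
Arguments rcube_set {T R n}.

Section maximal_function.
Context d (T : measurableType d) (R : realType) (n : nat).
Variables (co : 'I_n -> T -> R) (mco : forall i, measurable_fun setT (co i)).
Local Notation cube := (cube co).
Variable nu : {measure set T -> \bar R}.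
Variable D : R.
Local Notation RC k := (@rcube_set T R n co k).

Definition doubling := [/\ (1 <= D)%R,
  forall a l, (0 < l)%R -> 0 < nu (cube a l) < +oo &
  forall (a : 'I_n -> R) (l : R), (0 < l)%R ->
    nu (cube (triple a l).1 (triple a l).2) <= D%:E * nu (cube a l)].

Hypothesis nuD : doubling.

Let D1 : (1 <= D)%R. Proof. by case: nuD. Qed.
Let D0 : (0 < D)%R. Proof. exact: lt_le_trans D1. Qed.

Lemma doubling_enlarged a l k : (0 < l)%R ->
  nu (cube (enlarged a l k).1 (enlarged a l k).2) <= (D ^+ k)%:E * nu (cube a l).
Proof.
move=> l0; elim: k => [|k IH]; first by rewrite expr0 mul1e.
have [_ _ tripleD] := nuD.
rewrite /enlarged iterS -/(enlarged a l k); apply: (le_trans (tripleD _ _ _)).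
  by rewrite enlargedE/= mulr_gt0// exprn_gt0.
by rewrite exprS EFinM -muleA lee_pmul2l.
Qed.

Lemma doubling_meet a l b r k x : (0 < l)%R -> (0 < r)%R -> (l <= 3 ^+ k * r)%R ->
  cube a l x -> cube b r x -> nu (cube a l) <= (D ^+ k.+1)%:E * nu (cube b r).
Proof.
move=> l0 r0 lr xa xb; apply: (le_trans _ (doubling_enlarged b k.+1 r0)).
rewrite le_measure ?inE//; try exact: measurable_cube.
by apply: subset_enlargedS xa xb => //; rewrite (ltW l0).
Qed.

(** The maximal function over the cubes [rcube k] that contain [x].  The
    indicator turns the cubes that miss [x] into terms 0, so that the supremum
    runs over a set of indices independent of [x]. *)
Definition cmax (g : T -> \bar R) (x : T) : \bar R :=
  ereal_sup (range (fun k => ((fine (nu (RC k)))^-1)%:E *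
     (\int[nu]_(y in RC k) g y) * (\1_(RC k) x)%:E)).

Let nu_gt0 (k : nat) : 0 < nu (RC k).
Proof.
have [_ H _] := nuD.
by have /andP[] := H (@rcube R n k).1 _ (@rcube_gt0 R n k).
Qed.
Let nu_fin k : nu (RC k) \is a fin_num.
Proof.
rewrite ge0_fin_numE//; have [_ H _] := nuD.
by have /andP[] := H (@rcube R n k).1 _ (@rcube_gt0 R n k).
Qed.
Let fine_nu_gt0 k : (0 < fine (nu (RC k)))%R.
Proof. by rewrite fine_gt0// nu_gt0 ltey_eq nu_fin. Qed.

Let mrcube k : measurable (RC k : set T).
Proof. exact: measurable_cube. Qed.

Implicit Types g : T -> \bar R.

Lemma cmax_term_ge0 g k x : (forall x, 0 <= g x) ->
  0 <= ((fine (nu (RC k)))^-1)%:E *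
     (\int[nu]_(y in RC k) g y) * (\1_(RC k) x)%:E.
Proof.
move=> g0; apply: mule_ge0; last by rewrite lee_fin.
apply: mule_ge0; first by rewrite lee_fin invr_ge0 fine_ge0.
by apply: integral_ge0 => y _.
Qed.

Lemma cmax_ge0 g x : (forall x, 0 <= g x) -> 0 <= cmax g x.
Proof.
move=> g0; apply: le_trans (cmax_term_ge0 0 x g0) _.
by apply: ereal_sup_ubound; exists 0%N.
Qed.

Lemma measurable_cmax g : measurable_fun setT (cmax g).
Proof.
pose f k x := ((fine (nu (RC k)))^-1)%:E *
     (\int[nu]_(y in RC k) g y) * (\1_(RC k) x)%:E.
have -> : cmax g = (fun x => esups (f ^~ x) 0%N).
  apply/funext => x; rewrite /cmax /esups /sdrop; congr ereal_sup.
  by apply/seteqP; split => _ [k _ <-]; exists k.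
apply: measurable_fun_esups => k; apply: emeasurable_funM.
  exact: measurable_cst.
by apply/measurable_EFinP; exact: measurable_indic.
Qed.

Lemma int_rcube_le g k x : (forall x, 0 <= g x) -> RC k x ->
  \int[nu]_(y in RC k) g y <= nu (RC k) * cmax g x.
Proof.
move=> g0 kx.
rewrite -[nu (RC k)](fineK (nu_fin k)) -lee_pdivrMl//.
apply: ereal_sup_ubound; exists k => //.
by rewrite indicE mem_set// mule1.
Qed.

(** Some [rcube] contains the given cube and has at most twice its side, so
    passing to rational cubes costs two triplings. *)
Lemma int_cube_le g a l x : (forall x, 0 <= g x) -> measurable_fun setT g ->
  (0 < l)%R -> cube a l x ->
  \int[nu]_(y in cube a l) g y <= (D ^+ 2)%:E * nu (cube a l) * cmax g x.
Proof.
move=> g0 mg l0 xa; have [k [ak kl]] := rcube_dense co a l0.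
apply: (@le_trans _ _ (\int[nu]_(y in RC k) g y)).
  apply: ge0_subset_integral => //; first exact: measurable_cube.
  exact: measurable_funTS.
apply: (le_trans (int_rcube_le g0 (ak _ xa))).
apply: lee_wpmul2r; first exact: cmax_ge0.
apply: (@doubling_meet _ _ _ _ 1%N x) => //; rewrite ?rcube_gt0//.
  by rewrite expr1; lra.
exact: ak.
Qed.

Lemma cmax_leD g g1 (c : R) : (forall x, 0 <= g1 x) -> measurable_fun setT g1 ->
  (forall x, 0 <= g x) -> measurable_fun setT g ->
  (0 <= c)%R -> (forall x, g x <= g1 x + c%:E) ->
  forall x, cmax g x <= cmax g1 x + c%:E.
Proof.
move=> g10 mg1 g0 mg c0 gg1 x; apply: ge_ereal_sup => _ [k _ <-].
rewrite indicE; case: (boolP (x \in RC k)); rewrite ?inE => xk; last first.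
  by rewrite mule0 adde_ge0 ?cmax_ge0.
rewrite mule1 lee_pdivrMl// fineK//.
apply: (@le_trans _ _ (\int[nu]_(y in RC k) (g1 y + c%:E))).
  apply: ge0_le_integral => //.
  - exact: measurable_funTS.
  - by apply: emeasurable_funD => //; exact: measurable_funTS.
rewrite ge0_integralD//; last exact: measurable_funTS.
rewrite integral_cst// muleDr ?nu_fin ?fin_num_adde_defl//.
by rewrite [X in _ <= _ + X]muleC leeD2r// int_rcube_le.
Qed.

End maximal_function.

Lemma measure_bigsetU_le d (T : measurableType d) (R : realType)
    (mu : {measure set T -> \bar R}) (I : Type) (s : seq I) (A : I -> set T) :
  (forall i, measurable (A i)) ->
  mu (\big[setU/set0]_(i <- s) A i) <= \sum_(i <- s) mu (A i).
Proof.
move=> mA; elim: s => [|i s IH]; first by rewrite !big_nil measure0.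
rewrite !big_cons; apply: le_trans (leeD2l _ IH).
by apply: measureU2 => //; exact: bigsetU_measurable.
Qed.

Section maximal_estimates.
Context d (T : measurableType d) (R : realType) (n : nat).
Variables (co : 'I_n -> T -> R) (mco : forall i, measurable_fun setT (co i)).
Local Notation cube := (cube co).
Variable nu : {measure set T -> \bar R}.
Variable D : R.
Local Notation RC k := (@rcube_set T R n co k).
Hypothesis nuD : doubling co nu D.
Local Notation cmax := (cmax co nu).

Let D1 : (1 <= D)%R. Proof. by case: nuD. Qed.
Let D0 : (0 < D)%R. Proof. exact: lt_le_trans D1. Qed.

Let nu_gt0 k : 0 < nu (RC k).
Proof.
have [_ H _] := nuD.
by have /andP[] := H (@rcube R n k).1 _ (@rcube_gt0 R n k).
Qed.
Let nu_fin k : nu (RC k) \is a fin_num.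
Proof.
rewrite ge0_fin_numE//; have [_ H _] := nuD.
by have /andP[] := H (@rcube R n k).1 _ (@rcube_gt0 R n k).
Qed.
Let fine_nu_gt0 k : (0 < fine (nu (RC k)))%R.
Proof. by rewrite fine_gt0// nu_gt0 ltey_eq nu_fin. Qed.
Let mRC k : measurable (RC k : set T).
Proof. exact: measurable_cube. Qed.

Implicit Types g : T -> \bar R.

Let avgk g k := ((fine (nu (RC k)))^-1)%:E * (\int[nu]_(y in RC k) g y).

(** Weak type (1,1): the level set is an increasing union of finite unions of
    cubes on which the average exceeds [y].  Vitali's selection keeps disjoint
    cubes, whose triples cover the union and have comparable mass. *)
Lemma cmax_weak g (y : R) : (forall x, 0 <= g x) -> measurable_fun setT g ->
  (0 < y)%R ->
  y%:E * nu [set x | y%:E < cmax g x] <= D%:E * \int[nu]_x g x.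
Proof.
move=> g0 mg y0.
pose S N := [seq k <- iota 0 N | y%:E < avgk g k].
pose U N := \big[setU/set0]_(k <- S N) RC k.
have UE N x : U N x <-> exists2 k, (k < N)%N /\ y%:E < avgk g k & RC k x.
  rewrite /U -bigcup_seq; split.
    by move=> [k /=]; rewrite mem_filter mem_iota add0n/= => /andP[? ?] ?; exists k.
  by move=> [k [kN yk] kx]; exists k => //=; rewrite mem_filter yk mem_iota add0n.
have mU N : measurable (U N) by exact: bigsetU_measurable.
have -> : [set x | y%:E < cmax g x] = \bigcup_N U N.
  apply/seteqP; split => x /=.
    move=> /ereal_sup_gt[_ [k _ <-]]; rewrite indicE.
    case: (boolP (x \in RC k)); rewrite ?inE => xk; last first.
      by rewrite mule0 lte_fin ltNge ltW.
    by rewrite mule1 => yk; exists k.+1 => //; apply/UE; exists k.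
  move=> [N _ /UE[k [_ yk] kx]]; apply: (lt_le_trans yk).
  by apply: ereal_sup_ubound; exists k => //; rewrite indicE mem_set// mule1.
have ndU : nondecreasing_seq U.
  apply/nondecreasing_seqP => N; apply/subsetPset => x /UE[k [kN yk] kx].
  by apply/UE; exists k => //; split => //; exact: leqW.
rewrite -lee_pdivlMl//.
have cvgU : (nu \o U) N @[N --> \oo] --> nu (\bigcup_N U N).
  by apply: nondecreasing_cvg_mu => //; exact: bigcupT_measurable.
rewrite -(cvg_lim _ cvgU)//; apply: lime_le; first by apply/cvg_ex; eexists; exact: cvgU.
apply: nearW => N /=; rewrite lee_pdivlMl//.
have [t [ut tS tB tcover]] := @finite_vitali T R n co nat rcube (S N)
  (@rcube_gt0 R n).
pose T3 j := cube (triple (@rcube R n j).1 (@rcube R n j).2).1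
                  (triple (@rcube R n j).1 (@rcube R n j).2).2.
have mT3 j : measurable (T3 j) by exact: measurable_cube.
apply: (@le_trans _ _ (y%:E * nu (\big[setU/set0]_(j <- t) T3 j))).
  rewrite lee_pmul2l// le_measure ?inE//; first exact: bigsetU_measurable.
  move=> x; rewrite /U -!bigcup_seq => -[k /= /tcover[j jt kj] kx].
  by exists j => //; exact: kj.
apply: (@le_trans _ _ (y%:E * \sum_(j <- t) nu (T3 j))).
  by rewrite lee_pmul2l//; exact: measure_bigsetU_le.
apply: (@le_trans _ _ (\sum_(j <- t) D%:E * \int[nu]_(x in RC j) g x)).
  rewrite ge0_sume_distrr//.
  rewrite !big_seq; apply: lee_sum => j /tS; rewrite mem_filter => /andP[yj _].
  have [_ _ HD] := nuD.
  apply: (@le_trans _ _ (y%:E * (D%:E * nu (RC j)))).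
    by rewrite lee_pmul2l//; apply: HD; exact: rcube_gt0.
  rewrite muleCA lee_pmul2l// -[nu (RC j)](fineK (nu_fin j)) muleC.
  by rewrite -lee_pdivlMl// ltW.
rewrite -ge0_sume_distrr; last by move=> j _; exact: integral_ge0.
rewrite lee_pmul2l// -ge0_integral_bigsetU//; last exact: measurable_funTS.
apply: ge0_subset_integral => //; first exact: bigsetU_measurable.
Qed.

(** Averages of [g] over cubes smaller than the given one only see [g] on its
    triple.  The triple of a larger cube contains [z], where the maximal
    function is at most [m]. *)
Lemma cmax_local g a l z (m : R) (t : T) : (forall x, 0 <= g x) ->
  measurable_fun setT g -> (0 < l)%R -> (0 <= m)%R ->
  cube a l z -> cmax g z <= m%:E -> cube a l t ->
  cmax g t <= maxe (cmax (g \_ (cube (triple a l).1 (triple a l).2)) t)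
                   (D ^+ 3 * m)%:E.
Proof.
move=> g0 mg l0 m0 zQ gz tQ; set Q3 := cube _ _; set g1 := g \_ Q3.
have g10 x : 0 <= g1 x by rewrite /g1 patchE; case: ifP.
apply: ge_ereal_sup => _ [k _ <-]; rewrite indicE.
case: (boolP (t \in RC k)); rewrite ?inE => tk; last first.
  by rewrite mule0 le_max cmax_ge0.
rewrite mule1 le_max; apply/orP.
have [rl|lr] := leP (@rcube R n k).2 l.
  left; have kQ3 : RC k `<=` Q3.
    have := @subset_enlarged T R n co (@rcube R n k).1 (@rcube R n k).2 a l 1%N t.
    apply => //; rewrite expr1 ltW ?rcube_gt0//=.
    by apply: le_trans rl _; lra.
  rewrite (eq_integral g1); last first.
    by move=> x; rewrite inE => xk; rewrite /g1 patchE mem_set//; exact: kQ3.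
  by apply: ereal_sup_ubound; exists k => //; rewrite indicE mem_set// mule1.
right; rewrite lee_pdivrMl// fineK//.
set K := (@rcube R n k).
have K0 : (0 < K.2)%R by exact: rcube_gt0.
have QK : cube a l `<=` cube (triple K.1 K.2).1 (triple K.1 K.2).2.
  have := @subset_enlarged T R n co a l K.1 K.2 1%N t.
  apply => //; rewrite expr1 ltW//=; apply: (le_trans (ltW lr)).
  by rewrite -/K; lra.
have T30 : (0 < (triple K.1 K.2).2)%R by rewrite /= mulr_gt0.
apply: (@le_trans _ _
  (\int[nu]_(y in cube (triple K.1 K.2).1 (triple K.1 K.2).2) g y)).
  apply: ge0_subset_integral => //; first exact: measurable_cube.
    exact: measurable_funTS.
  apply: subset_cube => i /=; split; first by rewrite lerBlDr lerDl ltW.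
  by rewrite -/K; lra.
apply: (le_trans (int_cube_le mco nuD g0 mg T30 (QK _ zQ))).
have [_ _ HD] := nuD.
apply: (@le_trans _ _ ((D ^+ 2)%:E * (D%:E * nu (RC k)) * m%:E)).
  apply: lee_pmul.
  - by rewrite mule_ge0// lee_fin exprn_ge0// ltW.
  - exact: cmax_ge0.
  - by rewrite lee_pmul2l ?lte_fin ?exprn_gt0//; exact: HD.
  - exact: gz.
rewrite !muleA -EFinM -exprSr -[nu (RC k)](fineK (nu_fin k)) -!EFinM lee_fin.
by rewrite mulrAC mulrC.
Qed.

Definition A1_cst (x : R) : R :=
  (kolmogorov_cst x * ((1 + D) * D ^+ 3) `^ x + (D ^+ 3) `^ x)%R.

(** The theorem of Coifman and Rochberg: powers less than 1 of maximal
    functions are A_1 weights.  By [cmax_local] only the part of [g] in the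
    triple of the cube matters; its integral is at most a multiple of [m] times
    the mass of the cube, and [kolmogorov] applies to it. *)
Lemma cmax_A1 (x : R) g a l z (m : R) : (0 < x < 1)%R -> (forall x, 0 <= g x) ->
  measurable_fun setT g -> (0 < l)%R -> (0 < m)%R ->
  cube a l z -> cmax g z <= m%:E ->
  \int[nu]_(t in cube a l) (maxe (g t) (cmax g t)) `^ x <=
    (A1_cst x * m `^ x)%:E * nu (cube a l).
Proof.
move=> x01 g0 mg l0 m0 zQ gz; have /andP[x0 x1] := x01.
set Q := cube a l; set Q3 := cube (triple a l).1 (triple a l).2.
have mQ : measurable Q by exact: measurable_cube.
have mQ3 : measurable Q3 by exact: measurable_cube.
have QQ3 : Q `<=` Q3 by apply: subset_cube => i /=; split; lra.
have [_ nuQ HD] := nuD.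
have nuQf : nu Q \is a fin_num by rewrite ge0_fin_numE//; case/andP: (nuQ a l l0).
set g1 := g \_ Q3.
have g10 t : 0 <= g1 t by rewrite /g1 patchE; case: ifP.
have mg1 : measurable_fun setT g1.
  by apply/(measurable_restrictT _ mQ3); exact: measurable_funTS.
pose h t := maxe (g1 t) (cmax g1 t).
have mcm f : measurable_fun setT (cmax f) by exact: measurable_cmax.
have mh : measurable_fun setT h by exact: measurable_maxe.
have h0 t : 0 <= h t by rewrite /h le_max g10.
have Ig1 : \int[nu]_t g1 t <= (D ^+ 3 * m)%:E * nu Q.
  rewrite /g1 -integral_mkcond.
  have T30 : (0 < (triple a l).2)%R by rewrite /= mulr_gt0.
  apply: (le_trans (int_cube_le mco nuD g0 mg T30 (QQ3 _ zQ))).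
  apply: (@le_trans _ _ ((D ^+ 2)%:E * (D%:E * nu Q) * m%:E)).
    apply: lee_pmul.
    - by rewrite mule_ge0// lee_fin exprn_ge0// ltW.
    - exact: cmax_ge0.
    - by rewrite lee_pmul2l ?lte_fin ?exprn_gt0//; exact: HD.
    - exact: gz.
  rewrite !muleA -EFinM -exprSr -[nu Q](fineK nuQf) -!EFinM lee_fin.
  by rewrite mulrAC mulrC.
have c0 : (0 < (1 + D) * (D ^+ 3 * m))%R.
  by rewrite !mulr_gt0 ?exprn_gt0// ltr_wpDl.
have weak y : (0 < y)%R -> nu (Q `&` [set t | y%:E < h t]) <=
    ((1 + D) * (D ^+ 3 * m) / y * fine (nu Q))%:E.
  move=> y0.
  have mg1y : measurable [set t | y%:E < g1 t].
    exact: superlevel_measurable.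
  have mcy : measurable [set t | y%:E < cmax g1 t].
    exact: superlevel_measurable.
  apply: (@le_trans _ _ (nu [set t | y%:E < g1 t] + nu [set t | y%:E < cmax g1 t])).
    apply: (le_trans _ (measureU2 _ _ _)) => //.
    rewrite le_measure ?inE//.
    - apply: measurableI => //.
      exact: superlevel_measurable.
    - exact: measurableU.
    - by move=> t [_]; rewrite /h/= lt_max => /orP.
  have -> : ((1 + D) * (D ^+ 3 * m) / y * fine (nu Q))%:E =
      (y^-1)%:E * ((1 + D)%:E * ((D ^+ 3 * m)%:E * nu Q)).
    rewrite -[nu Q in RHS](fineK nuQf) -!EFinM; congr EFin.
    by field; rewrite gt_eqF.
  rewrite lee_pdivlMl//.
  rewrite ge0_muleDr// (EFinD 1) ge0_muleDl ?lee_fin ?(ltW D0)// mul1e leeD//.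
    apply: le_trans Ig1.
    have := @le_integral_abse _ _ _ nu setT measurableT g1 y mg1 y0.
    under eq_integral do rewrite gee0_abs//.
    apply: le_trans; rewrite lee_pmul2l// setTI le_measure ?inE//.
      rewrite -[X in measurable X]setTI; apply: emeasurable_fun_c_infty => //.
      exact: measurableT_comp.
    by move=> t /= /ltW; rewrite gee0_abs.
  apply: (le_trans (cmax_weak g10 mg1 y0)).
  by rewrite lee_pmul2l.
have := kolmogorov mQ mh h0 x01 c0 (esym (fineK nuQf)) weak.
move=> K.
apply: (@le_trans _ _ (\int[nu]_(t in Q) (h t `^ x + ((D ^+ 3 * m) `^ x)%:E))).
  have mpow f : measurable_fun setT f -> measurable_fun Q (fun t => f t `^ x).
    move=> mf; apply: measurable_funTS.
    exact: measurableT_comp (measurable_poweR x) mf.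
  apply: ge0_le_integral => //.
  - by move=> t _; exact: poweR_ge0.
  - by apply: mpow; exact: measurable_maxe.
  - by apply: emeasurable_funD => //; exact: mpow.
  move=> t tQ.
  have : maxe (g t) (cmax g t) <= maxe (h t) (D ^+ 3 * m)%:E.
    have H := cmax_local g0 mg l0 (ltW m0) zQ gz tQ.
    rewrite ge_max; apply/andP; split.
      by rewrite !le_max /g1 patchE mem_set ?lexx//; exact: QQ3.
    apply: (le_trans H); rewrite ge_max; apply/andP; split.
      by rewrite !le_max lexx orbT.
    by rewrite le_max lexx orbT.
  rewrite le_max => /orP[] H.
    apply: (@le_trans _ _ (h t `^ x)); last by rewrite leeDl// lee_fin powR_ge0.
    apply: gt0_ler_poweR => //; rewrite ?in_itv/= ?leey ?andbT//; first exact: ltW.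
    by rewrite le_max g0.
  apply: (@le_trans _ _ ((D ^+ 3 * m)%:E `^ x)); last first.
    by rewrite poweR_EFin leeDr// poweR_ge0.
  apply: gt0_ler_poweR => //; rewrite ?in_itv/= ?leey ?andbT//; first exact: ltW.
    by rewrite le_max g0.
  by rewrite lee_fin mulr_ge0// ?exprn_ge0// ltW.
have hx0 t : Q t -> 0 <= h t `^ x by move=> _; exact: poweR_ge0.
have mhx : measurable_fun Q (fun t => h t `^ x).
  by apply: measurable_funTS; exact: measurableT_comp (measurable_poweR x) mh.
rewrite ge0_integralD//; last by move=> t _; rewrite lee_fin powR_ge0.
rewrite integral_cst//; apply: (le_trans (leeD2r _ K)).
rewrite -[nu (cube a l)](fineK nuQf) -/Q -!EFinM -EFinD lee_fin.
have D30 : (0 <= (1 + D) * D ^+ 3)%R.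
  by rewrite mulr_ge0 ?exprn_ge0 ?addr_ge0// ltW.
rewrite [((1 + D) * _)%R]mulrA (powRM _ D30 (ltW m0)).
rewrite (powRM _ (exprn_ge0 3 (ltW D0)) (ltW m0)) /A1_cst.
by rewrite le_eqVlt; apply/orP; left; apply/eqP; ring.
Qed.

End maximal_estimates.

(** * Product weights on a single cube *)

Section integral_facts.
Context d (T : measurableType d) (R : realType) (mu : {measure set T -> \bar R}).

Lemma ae_exists (A : set T) (P : T -> Prop) : measurable A -> 0 < mu A ->
  {ae mu, forall x, A x -> P x} -> exists2 x, A x & P x.
Proof.
move=> mA A0 [N [mN N0 NP]]; apply: contrapT => nex.
have AN : A `<=` N.
  move=> x Ax; apply: NP => /= /(_ Ax) Px; apply: nex; by exists x.
have : mu A <= mu N by rewrite le_measure ?inE.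
by rewrite N0 leNgt A0.
Qed.

Lemma integral_pos_gt0 (A : set T) (f : T -> \bar R) : measurable A ->
  measurable_fun A f -> (forall x, A x -> 0 < f x) -> 0 < mu A ->
  0 < \int[mu]_(x in A) f x.
Proof.
move=> mA mf f0 A0; rewrite lt_neqAle integral_ge0 ?andbT; last first.
  by move=> x /f0/ltW.
apply/eqP => I0.
have : \int[mu]_(x in A) `|f x| = 0.
  by rewrite I0; apply: eq_integral => x /[1!inE] /f0/ltW/gee0_abs.
move=> /(ae_eq_integral_abs mu mA mf) /(ae_exists mA A0)[x Ax fx].
by have := f0 _ Ax; rewrite fx ltxx.
Qed.

End integral_facts.

Section weight_products.
Context (R : realType).

Lemma powR_le1D (X a b : R) : (0 <= X)%R -> (0 <= a <= b)%R ->
  (X `^ a <= 1 + X `^ b)%R.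
Proof.
move=> X0 /andP[a0 ab]; have [X1|X1] := leP 1%R X.
  by apply: (le_trans (ler_powR X1 ab)); rewrite lerDr.
apply: (@le_trans _ _ 1%R); last by rewrite lerDl powR_ge0.
have [->|Xn0] := eqVneq X 0%R.
  by rewrite /powR eqxx; case: (a == 0%R).
by rewrite -(powRr0 X) ger_powR// lt_neqAle eq_sym Xn0 X0 ltW.
Qed.

Lemma mulr3_le_exp3 (x y z : R) : (0 <= x)%R -> (0 <= y)%R -> (0 <= z)%R ->
  (x * y * z <= x ^+ 3 + y ^+ 3 + z ^+ 3)%R.
Proof.
move=> x0 y0 z0; pose m := Num.max x (Num.max y z).
have xm : (x <= m)%R by rewrite le_max lexx.
have ym : (y <= m)%R by rewrite !le_max lexx orbT.
have zm : (z <= m)%R by rewrite !le_max lexx !orbT.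
apply: (@le_trans _ _ (m ^+ 3)%R).
  by rewrite !exprS expr0 mulr1 mulrA !ler_pM// mulr_ge0.
have p3 t : (0 <= t -> 0 <= t ^+ 3 :> R)%R by move=> ?; exact: exprn_ge0.
have := p3 _ x0; have := p3 _ y0; have := p3 _ z0.
by rewrite /m; case: (leP x _) => _; [case: (leP y z) => _|]; lra.
Qed.

(** A product of three small powers is bounded by a sum of powers whose
    averages are known, through xyz <= x^3 + y^3 + z^3 and
    X^a <= 1 + X^b. *)
Lemma weight_pointwise (U V W p g s eta kap : R) :
  (0 <= U)%R -> (0 <= V)%R -> (0 <= W)%R -> (0 <= p)%R -> (0 <= g)%R -> (0 < s)%R ->
  (3 * (p * s) <= eta)%R -> (3 * (s + g * s) <= kap)%R -> (3 * (g * s) <= 1)%R ->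
  (U `^ (p * s) * V `^ s * (W * V) `^ (g * s) <=
   3 + U `^ eta + V `^ kap + W)%R.
Proof.
move=> U0 V0 W0 p0 g0 s0 h1 h2 h3.
have gs0 : (0 <= g * s)%R by rewrite mulr_ge0// ltW.
have ps0 : (0 <= p * s)%R by rewrite mulr_ge0// ltW.
have -> : (U `^ (p * s) * V `^ s * (W * V) `^ (g * s) =
    U `^ (p * s) * V `^ (s + g * s) * W `^ (g * s))%R.
  rewrite powRM// powRD; last by apply/implyP => /eqP; lra.
  ring.
apply: (le_trans (mulr3_le_exp3 _ _ _)); rewrite ?powR_ge0//.
rewrite -!powR_mulrn ?powR_ge0// -!powRrM.
have := @powR_le1D U (p * s * 3%:R) eta U0.
have := @powR_le1D V ((s + g * s) * 3%:R) kap V0.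
have := @powR_le1D W (g * s * 3%:R) 1 W0.
rewrite powRr1// => H1 H2 H3.
have {}H1 := H1 ltac:(by apply/andP; split; lra).
have {}H2 := H2 ltac:(by apply/andP; split; lra).
have {}H3 := H3 ltac:(by apply/andP; split; lra).
lra.
Qed.

End weight_products.

Section weight_on_cube.
Context d (T : measurableType d) (R : realType) (mu : {measure set T -> \bar R}).
Variables (Q : set T) (L : R) (u v A B : T -> R).
Variables (p g s eta kap S I KU KV CA CB : R).
Hypotheses (mQ : measurable Q) (L0 : (0 < L)%R) (QL : mu Q = L%:E).
Hypotheses (mu_ : measurable_fun setT u) (mv : measurable_fun setT v).
Hypotheses (mA : measurable_fun setT A) (mB : measurable_fun setT B).
Hypotheses (u0 : forall x, (0 < u x)%R) (v0 : forall x, (0 < v x)%R).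
Hypotheses (A0 : forall x, (0 < A x)%R) (B0 : forall x, (0 < B x)%R).
Hypotheses (p0 : (0 <= p)%R) (g0 : (0 <= g)%R) (s0 : (0 < s)%R).
Hypotheses (h1 : (3 * (p * s) <= eta)%R) (h2 : (3 * (s + g * s) <= kap)%R).
Hypotheses (h3 : (3 * (g * s) <= 1)%R).
Hypotheses (S0 : (0 < S)%R) (uS : {ae mu, forall x, Q x -> (u x <= S)%R}).
Hypothesis (I0 : (0 < I)%R).
Hypotheses (HU : \int[mu]_(x in Q) ((S / u x) `^ eta)%:E <= (KU * L)%:E).
Hypotheses (HV : \int[mu]_(x in Q) ((I / L / v x) `^ kap)%:E <= (KV * L)%:E).
Hypotheses (KU0 : (0 <= KU)%R) (KV0 : (0 <= KV)%R).
Hypotheses (CA0 : (0 < CA)%R) (CB0 : (0 < CB)%R).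
Hypotheses (HA : {ae mu, forall y, Q y ->
  \int[mu]_(x in Q) (A x * v x)%:E <= (CA * A y * I)%:E}).
Hypotheses (HB : {ae mu, forall y, Q y ->
  \int[mu]_(x in Q) (B x * v x)%:E <= (CB * B y * I)%:E}).

Definition product_weight x : R := (u x `^ p * v x * A x * B x `^ (- g))%R.

Let mQE (f : T -> R) : measurable_fun setT f ->
  measurable_fun Q (fun x => (f x)%:E).
Proof. by move=> mf; apply/measurable_EFinP; exact: measurable_funTS. Qed.

Let mpow (f : T -> R) (e : R) : measurable_fun setT f ->
  measurable_fun setT (fun x => f x `^ e)%R.
Proof. by move=> mf; exact: measurableT_comp (measurable_powR e) mf. Qed.

Let minv (f : T -> R) : measurable_fun setT f -> (forall x, 0 < f x)%R ->
  measurable_fun setT (fun x => (f x)^-1)%R.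
Proof.
move=> mf f0; rewrite (_ : (fun _ => _) = (fun x => f x `^ (-1))%R).
  exact: mpow.
by apply/funext => x; rewrite powR_inv1// ltW.
Qed.

Let Q0 : 0 < mu Q. Proof. by rewrite QL lte_fin. Qed.

Let average (X : T -> R) (C : R) : measurable_fun setT X ->
  (forall x, (0 < X x)%R) -> (0 < C)%R ->
  {ae mu, forall y, Q y -> \int[mu]_(x in Q) (X x * v x)%:E <= (C * X y * I)%:E} ->
  exists2 X' : R, (0 < X')%R & \int[mu]_(x in Q) (X x * v x)%:E = (X' * I)%:E.
Proof.
move=> mX X0 C0 HX; set J := \int[mu]_(x in Q) _ in HX *.
have Jf : J < +oo.
  by have [y Qy] := ae_exists mQ Q0 HX => /le_lt_trans; apply; exact: ltry.
have J0 : 0 < J.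
  apply: integral_pos_gt0 => //; first exact/mQE/measurable_funM.
  by move=> x _; rewrite lte_fin mulr_gt0.
exists (fine J / I)%R; first by rewrite divr_gt0// fine_gt0// J0.
by rewrite divfK ?gt_eqF// fineK// ge0_fin_numE// ltW.
Qed.

(** Let [S] bound [u], let [m = I / L] be the average of [v], and let [A'], [B']
    be the averages of [A], [B] with respect to [v] dx.  The A_1 inequalities
    bound [A] and [B] from below by multiples of [A'] and [B'].  In [w] itself,
    [u] is replaced by [S] and [B] by [B'], and the integral of [A v] remains.
    In the power [- s] of [w], [A] is replaced by [A'], and [weight_pointwise]
    applies to U = S / u, V = m / v and W = B v / (B' m), which have bounded
    averages of U^eta, V^kap and W.  The powers of [S], [m], [A'], [B']
    cancel in the product of the two bounds. *)
Lemma product_weight_bound : exists c1 c2 : R,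
  [/\ (0 <= c1)%R, (0 <= c2)%R,
   \int[mu]_(x in Q) (product_weight x)%:E <= (c1 * L)%:E,
   \int[mu]_(x in Q) (product_weight x `^ (- s))%:E <= (c2 * L)%:E &
   (c1 * c2 `^ s^-1 <= CB `^ g * CA * (4 + KU + KV) `^ s^-1)%R].
Proof.
have [A' A'0 AA'] := average mA A0 CA0 HA.
have [B' B'0 BB'] := average mB B0 CB0 HB.
have Age : {ae mu, forall y, Q y -> (A' / CA <= A y)%R}.
  apply: filterS HA => y /[apply]; rewrite AA' lee_fin ler_pM2r//.
  by rewrite ler_pdivrMr// mulrC.
have Bge : {ae mu, forall y, Q y -> (B' / CB <= B y)%R}.
  apply: filterS HB => y /[apply]; rewrite BB' lee_fin ler_pM2r//.
  by rewrite ler_pdivrMr// mulrC.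
have [m m0 mE] : exists2 m : R, (0 < m)%R & m = (I / L)%R.
  by exists (I / L)%R => //; exact: divr_gt0.
have HV' := HV; rewrite -mE in HV'.
pose M := (S `^ p * m * A' * B' `^ (- g))%R.
have M0 : (0 < M)%R by rewrite /M !mulr_gt0 ?powR_gt0 ?invr_gt0.
pose KK := (4 + KU + KV)%R.
have KK0 : (0 < KK)%R by rewrite /KK ltr_wpDr// ltr_wpDr.
have powN (b C : R) : (0 < b)%R -> (0 < C)%R ->
    ((b / C) `^ (- g) = b `^ (- g) * C `^ g)%R.
  move=> b0 C0; rewrite powRM ?invr_ge0 ?(ltW b0) ?(ltW C0)//; congr (_ * _)%R.
  by rewrite -powR_inv1 ?ltW// -powRrM mulN1r opprK.
have w0 x : (0 < product_weight x)%R by rewrite /product_weight !mulr_gt0 ?powR_gt0.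
have mw : measurable_fun setT product_weight.
  by rewrite /product_weight; apply: measurable_funM;
    [apply: measurable_funM => //; apply: measurable_funM => //|]; exact: mpow.
exists (M * CB `^ g)%R, (M `^ (- s) * CA `^ s * KK)%R; split.
- by rewrite mulr_ge0 ?powR_ge0// ltW.
- by rewrite !mulr_ge0 ?powR_ge0// ltW.
- apply: (@le_trans _ _ (\int[mu]_(x in Q)
      ((S `^ p * (B' / CB) `^ (- g))%:E * (A x * v x)%:E))).
    apply: ae_ge0_le_integral => //.
    + by move=> x _; rewrite lee_fin ltW.
    + exact: mQE.
    + by move=> x _; rewrite -EFinM lee_fin !mulr_ge0 ?powR_ge0// ltW.
    + by apply: emeasurable_funM => //; exact/mQE/measurable_funM.
    near=> x => Qx; rewrite -EFinM lee_fin /product_weight.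
    have ux : (u x <= S)%R by move: Qx; near: x; exact: uS.
    have Bx : (B' / CB <= B x)%R by move: Qx; near: x; exact: Bge.
    have -> : (u x `^ p * v x * A x * B x `^ (- g) =
       u x `^ p * B x `^ (- g) * (A x * v x))%R by ring.
    rewrite ler_wpM2r ?mulr_ge0 ?(ltW (A0 _)) ?(ltW (v0 _))//.
    rewrite ler_pM ?powR_ge0//.
      by rewrite ge0_ler_powR ?nnegrE ?(ltW S0) ?(ltW (u0 _)).
    rewrite !powRN lef_pV2 ?posrE ?powR_gt0 ?divr_gt0//.
    by rewrite ge0_ler_powR ?nnegrE ?(ltW (B0 _)) ?divr_ge0 ?(ltW B'0) ?(ltW CB0).
  rewrite ge0_integralZl//; last 3 first.
  + exact/mQE/measurable_funM.
  + by move=> x _; rewrite lee_fin mulr_ge0// ltW.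
  + by rewrite lee_fin mulr_ge0 ?powR_ge0.
  rewrite AA' -EFinM lee_fin powN// /M mE le_eqVlt; apply/orP; left; apply/eqP.
  by field; rewrite gt_eqF.
- pose U x := (S / u x)%R; pose V x := (m / v x)%R.
  pose W x := (B x * v x / (B' * m))%R.
  have mU : measurable_fun setT U by apply: measurable_funM => //; exact: minv.
  have mV : measurable_fun setT V by apply: measurable_funM => //; exact: minv.
  have mW : measurable_fun setT W.
    by apply: measurable_funM => //; exact: measurable_funM.
  have U0 x : (0 < U x)%R by rewrite divr_gt0.
  have V0 x : (0 < V x)%R by rewrite divr_gt0.
  have W0 x : (0 < W x)%R.
    by apply: divr_gt0; exact: mulr_gt0.
  have WV x : (W x * V x = B x / B')%R.
    by rewrite /W /V; field; rewrite !gt_eqF.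
  pose c := (M `^ (- s) * CA `^ s)%R.
  have c0 : (0 <= c)%R by rewrite mulr_ge0 ?powR_ge0.
  have IW : \int[mu]_(x in Q) (W x)%:E = L%:E.
    under eq_integral => x _ do rewrite /W mulrC EFinM.
    rewrite ge0_integralZl//; last 3 first.
    + exact/mQE/measurable_funM.
    + by move=> x _; rewrite lee_fin mulr_ge0// ltW.
    + by rewrite lee_fin invr_ge0 mulr_ge0// ltW.
    rewrite BB' -EFinM; congr EFin; rewrite mE; field.
    by rewrite !gt_eqF.
  apply: (@le_trans _ _ (\int[mu]_(x in Q) (c%:E *
      (3%:E + ((U x `^ eta)%:E + ((V x `^ kap)%:E + (W x)%:E)))))).
    apply: ae_ge0_le_integral => //.
    + by move=> x _; rewrite lee_fin powR_ge0.
    + exact/mQE/mpow.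
    + move=> x _; rewrite -!EFinD -EFinM lee_fin mulr_ge0// !addr_ge0 ?powR_ge0//.
      exact: ltW.
    + by apply: emeasurable_funM => //; do 3 (apply: emeasurable_funD => //;
        try exact/mQE/mpow); exact: mQE.
    near=> x => Qx; rewrite -!EFinD -EFinM lee_fin.
    have Ax : (A' / CA <= A x)%R by move: Qx; near: x; exact: Age.
    have := weight_pointwise (ltW (U0 x)) (ltW (V0 x)) (ltW (W0 x)) p0 g0 s0 h1 h2 h3.
    rewrite WV => H.
    apply: (@le_trans _ _ (c * (U x `^ (p * s) * V x `^ s * (B x / B') `^ (g * s)))%R);
      last by rewrite ler_wpM2l//; lra.
    have -> : (c * (U x `^ (p * s) * V x `^ s * (B x / B') `^ (g * s)) =
       (u x `^ p * v x * (A' / CA) * B x `^ (- g)) `^ (- s))%R.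
      have vi : ((v x)^-1 `^ s = v x `^ (- s))%R.
        by rewrite -powR_inv1 ?(ltW (v0 _))// -powRrM mulN1r.
      have inv_pow (b e : R) : (0 < b)%R -> ((b^-1) `^ e = b `^ (- e))%R.
        by move=> b0; rewrite -powR_inv1 ?(ltW b0)// -powRrM mulN1r.
      rewrite /c /M /U /V !powRM ?mulr_ge0 ?powR_ge0 ?invr_ge0 ?(ltW S0) ?(ltW m0)
        ?(ltW A'0) ?(ltW B'0) ?(ltW CA0) ?(ltW (u0 _)) ?(ltW (v0 _)) ?(ltW (B0 _))
        ?divr_ge0 ?(ltW A'0) ?(ltW CA0)//.
      rewrite -!powRrM !inv_pow// !opprK !mulrN !mulNr !opprK.
      have SS : (S `^ (- (p * s)) * S `^ (p * s) = 1)%R.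
        by rewrite powRN mulVf// gt_eqF// powR_gt0.
      have mm : (m `^ (- s) * m `^ s = 1)%R.
        by rewrite powRN mulVf// gt_eqF// powR_gt0.
      have BB : (B' `^ (g * s) * B' `^ (- (g * s)) = 1)%R.
        by rewrite powRN mulfV// gt_eqF// powR_gt0.
      transitivity (S `^ (- (p * s)) * S `^ (p * s) * (m `^ (- s) * m `^ s) *
        (B' `^ (g * s) * B' `^ (- (g * s))) * (A' `^ (- s) * CA `^ s *
        u x `^ (- (p * s)) * v x `^ (- s) * B x `^ (g * s)))%R; first by ring.
      by rewrite SS mm BB; ring.
    rewrite !(powRN _ s) lef_pV2 ?posrE ?powR_gt0 ?mulr_gt0 ?powR_gt0 ?divr_gt0 ?invr_gt0//.
    apply: ge0_ler_powR; rewrite ?nnegrE; [exact: ltW| |exact: ltW|].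
      by apply: ltW; rewrite !mulr_gt0 ?powR_gt0 ?invr_gt0.
    rewrite /product_weight ler_wpM2r ?powR_ge0// ler_wpM2l// mulr_ge0 ?powR_ge0//.
    exact: ltW.
  have mf1 : measurable_fun Q (fun x => (U x `^ eta)%:E) by exact/mQE/mpow.
  have mf2 : measurable_fun Q (fun x => (V x `^ kap)%:E) by exact/mQE/mpow.
  have mf3 : measurable_fun Q (fun x => (W x)%:E) by exact: mQE.
  have mf23 := emeasurable_funD mf2 mf3.
  have mf123 := emeasurable_funD mf1 mf23.
  have mf0123 := emeasurable_funD (@measurable_cst _ _ _ _ Q (3 : \bar R)) mf123.
  have n1 x : Q x -> 0 <= (U x `^ eta)%:E by rewrite lee_fin powR_ge0.
  have n2 x : Q x -> 0 <= (V x `^ kap)%:E by rewrite lee_fin powR_ge0.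
  have n3 x : Q x -> 0 <= (W x)%:E by move=> _; rewrite lee_fin ltW.
  have n23 x : Q x -> 0 <= (V x `^ kap)%:E + (W x)%:E.
    by move=> Qx; rewrite adde_ge0 ?n2 ?n3.
  have n123 x : Q x -> 0 <= (U x `^ eta)%:E + ((V x `^ kap)%:E + (W x)%:E).
    by move=> Qx; rewrite adde_ge0 ?n1 ?n23.
  have n0123 x : Q x ->
      0 <= 3%:E + ((U x `^ eta)%:E + ((V x `^ kap)%:E + (W x)%:E)).
    by move=> Qx; rewrite adde_ge0 ?n123.
  rewrite ge0_integralZl//.
  rewrite ge0_integralD// integral_cst// ge0_integralD// ge0_integralD//.
  rewrite IW QL.
  apply: (@le_trans _ _ (c%:E * (3%:E * L%:E + ((KU * L)%:E + ((KV * L)%:E + L%:E))))).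
    by rewrite lee_wpmul2l ?lee_fin// leeD2l// leeD// leeD2r.
  rewrite -!EFinM lee_fin /c /KK le_eqVlt; apply/orP; left.
  by apply/eqP; ring.
- have Ms : ((M `^ (- s)) `^ s^-1 = M^-1)%R.
    by rewrite -powRrM mulNr divff ?gt_eqF// powR_inv1// ltW.
  have CAs : ((CA `^ s) `^ s^-1 = CA)%R.
    by rewrite -powRrM divff ?gt_eqF// powRr1// ltW.
  rewrite powRM ?mulr_ge0 ?powR_ge0 ?(ltW KK0)// powRM ?powR_ge0// Ms CAs.
  rewrite le_eqVlt; apply/orP; left; apply/eqP; rewrite /KK.
  by field; rewrite gt_eqF.
Unshelve. all: by end_near. Qed.

End weight_on_cube.

(** * Stopping times on nested partitions *)

Section dyadic.
Context d (T : measurableType d) (R : realType) (mu : {measure set T -> \bar R}).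

Lemma le_measure_partition (F : nat -> set T) (A B : set T) (c : R) :
  measurable A -> measurable B -> (forall i, measurable (F i)) ->
  trivIset setT F -> A `<=` \bigcup_i F i -> (0 <= c)%R ->
  (forall i, mu (A `&` F i) <= c%:E * mu (B `&` F i)) -> mu A <= c%:E * mu B.
Proof.
move=> mA mB mF tF AF c0 H.
have -> : A = \bigcup_i (A `&` F i) by rewrite -setI_bigcupr; apply/esym/setIidPl.
have mI X i : measurable X -> measurable (X `&` F i).
  by move=> mX; exact: measurableI.
have tI X : trivIset setT (fun i => X `&` F i) by exact: trivIset_setIl.
rewrite measure_bigcup//; last by move=> i _; exact: mI.
apply: (@le_trans _ _ (\sum_(i <oo) (c%:E * mu (B `&` F i)))).
  by under eq_eseriesl do rewrite in_setT; apply: lee_nneseries => // i _; exact: H.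
rewrite nneseriesZl// lee_wpmul2l ?lee_fin//.
have -> : \sum_(i <oo) mu (B `&` F i) = mu (\bigcup_i (B `&` F i)).
  rewrite measure_bigcup//; last by move=> i _; exact: mI.
  by apply: eq_eseriesl => i; rewrite in_setT.
rewrite le_measure ?inE//; first by apply: bigcupT_measurable => i; exact: mI.
by move=> x [i _ []].
Qed.

(* [kap m x] is the number of the cell of generation [m] that contains [x]. *)
Variable kap : nat -> T -> nat.
Hypothesis mkap : forall m i, measurable [set x | kap m x = i].
Hypothesis kapS : forall m x y, kap m.+1 x = kap m.+1 y -> kap m x = kap m y.
Variable Q : set T.
Hypothesis Q0 : exists i0, Q = [set x | kap 0 x = i0].
Hypothesis Qfin : mu Q < +oo.
Hypothesis approx : forall (A : set T) (e : R), measurable A -> A `<=` Q ->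
  (0 < e)%R -> exists m (S : set nat),
    mu (A `\` [set x | Q x /\ S (kap m x)]) <= e%:E /\
    mu ([set x | Q x /\ S (kap m x)] `\` A) <= e%:E.

Local Notation cell m x := [set y | kap m y = kap m x].

Let kap_le m k x y : (k <= m)%N -> kap m x = kap m y -> kap k x = kap k y.
Proof.
elim: m => [|m IH]; first by rewrite leqn0 => /eqP ->.
by rewrite leq_eqVlt => /predU1P[->//|]; rewrite ltnS => km /kapS; exact: IH.
Qed.

Let mQ : measurable Q. Proof. by case: Q0 => i0 ->. Qed.

Let mpre m (S : set nat) : measurable [set x | S (kap m x)].
Proof.
rewrite (_ : [set x | _] = \bigcup_(i in S) [set x | kap m x = i]).
  exact: bigcup_measurable.
by apply/seteqP; split => [x Sx|x [i Si /= xi]]; [exists (kap m x)|rewrite /= xi].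
Qed.

Let triv m : trivIset setT (fun i => [set x | kap m x = i]).
Proof.
apply/trivIsetP => i j _ _ ij; apply/seteqP; split => x //= -[xi xj].
by move: ij; rewrite -xi -xj eqxx.
Qed.

Let covers m (A : set T) : A `<=` \bigcup_i [set x | kap m x = i].
Proof. by move=> x _; exists (kap m x). Qed.

Let Qcell x : Q x -> Q = cell 0 x.
Proof. by case: Q0 => i0 QE; rewrite QE => /= xi; rewrite xi. Qed.

Let cellQ m x : Q x -> cell m x `<=` Q.
Proof. by move=> Qx y /= yx; rewrite (Qcell Qx)/=; exact: kap_le (leq0n m) yx. Qed.

(** Approximate the exceptional set E' by a union D of cells of one generation.
    In each cell that it meets, E' fills less than the fraction [th], hence
    mu E' is at most [th] mu D up to a small error; and mu D is close to
    mu E'. *)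
Lemma dyadic_density (E : set T) (th : R) : measurable E -> E `<=` Q ->
  (0 <= th < 1)%R ->
  mu [set x | E x /\ forall m, mu (E `&` cell m x) < th%:E * mu (cell m x)] = 0.
Proof.
move=> mE EQ /andP[th0 th1]; set E' := [set x | _].
have mE' : measurable E'.
  have -> : E' = E `&` \bigcap_m [set x | [set i |
      mu (E `&` [set y | kap m y = i]) < th%:E * mu [set y | kap m y = i]] (kap m x)].
    by apply/seteqP; split => [x [Ex H]|x [Ex H]]; split => // m; [move=> _|]; exact: H.
  by apply: measurableI => //; apply: bigcapT_measurable => m; exact: mpre.
have E'Q : E' `<=` Q by move=> x [/EQ].
have E'fin : mu E' \is a fin_num.
  rewrite ge0_fin_numE//; apply: le_lt_trans Qfin; by rewrite le_measure ?inE.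
have key m (S : set nat) : mu (E' `&` [set x | Q x /\ S (kap m x)]) <=
    th%:E * mu [set x | Q x /\ S (kap m x)].
  have mD : measurable [set x | Q x /\ S (kap m x)].
    by apply: measurableI => //; exact: mpre.
  apply: (le_measure_partition (F := fun i => [set x | kap m x = i])) => //.
    exact: measurableI.
  move=> i; have [[x [[E'x [Qx Sx]] xi]]|none] :=
    pselect ((E' `&` [set x | Q x /\ S (kap m x)] `&` [set x | kap m x = i]) !=set0).
    have -> : [set x | Q x /\ S (kap m x)] `&` [set x | kap m x = i] = cell m x.
      apply/seteqP; split => [y [_ /=]|y yx]; first by rewrite xi.
      split; last by rewrite /= -xi.
      by split; [exact: cellQ Qx _ yx|rewrite yx].
    apply: le_trans (ltW (E'x.2 m)); rewrite le_measure ?inE//.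
    - by apply: measurableI => //; exact: measurableI.
    - exact: measurableI.
    - by move=> y [[[Ey _] _] /= ->]; split => //=; rewrite xi.
  have -> : E' `&` [set x | Q x /\ S (kap m x)] `&` [set x | kap m x = i] = set0.
    by apply/eqP/negPn/negP => /set0P.
  by rewrite measure0 mule_ge0.
suff : mu E' <= th%:E * mu E'.
  rewrite -[mu E'](fineK E'fin) -EFinM lee_fin => H.
  have : (0 <= fine (mu E'))%R by exact: fine_ge0.
  by move=> H0; congr EFin; nra.
apply/lee_addgt0Pr => e e0.
have [m [S [AD DA]]] := approx mE' E'Q (divr_gt0 e0 (ltr0n R 2)).
pose D := [set x | Q x /\ S (kap m x)].
have mD : measurable D by apply: measurableI => //; exact: mpre.
apply: (@le_trans _ _ (mu (E' `&` D) + (e / 2)%:E)).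
  rewrite -[X in mu X <= _](setUIDK E' D) (le_trans (measureU2 _ _ _))//.
  - exact: measurableI.
  - exact: measurableD.
  - by rewrite leeD2l.
apply: (@le_trans _ _ (th%:E * (mu E' + (e / 2)%:E) + (e / 2)%:E)).
  rewrite leeD2r// (le_trans (key _ _))// lee_wpmul2l ?lee_fin//.
  rewrite -[X in mu X <= _](setUIDK D E') (le_trans (measureU2 _ _ _))//.
  - exact: measurableI.
  - exact: measurableD.
  - by rewrite leeD// le_measure ?inE//; exact: measurableI.
rewrite -[mu E'](fineK E'fin) -?(EFinD, EFinM) lee_fin.
have e20 : (0 < e / 2)%R by rewrite divr_gt0.
have : (th * (e / 2) <= e / 2)%R by rewrite ler_piMl// ltW.
by lra.
Qed.

(** Almost every point of [E] lies in a cell that [E] fills to the fraction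
    [th], by [dyadic_density].  Take the first generation where this happens:
    the parent cell is filled less, and lies in [F] up to a null set.  Such
    parents, with the largest ones selected, are disjoint and cover almost all of [E]. *)
Lemma dyadic_stopping (E F : set T) (th : R) : measurable E -> measurable F ->
  E `<=` Q -> (0 <= th < 1)%R -> mu E < th%:E * mu Q ->
  (forall m x, Q x -> th%:E * mu (cell m.+1 x) <= mu (E `&` cell m.+1 x) ->
     mu (cell m x `\` F) = 0) ->
  mu E <= th%:E * mu F.
Proof.
move=> mE mF EQ th01 E0 good; have /andP[th0 th1] := th01.
pose small m i := mu (E `&` [set y | kap m y = i]) < th%:E * mu [set y | kap m y = i]
  /\ mu ([set y | kap m y = i] `\` F) = 0.
pose P m := [set x | small m (kap m x)].
have mP m : measurable (P m) by exact: (mpre m (small m)).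
pose P' := seqDU P.
have mP' m : measurable (P' m).
  by apply: measurableD => //; exact: bigsetU_measurable.
have satP' m x y : kap m x = kap m y -> P' m x -> P' m y.
  move=> xy; rewrite /P' /seqDU => -[Px nPx]; split.
    by move: Px; rewrite /P/= xy.
  apply: contra_not nPx; rewrite -!bigcup_mkord => -[k /= km Pk]; exists k => //.
  by move: Pk; rewrite /P/= (kap_le (ltnW km) xy).
have EP : E `<=` \bigcup_m P' m `|`
    [set x | E x /\ forall m, mu (E `&` cell m x) < th%:E * mu (cell m x)].
  move=> x Ex; rewrite /P' -seqDU_bigcup_eq.
  have [H|/existsNP/cid[m0 /negP]] := pselect
    (forall m, mu (E `&` cell m x) < th%:E * mu (cell m x)); first by right.
  rewrite -leNgt => m0g; left.
  pose b : pred nat := fun m => th%:E * mu (cell m x) <= mu (E `&` cell m x).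
  have ex : exists m, b m by exists m0.
  case: (ex_minnP ex) => -[|m] mg minm.
    move: mg; rewrite /b -(Qcell (EQ _ Ex)) (setIidl EQ) leNgt; by rewrite E0.
  exists m => //; split; last exact: good (EQ _ Ex) mg.
  by rewrite ltNge; apply/negP => H; have := minm m H; rewrite ltnn.
have ED := dyadic_density mE EQ th01.
set E' := [set x | _] in EP ED.
have mE' : measurable E'.
  have -> : E' = E `&` \bigcap_m [set x | [set i |
      mu (E `&` [set y | kap m y = i]) < th%:E * mu [set y | kap m y = i]] (kap m x)].
    by apply/seteqP; split => [x [Ex H]|x [Ex H]]; split => // m; [move=> _|]; exact: H.
  by apply: measurableI => //; apply: bigcapT_measurable => m; exact: mpre.
have mUP' : measurable (\bigcup_m P' m) by exact: bigcupT_measurable.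
apply: (@le_trans _ _ (mu ((E `&` \bigcup_m P' m) `|` E'))).
  rewrite le_measure ?inE//; first by apply: measurableU => //; exact: measurableI.
  by move=> x Ex; have [?|?] := EP _ Ex; [left|right].
apply: (le_trans (measureU2 _ _ _)) => //; first exact: measurableI.
rewrite [X in _ + X](_ : _ = 0) ?adde0; last exact: ED.
apply: (le_measure_partition (F := P')) => //; first exact: measurableI.
  by apply/trivIsetP => i j _ _ ij; have /trivIsetP := @trivIset_seqDU _ P; exact.
move=> m; apply: (le_measure_partition (F := fun i => [set x | kap m x = i])) => //.
- by apply: measurableI => //; exact: measurableI.
- exact: measurableI.
move=> i; have [[x [P'x xi]]|none] := pselect ((P' m `&` [set x | kap m x = i]) !=set0).
  have cellP : [set x | kap m x = i] `<=` P' m.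
    by move=> y /= yi; apply: satP' P'x; rewrite xi.
  have [[Px1 Px2] _] := P'x.
  rewrite -[in X in _ <= X]setIA (setIidr cellP).
  apply: (@le_trans _ _ (mu (E `&` [set y | kap m y = kap m x]))).
    rewrite le_measure ?inE//; last by move=> y [[[Ey _] _] /= ->]; split.
    - by do 3?[apply: measurableI => //].
    - exact: measurableI.
  apply: (le_trans (ltW Px1)); rewrite lee_wpmul2l ?lee_fin// xi setIC.
  rewrite -[X in mu X <= _](setUIDK [set y | kap m y = i] F).
  apply: (le_trans (measureU2 _ _ _)).
  - exact: measurableI.
  - exact: measurableD.
  - rewrite [X in _ + X](_ : _ = 0) ?adde0; last by rewrite -xi; exact: Px2.
    by rewrite setIC.
have -> : E `&` \bigcup_m0 P' m0 `&` P' m `&` [set x | kap m x = i] = set0.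
  rewrite -setIA (_ : P' m `&` _ = set0) ?setI0//.
  by apply/eqP/negPn/negP => /set0P.
by rewrite measure0 mule_ge0.
Qed.

End dyadic.

(** * Negative powers of reverse Hoelder weights *)

Section dyadic_cells.
Context d (T : measurableType d) (R : realType) (n : nat).
Variables (co : 'I_n -> T -> R) (mco : forall i, measurable_fun setT (co i)).
Variables (a : 'I_n -> R) (l : R).
Hypothesis l0 : (0 < l)%R.
Local Notation cube := (cube co).

Definition dfloor m x (i : 'I_n) : int := Num.floor ((co i x - a i) * 2 ^+ m / l)%R.

Definition dindex (m : nat) (x : T) : nat := pickle [ffun i => dfloor m x i].

Definition dcorner m x (i : 'I_n) : R := (a i + (dfloor m x i)%:~R * (l / 2 ^+ m))%R.

Definition dcube m x : set T := cube (dcorner m x) (l / 2 ^+ m)%R.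

Let h0 m : (0 < l / 2 ^+ m)%R. Proof. by rewrite divr_gt0// exprn_gt0. Qed.

Lemma dindexP m x y : dindex m x = dindex m y <-> dfloor m x =1 dfloor m y.
Proof.
split=> [/(pcan_inj pickleK)/ffunP H i|H]; first by have := H i; rewrite !ffunE.
by rewrite /dindex; congr pickle; apply/ffunP => i; rewrite !ffunE.
Qed.

Lemma dfloor_itv m x y i : (dfloor m y i = dfloor m x i) <->
  (dcorner m x i <= co i y < dcorner m x i + l / 2 ^+ m)%R.
Proof.
set h := (l / 2 ^+ m)%R.
have hE : ((co i y - a i) * 2 ^+ m / l = (co i y - a i) / h)%R.
  by rewrite /h; field; rewrite !gt_eqF ?exprn_gt0.
have hh : (0 < h)%R by exact: h0.
rewrite /dcorner -/h; set k := dfloor m x i.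
have -> : (dfloor m y i = k) <->
    (k%:~R <= (co i y - a i) / h < (k + 1)%:~R)%R.
  rewrite /dfloor hE; split=> [<-|]; first exact: floor_itv.
  by move=> /floor_def.
rewrite ler_pdivlMr// ltr_pdivrMr// rmorphD/= mulrDl mul1r.
by split=> /andP[? ?]; apply/andP; split; lra.
Qed.

Lemma dcellE m x : [set y | dindex m y = dindex m x] =
  box co (fun i => `[dcorner m x i, (dcorner m x i + l / 2 ^+ m)%R[%classic).
Proof.
apply/seteqP; split => y /=.
  by move=> /dindexP H i; rewrite /= in_itv/=; apply/dfloor_itv.
move=> H; apply/dindexP => i; apply/dfloor_itv.
by have := H i; rewrite /= in_itv.
Qed.

Lemma dcell_dcube m x : [set y | dindex m y = dindex m x] `<=` dcube m x.
Proof.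
by rewrite dcellE => y H i; have := H i; rewrite /= in_itv/= => /andP[-> /ltW].
Qed.

Lemma measurable_dindex m j : measurable [set y | dindex m y = j].
Proof.
have [[x <-]|none] := pselect (exists x, dindex m x = j).
  by rewrite dcellE; apply: (measurable_box mco) => i; exact: measurable_itv.
rewrite (_ : [set y | _] = set0)//; apply/seteqP; split => // y yj.
by apply: none; exists y.
Qed.

Lemma dcubeS m x i : (dcorner m x i <= dcorner m.+1 x i /\
  dcorner m.+1 x i + l / 2 ^+ m.+1 <= dcorner m x i + l / 2 ^+ m)%R.
Proof.
set t := ((co i x - a i) * 2 ^+ m / l)%R.
have E : ((co i x - a i) * 2 ^+ m.+1 / l = 2 * t)%R.
  by rewrite /t exprS; field; rewrite gt_eqF.
rewrite /dcorner /dfloor E -/t.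
have -> : (l / 2 ^+ m.+1 = l / 2 ^+ m / 2)%R.
  by rewrite exprS; field; rewrite !gt_eqF ?exprn_gt0.
have hh := h0 m; set h := (l / 2 ^+ m)%R in hh *.
have h1 : (Num.floor t + Num.floor t <= Num.floor (2 * t)%R)%R.
  by rewrite floor_ge_int rmorphD/=; have := floor_le t; lra.
have h2 : (Num.floor (2 * t)%R <= Num.floor t + Num.floor t + 1)%R.
  rewrite -ltzD1 floor_lt_int !rmorphD/=.
  by have := floorD1_gt t; rewrite rmorphD/=; lra.
move: h1 h2; rewrite -!(ler_int R) !rmorphD/= => h1 h2.
by split; nra.
Qed.

Lemma dindexS m x y : dindex m.+1 x = dindex m.+1 y -> dindex m x = dindex m y.
Proof.
move=> xy; have yx : [set z | dindex m.+1 z = dindex m.+1 y] x by [].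
apply/dindexP => i; apply/dfloor_itv.
move: yx; rewrite dcellE => /(_ i); rewrite /= in_itv/=.
by have [H1 H2] := dcubeS m y i => /andP[? ?]; apply/andP; split; lra.
Qed.

(** The half-open cube, written as a cell of generation 0 so that it can serve
    as the initial cell of the stopping time. *)
Definition halfopen : set T := [set x | dindex 0 x = pickle [ffun i : 'I_n => 0%R : int]].

Lemma halfopenE : halfopen = box co (fun i => `[a i, (a i + l)%R[%classic).
Proof.
have E x i : ((dfloor 0 x i = 0) <-> (a i <= co i x < a i + l))%R.
  rewrite /dfloor expr0 mulr1; split.
    move=> H; have := floor_itv ((co i x - a i) / l); rewrite H add0r.
    by rewrite ler_pdivlMr// ltr_pdivrMr// mul0r mul1r => /andP[? ?]; apply/andP; split; lra.
  move=> /andP[? ?]; apply: floor_def.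
  by rewrite add0r ler_pdivlMr// ltr_pdivrMr// mul0r mul1r; apply/andP; split; lra.
apply/seteqP; split => x /=.
  move=> /(pcan_inj pickleK)/ffunP H i; rewrite /= in_itv/=; apply/E.
  by have := H i; rewrite !ffunE.
move=> H; rewrite /halfopen/= /dindex; congr pickle; apply/ffunP => i; rewrite !ffunE.
by apply/E; have := H i; rewrite /= in_itv.
Qed.

Lemma halfopen_cube : halfopen `<=` cube a l.
Proof.
by rewrite halfopenE => y H i; have := H i; rewrite /= in_itv/= => /andP[-> /ltW].
Qed.

Lemma measurable_halfopen : measurable halfopen.
Proof. exact: measurable_dindex. Qed.

End dyadic_cells.

Section RHinfty_integral.
Context d (T : measurableType d) (R : realType) (n : nat).
Variables (co : 'I_n -> T -> R) (mco : forall i, measurable_fun setT (co i)).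
Local Notation cube := (cube co).
Variable mu : {measure set T -> \bar R}.
Hypothesis mu_cube : forall a l, (0 < l)%R -> mu (cube a l) = (l ^+ n)%:E.
Hypothesis mu_halfopen : forall (a : 'I_n -> R) l, (0 < l)%R ->
  mu (box co (fun i => `[a i, (a i + l)%R[%classic)) = (l ^+ n)%:E.
Hypothesis approx : forall a l, (0 < l)%R ->
  forall (A : set T) (e : R), measurable A -> A `<=` halfopen co a l ->
  (0 < e)%R -> exists m (S : set nat),
    mu (A `\` [set x | halfopen co a l x /\ S (dindex co a l m x)]) <= e%:E /\
    mu ([set x | halfopen co a l x /\ S (dindex co a l m x)] `\` A) <= e%:E.
Variables (u : T -> R) (C : R).
Hypotheses (mu_ : measurable_fun setT u) (u0 : forall x, (0 < u x)%R).
Hypothesis C1 : (1 <= C)%R.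
Hypothesis RH : forall a l, (0 < l)%R -> exists J : R,
  \int[mu]_(x in cube a l) (u x)%:E = J%:E /\
  {ae mu, forall x, cube a l x -> (u x <= C * (J / l ^+ n))%R}.

Let th : R := (1 - (2 * C)^-1)%R.

Let C20 : (0 < 2 * C)%R. Proof. by have := C1; lra. Qed.
Let thge : (2^-1 <= th)%R.
Proof.
rewrite /th; have : ((2 * C)^-1 <= 2^-1)%R by rewrite lef_pV2 ?posrE//; have := C1; lra.
by move=> ?; lra.
Qed.
Let th0 : (0 < th)%R. Proof. by have := thge; lra. Qed.
Let th1 : (th < 1)%R.
Proof. by rewrite /th ltrBlDr ltrDl invr_gt0. Qed.

Let ubound a l s := {ae mu, forall x, cube a l x -> (u x <= s)%R}.

Let mcube a l : measurable (cube a l). Proof. exact: measurable_cube. Qed.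

(** The complement of [G] has at most the fraction 1 / (2 C) of the volume, so
    by the reverse Hoelder inequality it carries at most half of the integral of
    [u].  Thus the average of [u] is at most 2 [s], and [u] at most [C] times
    that. *)
Lemma ess_bound_spread (a : 'I_n -> R) l G s : (0 < l)%R -> measurable G -> G `<=` cube a l ->
  (th * l ^+ n)%:E <= mu G -> (0 <= s)%R ->
  {ae mu, forall x, G x -> (u x <= s)%R} -> ubound a l (2 * C * s)%R.
Proof.
have C1' := C1; move=> l0 mG GQ thG s0 uG; have [J [JE HJ]] := RH a l0.
have L0 : (0 < l ^+ n)%R by exact: exprn_gt0.
set L := (l ^+ n)%R in L0 thG HJ *.
have QL : mu (cube a l) = L%:E by exact: mu_cube.
have GL : mu G <= L%:E by rewrite -QL le_measure ?inE.
have Gf : mu G \is a fin_num by rewrite ge0_fin_numE// (le_lt_trans GL) ?ltry.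
pose g := fine (mu G); have gE : mu G = g%:E by rewrite /g fineK.
have mue A : measurable_fun A (fun x => (u x)%:E).
  by apply/measurable_EFinP; exact: measurable_funTS.
have mD : measurable (cube a l `\` G) by exact: measurableD.
have muD : mu (cube a l `\` G) = (L - g)%:E.
  have Qf : mu (cube a l) < +oo by rewrite QL ltry.
  have -> := measureD (mcube a l) mG Qf.
  by rewrite (setIidr GQ) EFinB -QL -gE.
pose S' := (C * (J / L))%R.
have J0 : (0 <= J)%R by rewrite -lee_fin -JE; apply: integral_ge0 => x _; rewrite lee_fin ltW.
have S'0 : (0 <= S')%R by rewrite !mulr_ge0 ?invr_ge0 ?(ltW L0)//; lra.
have cstI A (c : R) : measurable A -> (0 <= c)%R ->
    {ae mu, forall x, A x -> (u x <= c)%R} ->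
    \int[mu]_(x in A) (u x)%:E <= c%:E * mu A.
  move=> mA c0 HA; rewrite -integral_cst//; apply: ae_ge0_le_integral => //.
  by move=> x _; rewrite lee_fin ltW.
have IG := cstI _ _ mG s0 uG.
have ID : \int[mu]_(x in cube a l `\` G) (u x)%:E <= S'%:E * mu (cube a l `\` G).
  by apply: cstI => //; apply: filterS HJ => x H [Qx _]; exact: H.
have JJ : (J <= s * g + S' * (L - g))%R.
  rewrite -lee_fin -JE -[X in \int[mu]_(x in X) _](setDUK GQ).
  have ge0u x : (G `|` (cube a l `\` G)) x -> 0 <= (u x)%:E.
    by move=> _; rewrite lee_fin ltW.
  have disj : [disjoint G & cube a l `\` G] by rewrite disj_set2E setDIK.
  rewrite (@ge0_integral_setU _ _ _ mu _ _ mG mD _ (mue _) ge0u disj).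
  by rewrite EFinD !EFinM -gE -muD leeD.
have gth : (th * L <= g)%R by rewrite -lee_fin -gE.
have gL : (g <= L)%R by rewrite -lee_fin -gE.
have S'J : (S' * (L - g) <= J / 2)%R.
  apply: (@le_trans _ _ (S' * (L * (2 * C)^-1))%R).
    by rewrite ler_wpM2l//; move: gth; rewrite /th mulrBl mul1r; lra.
  rewrite /S' le_eqVlt; apply/orP; left; apply/eqP; field.
  by rewrite !gt_eqF//; lra.
have J2 : (J <= 2 * s * L)%R.
  have : (s * g <= s * L)%R by rewrite ler_wpM2l.
  by move=> ?; lra.
apply: filterS HJ => x H Qx; apply: (le_trans (H Qx)).
rewrite -mulrA [leRHS]mulrCA ler_wpM2l//; first lra.
by rewrite ler_pdivrMr.
Qed.

(* Scaling a cube by 1 / r keeps at least the fraction [th] of its volume. *)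
Let r : R := (th^-1 `^ (n.+1%:R^-1))%R.

Let r1 : (1 < r)%R.
Proof.
rewrite /r -[ltLHS](powRr0 th^-1) gt1_ltr_powR ?invr_gt0//.
by rewrite invf_gt1.
Qed.

Let rn : (th * r ^+ n <= 1)%R.
Proof.
have r0 : (0 < r)%R by apply: lt_trans r1.
have : (r ^+ n.+1 = th^-1)%R.
  by rewrite /r -powR_mulrn ?powR_ge0// -powRrM mulVf ?pnatr_eq0// powRr1// invr_ge0 ltW.
move=> rS; rewrite -ler_pdivlMl// mulr1 -rS exprS ler_peMl ?exprn_ge0 ?ltW//.
Qed.

(** Between the two cubes one inserts intermediate ones whose sides grow by a
    factor at most [r], and spreads the bound from each to the next. *)
Lemma ess_bound_chain N (a a' : 'I_n -> R) l l' s : (0 < l)%R -> (0 < l')%R -> (0 <= s)%R ->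
  (forall i, a' i <= a i /\ a i + l <= a' i + l')%R -> (l' <= r ^+ N * l)%R ->
  ubound a l s -> ubound a' l' ((2 * C) ^+ N * s)%R.
Proof.
have C1' := C1; have C21 : (1 <= 2 * C)%R by lra.
elim: N a a' l l' s => [|N IH] a a' l l' s l0 l'0 s0 aa' ll' us.
  rewrite expr0 mul1r; move: ll'; rewrite expr0 mul1r => ll'.
  apply: filterS us => x H xQ; apply: H; apply: subset_cube xQ => i.
  by have [? ?] := aa' i; split; lra.
have [l'l|ll] := leP l' l.
  apply: filterS us => x H xQ; apply: (@le_trans _ _ s).
    apply: H; apply: subset_cube xQ => i.
    by have [? ?] := aa' i; split; lra.
  by rewrite ler_peMl// exprn_ege1.
have r0 : (0 < r)%R by apply: lt_trans r1.
pose l2 := Num.max l (l' / r)%R.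
pose a2 i := Num.min (a i) (a' i + l' - l2)%R.
have l2l : (l <= l2)%R by rewrite le_max lexx.
have l2r : (l' <= r * l2)%R by rewrite mulrC -ler_pdivrMr// le_max lexx orbT.
have l2l' : (l2 <= l')%R.
  by rewrite ge_max (ltW ll) ler_pdivrMr// ler_peMr// ltW.
have l20 : (0 < l2)%R by apply: lt_le_trans l2l.
have U2 : ubound a2 l2 ((2 * C) ^+ N * s)%R.
  apply: (IH a a2 l l2 s) => //.
    move=> i; have [? ?] := aa' i; rewrite /a2.
    by case: (leP (a i) (a' i + l' - l2)%R) => ?; split; lra.
  rewrite ge_max; apply/andP; split; first by rewrite ler_peMl ?(ltW l0)// exprn_ege1// ltW.
  by rewrite ler_pdivrMr// mulrAC -exprSr.
rewrite exprS -mulrA; apply: (ess_bound_spread l'0 (mcube a2 l2)) => //.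
- apply: subset_cube => i; have [? ?] := aa' i; rewrite /a2.
  by case: (leP (a i) (a' i + l' - l2)%R) => ?; split; lra.
- rewrite mu_cube// lee_fin.
  apply: (@le_trans _ _ (th * (r ^+ n * l2 ^+ n))%R).
    rewrite ler_pM2l// -exprMn lerXn2r// nnegrE ?mulr_ge0// ltW//.
  by rewrite mulrA ler_piMl// exprn_ge0// ltW.
- by rewrite mulr_ge0// exprn_ge0//; lra.
Qed.

(** If {u < eps^(j+1) S} fills the fraction [th] of a dyadic cell, then u is
    bounded on this cell by a multiple of eps^(j+1) S, and so it is on the
    parent cell; for small [eps] this multiple is less than eps^j S.  Hence
    parents of such cells lie in {u < eps^j S} up to null sets, and the stopping
    time gives a factor [th] between the measures of consecutive sublevel
    sets. *)
Lemma RHinfty_small : exists eps : R, [/\ (0 < eps < 1)%R &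
  forall (a : 'I_n -> R) l J, (0 < l)%R ->
   \int[mu]_(x in cube a l) (u x)%:E = J%:E -> forall j,
   mu (cube a l `&` [set x | (u x < eps ^+ j * (C * (J / l ^+ n)))%R]) <=
     (th ^+ j * l ^+ n)%:E].
Proof.
have C1' := C1; have [N rN] := exprn_unbounded r1 2.
have N0 : (0 < N)%N by case: N rN => //; rewrite expr0 => ?; lra.
pose eps := ((2 * C) ^- N.+1 / 2)%R.
have K0 : (0 < (2 * C) ^+ N.+1)%R by exact: exprn_gt0.
have eps0 : (0 < eps)%R by rewrite divr_gt0// invr_gt0.
have epsC : ((2 * C) ^+ N.+1 * eps = 2^-1)%R.
  by rewrite /eps mulrA divff ?mul1r// gt_eqF.
clearbody eps.
have epsC2 : (2 * C * (C * eps) < 1)%R.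
  have : ((2 * C) ^+ 2 * eps <= 2^-1)%R.
    rewrite -epsC ler_pM2r// ler_weXn2l//; lra.
  have C0 : (0 < C)%R by lra.
  have : (0 < C * C * eps)%R by rewrite !mulr_gt0.
  rewrite expr2 (_ : (2 * C * (2 * C) * eps = 4 * (C * C * eps))%R); last by ring.
  rewrite (_ : (2 * C * (C * eps) = 2 * (C * C * eps))%R); last by ring.
  by move=> ? ?; lra.
have eps1 : (eps < 1)%R.
  apply: le_lt_trans epsC2; rewrite mulrA ler_peMl ?(ltW eps0)//.
  have : (1 <= C * C)%R by rewrite -[leLHS]mulr1 ler_pM//; lra.
  by move=> ?; lra.
exists eps; split => [|a l J l0 JE]; first by rewrite eps0.
set L := (l ^+ n)%R; have L0 : (0 < L)%R by exact: exprn_gt0.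
set S := (C * (J / L))%R.
set H := halfopen co a l.
have mH : measurable H by exact: measurable_halfopen.
have HQ : H `<=` cube a l by exact: halfopen_cube.
have muH : mu H = L%:E by rewrite /H halfopenE// mu_halfopen.
have QL : mu (cube a l) = L%:E by exact: mu_cube.
have J0 : (0 < J)%R.
  rewrite -lte_fin -JE; apply: integral_pos_gt0 => //.
  - by apply/measurable_EFinP; exact: measurable_funTS.
  - by move=> x _; rewrite lte_fin.
  - by rewrite QL lte_fin.
have S0 : (0 < S)%R by rewrite mulr_gt0 ?divr_gt0//; lra.
pose E j := H `&` [set x | (u x < eps ^+ j * S)%R].
have mlt c : measurable [set x | (u x < c)%R].
  rewrite (_ : [set x | _] = u @^-1` `]-oo, c[%classic).
    by rewrite -[X in measurable X]setTI; apply: mu_ => //; exact: measurable_itv.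
  by apply/seteqP; split => x /=; rewrite in_itv.
have mE j : measurable (E j) by exact: measurableI.
have EH j : E j `<=` H by move=> x [].
have ej0 j : (0 < eps ^+ j * S)%R by rewrite mulr_gt0// exprn_gt0.
have step j : mu (E j.+1) <= th%:E * mu (E j).
  apply: (@dyadic_stopping _ _ _ mu (dindex co a l)) => //.
  - exact: measurable_dindex.
  - exact: dindexS.
  - by exists (pickle [ffun i : 'I_n => 0%R : int]).
  - by rewrite muH ltry.
  - by move=> A e mA AQ e0; exact: approx.
  - by rewrite (ltW th0) th1.
  - rewrite muH -EFinM ltNge; apply/negP => big.
    have := @ess_bound_spread a l (E j.+1) (eps ^+ j.+1 * S)%R l0 (mE j.+1).
    have H1 : E j.+1 `<=` cube a l by exact: subset_trans (EH _) HQ.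
    move=> /(_ H1 big (ltW (ej0 _))) [|].
      by apply: aeW => x [_ /ltW].
    move=> N0' [mN0 N00 sub].
    have UB : {ae mu, forall x, cube a l x -> (u x <= 2 * C * (eps ^+ j.+1 * S))%R}.
      by exists N0'.
    have : J%:E <= (2 * C * (eps ^+ j.+1 * S))%:E * mu (cube a l).
      rewrite -JE -integral_cst//; apply: ae_ge0_le_integral => //.
      + by move=> x _; rewrite lee_fin ltW.
      + by apply/measurable_EFinP; exact: measurable_funTS.
      + by move=> x _; rewrite lee_fin mulr_ge0 ?(ltW (ej0 _))// ltW.
    rewrite QL -EFinM lee_fin leNgt => /negP; apply.
    apply: (@le_lt_trans _ _ (2 * C * (C * eps) * J)%R); last by rewrite gtr_pMl.
    rewrite /S exprS.
    have -> : (2 * C * (eps * eps ^+ j * (C * (J / L))) * L =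
      eps ^+ j * (2 * C * (C * eps) * J))%R by field; rewrite gt_eqF.
    rewrite ler_piMl ?exprn_ile1 ?(ltW eps0) ?(ltW eps1)//.
    by rewrite !mulr_ge0 ?(ltW eps0) ?(ltW J0)//; lra.
  move=> m x Hx good.
  have hm k : (0 < l / 2 ^+ k)%R by rewrite divr_gt0// exprn_gt0.
  have mucell : mu [set y | dindex co a l m.+1 y = dindex co a l m.+1 x] =
      ((l / 2 ^+ m.+1) ^+ n)%:E by rewrite dcellE// mu_halfopen.
  have G1 : ubound (dcorner co a l m.+1 x) (l / 2 ^+ m.+1)%R
      (2 * C * (eps ^+ j.+1 * S))%R.
    apply: (@ess_bound_spread _ _
      (E j.+1 `&` [set y | dindex co a l m.+1 y = dindex co a l m.+1 x])) => //.
    - by apply: measurableI => //; exact: measurable_dindex.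
    - by move=> y [_ yx]; exact: dcell_dcube.
    - by rewrite EFinM -mucell.
    - by rewrite ltW.
    - by apply: aeW => y [[_ /ltW]].
  have G2 : ubound (dcorner co a l m x) (l / 2 ^+ m)%R
      ((2 * C) ^+ N * (2 * C * (eps ^+ j.+1 * S)))%R.
    apply: ess_bound_chain G1 => //.
    - by rewrite mulr_ge0 ?(ltW (ej0 _)) ?(ltW C20).
    - by move=> i; exact: dcubeS.
    have -> : (l / 2 ^+ m = 2 * (l / 2 ^+ m.+1))%R.
      by rewrite exprS; field; rewrite gt_eqF ?exprn_gt0.
    by rewrite ler_wpM2r// ltW.
  have bnd : ((2 * C) ^+ N * (2 * C * (eps ^+ j.+1 * S)) = eps ^+ j * S / 2)%R.
    rewrite exprS.
    have -> : ((2 * C) ^+ N * (2 * C * (eps * eps ^+ j * S)) =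
      ((2 * C) ^+ N.+1 * eps) * (eps ^+ j * S))%R by rewrite exprSr; ring.
    by rewrite epsC mulrC.
  rewrite bnd in G2; case: G2 => N1 [mN1 N10 N1sub].
  apply/eqP; rewrite eq_le measure_ge0 andbT -N10 le_measure ?inE//.
    by apply: measurableD => //; exact: measurable_dindex.
  move=> y [yx nE]; apply: N1sub => /= /(_ (dcell_dcube l0 yx)) uy.
  apply: nE; split.
    have [i0 Hi0] : exists i0, H = [set z | dindex co a l 0 z = i0] by eexists; reflexivity.
    move: Hx; rewrite Hi0 /= => <-.
    by elim: (m) yx => [//|k IHk] /= yx; apply: IHk; exact: dindexS yx.
  by rewrite /=; apply: (le_lt_trans uy); have := ej0 j; lra.
have Ej j : mu (E j) <= (th ^+ j * L)%:E.
  elim: j => [|j IHj].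
    by rewrite expr0 mul1r -muH le_measure ?inE.
  apply: (le_trans (step j)); rewrite exprS -mulrA EFinM.
  by rewrite lee_pmul2l.
move=> j; apply: le_trans (Ej j).
have QH : mu (cube a l `\` H) = 0.
  have Qf : mu (cube a l) < +oo by rewrite QL ltry.
  have -> := measureD (mcube a l) mH Qf.
  have E0 : mu (cube a l) - mu H = 0 by rewrite QL muH subee.
  by rewrite (setIidr HQ); exact: E0.
have mD : measurable (cube a l `\` H) by exact: measurableD.
apply: (@le_trans _ _ (mu (E j `|` (cube a l `\` H)))).
  rewrite le_measure ?inE//; first exact: measurableI.
    exact: measurableU.
  move=> x [Qx ux]; have [Hx|nH] := pselect (H x); first by left.
  by right.
apply: (le_trans (measureU2 _ _ _)) => //.
by rewrite [X in _ + X](_ : _ = 0) ?adde0.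
Qed.

(** The measure of {u < eps^j S} decays geometrically in [j], so the layers of
    a small enough power of S / u can be summed. *)
Lemma RHinfty_integral : exists eta K : R, [/\ (0 < eta)%R, (0 <= K)%R &
  forall (a : 'I_n -> R) l, (0 < l)%R -> exists2 S : R, (0 < S)%R &
    {ae mu, forall x, cube a l x -> (u x <= S)%R} /\
    \int[mu]_(x in cube a l) ((S / u x) `^ eta)%:E <= (K * l ^+ n)%:E].
Proof.
have C1' := C1; have [eps [/andP[eps0 eps1] small]] := RHinfty_small.
pose q := eps^-1%R.
have q1 : (1 < q)%R by rewrite invf_gt1.
have q0 : (0 < q)%R by apply: lt_trans q1.
have ht1 : (1 < th^-1 `^ (2^-1))%R.
  by rewrite -[ltLHS](powRr0 th^-1) gt1_ltr_powR ?invf_gt1// invr_gt0.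
pose eta := (ln (th^-1 `^ 2^-1) / ln q)%R.
have lq : (0 < ln q)%R by rewrite ln_gt0.
have eta0 : (0 < eta)%R by rewrite divr_gt0// ln_gt0.
have qeta : (q `^ eta = th^-1 `^ 2^-1)%R.
  rewrite [LHS]/powR gt_eqF// /eta divfK ?gt_eqF// lnK// posrE powR_gt0//.
  by rewrite invr_gt0.
pose p := (th^-1 `^ 2^-1)%R; have p0 : (0 < p)%R by apply: lt_trans ht1.
have pth : (0 <= p * th < 1)%R.
  rewrite mulr_ge0 ?(ltW p0) ?(ltW th0)//=.
  have pp : (p * p = th^-1)%R.
    have two : (2^-1 + 2^-1 = 1 :> R)%R by lra.
    rewrite /p -powRD; last by rewrite gt_eqF ?invr_gt0// implybT.
    by rewrite two powRr1// invr_ge0 ltW.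
  have -> : th = (p^-1 * p^-1)%R by rewrite -invfM pp invrK.
  by rewrite mulrA divff ?gt_eqF// mul1r invf_lt1.
exists eta, (1 + p / (1 - p * th))%R; split => //.
  by rewrite addr_ge0// divr_ge0 ?(ltW p0)// subr_ge0 ltW//; case/andP: pth.
move=> a l l0; have [J [JE HJ]] := RH a l0.
set L := (l ^+ n)%R in HJ *; have L0 : (0 < L)%R by exact: exprn_gt0.
have QL : mu (cube a l) = L%:E by exact: mu_cube.
have J0 : (0 < J)%R.
  rewrite -lte_fin -JE; apply: integral_pos_gt0 => //.
  - by apply/measurable_EFinP; exact: measurable_funTS.
  - by move=> x _; rewrite lte_fin.
  - by rewrite QL lte_fin.
set S := (C * (J / L))%R in HJ *.
have S0 : (0 < S)%R by rewrite mulr_gt0 ?divr_gt0//; lra.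
exists S => //; split => //.
have mh : measurable_fun setT (fun x => ((S / u x) `^ eta)%:E).
  apply/measurable_EFinP; apply: measurableT_comp (measurable_powR eta) _.
  apply: measurable_funM => //.
  rewrite (_ : (fun _ => _) = (fun x => u x `^ (-1))%R).
    exact: measurableT_comp (measurable_powR _) mu_.
  by apply/funext => x; rewrite powR_inv1// ltW.
pose y j := (p ^+ j)%R.
have := @integral_le_layers _ _ _ mu (cube a l)
  (fun x => ((S / u x) `^ eta)%:E) y (mcube a l) mh.
have y0 j : (0 <= y j)%R by rewrite exprn_ge0// ltW.
have yoo M : exists j, (M <= y j)%R by exact: exprn_unbounded.
have h0 x : 0 <= ((S / u x) `^ eta)%:E by rewrite lee_fin powR_ge0.
move=> /(_ h0 y0 yoo) /le_trans; apply.
rewrite QL /y expr0 mul1e.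
have K0 : (0 <= p * L)%R by rewrite mulr_ge0// ltW.
apply: (@le_trans _ _ (L%:E + \sum_(j <oo) (p * L * (p * th) ^+ j)%:E)).
  rewrite leeD2l//; apply: lee_nneseries => [j _ _|j _].
    by rewrite mule_ge0// lee_fin.
  apply: (@le_trans _ _ ((p ^+ j.+1)%:E * (th ^+ j * L)%:E)); last first.
    rewrite -EFinM lee_fin exprMn exprS le_eqVlt; apply/orP; left; apply/eqP; ring.
  rewrite lee_wpmul2l ?lee_fin ?y0//; apply: le_trans (small a l J l0 JE j).
  rewrite -/L -/S le_measure ?inE//.
  - by apply: measurableI => //; exact: superlevel_measurable.
  - apply: measurableI => //.
    rewrite (_ : [set x | _] = u @^-1` `]-oo, (eps ^+ j * S)%R[%classic).
      by rewrite -[X in measurable X]setTI; apply: mu_ => //; exact: measurable_itv.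
    by apply/seteqP; split => x /=; rewrite in_itv.
  apply: setIS => x /=; rewrite lte_fin => H.
  rewrite ltNge; apply/negP => ux; move: H; rewrite ltNge => /negP; apply.
  rewrite -/p /p -qeta -powR_exprn ?(ltW q0)//.
  rewrite ge0_ler_powR ?nnegrE ?(ltW eta0) ?divr_ge0 ?exprn_ge0 ?(ltW q0) ?(ltW S0) ?(ltW (u0 x))//.
  by rewrite ler_pdivrMr// /q exprVn ler_pdivlMl ?exprn_gt0.
have := geometric_nneseries K0 pth => /(leeD2l L%:E) /le_trans; apply.
rewrite -EFinD lee_fin le_eqVlt; apply/orP; left; apply/eqP; field.
by case/andP: pth => _ ?; rewrite subr_eq0 gt_eqF.
Qed.

End RHinfty_integral.

(** * Approximation by dyadic cubes *)

Section dyadic_approximation.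
Context d (T : measurableType d) (R : realType) (n : nat).
Variables (co : 'I_n -> T -> R) (mco : forall i, measurable_fun setT (co i)).
Variable mu : {measure set T -> \bar R}.
Variables (a : 'I_n -> R) (l : R).
Hypothesis l0 : (0 < l)%R.
Local Notation H := (halfopen co a l).
Local Notation ix := (dindex co a l).
Hypothesis Hfin : mu H < +oo.

Definition dunion m (S : set nat) : set T := [set x | H x /\ S (ix m x)].

(** Sets that are, inside the half-open cube and up to small measure, unions of
    cells of a single generation.  They form a sigma-algebra, which contains the
    half-spaces. *)
Definition dapprox (X : set T) := measurable X /\ forall e : R, (0 < e)%R ->
  exists m S, mu ((X `&` H) `\` dunion m S) <= e%:E /\
              mu (dunion m S `\` X) <= e%:E.

Let mH : measurable H. Proof. exact: measurable_halfopen. Qed.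

Lemma measurable_dunion m S : measurable (dunion m S).
Proof.
rewrite (_ : dunion m S = H `&` \bigcup_(j in S) [set x | ix m x = j]).
  apply: measurableI => //; apply: bigcup_measurable => j _.
  exact: measurable_dindex.
apply/seteqP; split => x [Hx] => [Sx|[j Sj /= xj]]; split => //.
  by exists (ix m x).
by rewrite xj.
Qed.

Let ix_le m k x y : (k <= m)%N -> ix m x = ix m y -> ix k x = ix k y.
Proof.
elim: m => [|m IH]; first by rewrite leqn0 => /eqP ->.
by rewrite leq_eqVlt => /predU1P[->//|]; rewrite ltnS => km /(dindexS l0); exact: IH.
Qed.

Lemma dunion_refine m k S : (k <= m)%N -> exists S', dunion k S = dunion m S'.
Proof.
move=> km; exists [set j | exists2 x, ix m x = j & S (ix k x)].
apply/seteqP; split => x [Hx] => [Sx|[y yx Sy]]; split => //; first by exists x.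
by rewrite -(ix_le km yx).
Qed.

Lemma dapproxC X : dapprox X -> dapprox (~` X).
Proof.
move=> [mX HX]; split; first exact: measurableC.
move=> e e0; have [m [S [H1 H2]]] := HX e e0; exists m, (~` S).
have mD S' := measurable_dunion m S'.
split.
  apply: le_trans H2; rewrite le_measure ?inE//.
  - by apply: measurableD => //; apply: measurableI => //; exact: measurableC.
  - exact: measurableD.
  - move=> x [[nX Hx] nD]; split => //; split => //.
    by apply: contrapT => nS; apply: nD.
apply: le_trans H1; rewrite le_measure ?inE//.
- by apply: measurableD => //; exact: measurableC.
- by apply: measurableD => //; exact: measurableI.
- move=> x [[Hx nS] /contrapT Xx]; split => //.
  by move=> [_ Sx]; exact: nS.
Qed.

Lemma dapproxU X Y : dapprox X -> dapprox Y -> dapprox (X `|` Y).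
Proof.
move=> [mX HX] [mY HY]; split; first exact: measurableU.
move=> e e0; have e20 : (0 < e / 2)%R by exact: divr_gt0.
have [m [S [X1 X2]]] := HX _ e20; have [k [S' [Y1 Y2]]] := HY _ e20.
have [U EU] := dunion_refine S (leq_maxl m k).
have [U' EU'] := dunion_refine S' (leq_maxr m k).
rewrite EU in X1 X2; rewrite EU' in Y1 Y2.
exists (maxn m k), (U `|` U').
have mD V := measurable_dunion (maxn m k) V.
have E : e%:E = (e / 2)%:E + (e / 2)%:E by rewrite -EFinD -splitr.
have mXH : measurable (X `&` H) by exact: measurableI.
have mYH : measurable (Y `&` H) by exact: measurableI.
rewrite E; split.
  apply: le_trans (leeD X1 Y1); apply: le_trans (measureU2 _ _ _).
  - rewrite le_measure ?inE//.
    + by apply: measurableD => //; apply: measurableI => //; exact: measurableU.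
    + by apply: measurableU; exact: measurableD.
    + move=> x [[[Xx|Yx] Hx] nD].
        by left; split => //; apply: contra_not nD => -[_ ?]; split => //; left.
      by right; split => //; apply: contra_not nD => -[_ ?]; split => //; right.
  - exact: measurableD.
  - exact: measurableD.
apply: le_trans (leeD X2 Y2); apply: le_trans (measureU2 _ _ _).
- rewrite le_measure ?inE//.
  + by apply: measurableD => //; exact: measurableU.
  + by apply: measurableU; exact: measurableD.
  + move=> x [[Hx [Ux|Ux]] nXY].
      by left; split => //; apply: contra_not nXY => ?; left.
    by right; split => //; apply: contra_not nXY => ?; right.
- exact: measurableD.
- exact: measurableD.
Qed.

Lemma dapprox0 : dapprox set0.
Proof.
split => // e e0; exists 0%N, set0.
rewrite set0I set0D measure0 lee_fin (ltW e0); split => //.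
rewrite (_ : dunion _ _ `\` _ = set0) ?measure0 ?lee_fin ?(ltW e0)//.
by apply/seteqP; split => // x [[_ []]].
Qed.

Lemma dapprox_bigcup (X : nat -> set T) :
  (forall k, dapprox (X k)) -> dapprox (\bigcup_k X k).
Proof.
move=> HX; have mX k : measurable (X k) by case: (HX k).
have mU : measurable (\bigcup_k X k) by exact: bigcupT_measurable.
split=> // e e0; have e20 : (0 < e / 2)%R by exact: divr_gt0.
pose U N := \big[setU/set0]_(k < N) X k.
have aU N : dapprox (U N).
  rewrite /U; elim: N => [|N IH]; first by rewrite big_ord0; exact: dapprox0.
  by rewrite big_ord_recr/=; exact: dapproxU.
have mUN N : measurable (U N) by case: (aU N).
pose Z N := (\bigcup_k X k `&` H) `\` U N.
have mUH : measurable (\bigcup_k X k `&` H) by exact: measurableI.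
have mZ N : measurable (Z N) by exact: measurableD.
have Z0 : \bigcap_N Z N = set0.
  apply/seteqP; split => // x HZ.
  have [[[k _ Xkx] _] _] := HZ 0%N I.
  have [_] := HZ k.+1 I; apply; rewrite /U -bigcup_mkord; exists k => //=.
have cvgZ : (mu \o Z) N @[N --> \oo] --> mu (\bigcap_N Z N).
  apply: nonincreasing_cvg_mu => //.
  - apply: le_lt_trans Hfin; rewrite le_measure ?inE//.
    by move=> x [[]].
  - by rewrite Z0.
  - apply/nonincreasing_seqP => N; apply/subsetPset => x [[Ux Hx] nU].
    split => //; apply: contra_not nU; rewrite /U -!bigcup_mkord => -[k /= kN Xk].
    by exists k => //=; exact: leqW.
rewrite Z0 measure0 in cvgZ.
have [N ZN] : exists N, mu (Z N) < (e / 2)%:E.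
  have : \forall N \near \oo, (mu \o Z) N < (e / 2)%:E.
    by apply: (cvgZ [set x | x < (e / 2)%:E]); apply: open_nbhs_nbhs; split;
      [exact: open_ereal_lt_ereal|rewrite /= lte_fin].
  by move=> [N _ HN]; exists N; apply: HN => /=.
have [m [S [X1 X2]]] := (aU N).2 _ e20.
exists m, S; have mD := measurable_dunion m S; split.
  have -> : e%:E = (e / 2)%:E + (e / 2)%:E by rewrite -EFinD -splitr.
  apply: le_trans (leeD (ltW ZN) X1); apply: le_trans (measureU2 _ _ _).
  - rewrite le_measure ?inE//.
    + exact: measurableD.
    + by apply: measurableU => //; apply: measurableD => //; exact: measurableI.
    + move=> x [[Ux Hx] nD]; have [UN|nUN] := pselect (U N x).
        by right; split.
      by left; split.
  - exact: mZ.
  - by apply: measurableD => //; exact: measurableI.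
apply: (@le_trans _ _ (e / 2)%:E); last by rewrite lee_fin; lra.
apply: le_trans X2; rewrite le_measure ?inE//; try exact: measurableD.
move=> x [Dx nU]; split => //; apply: contra_not nU.
by rewrite /U -bigcup_mkord => -[k _ Xk]; exists k.
Qed.

(** The cells crossing the boundary of the half-space lie in a slab of width
    l / 2^m, and these slabs decrease to the empty set. *)
Lemma dapprox_halfline i (c : R) : dapprox (co i @^-1` `]-oo, c[%classic).
Proof.
set X := _ @^-1` _.
have mlt (c' : R) : measurable (co i @^-1` `]-oo, c'[%classic).
  by rewrite -[Y in measurable Y]setTI; apply: mco => //; exact: measurable_itv.
have mX : measurable X by exact: mlt.
split => // e e0.
pose Z m := H `&` (X `\` (co i @^-1` `]-oo, (c - l / 2 ^+ m)%R[%classic)).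
have mZ m : measurable (Z m) by apply: measurableI => //; exact: measurableD.
have hm m : (0 < l / 2 ^+ m)%R by rewrite divr_gt0// exprn_gt0.
have Z0 : \bigcap_m Z m = set0.
  apply/seteqP; split => // x HZ.
  have [_ [Xx _]] := HZ 0%N I; move: Xx; rewrite /X/= in_itv/= => xc.
  have d0 : (0 < c - co i x)%R by rewrite subr_gt0.
  have [m Hm] := @exprn_unbounded R 2 (ltr1n R 2) (l / (c - co i x) + 1)%R.
  have [_ [_]] := HZ m I; apply; rewrite /= in_itv/=.
  rewrite ltrBrDl -ltrBrDr ltr_pdivrMr ?exprn_gt0// mulrC -ltr_pdivrMr//.
  by apply: lt_le_trans Hm; rewrite ltrDl.
have cvgZ : (mu \o Z) m @[m --> \oo] --> mu (\bigcap_m Z m).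
  apply: nonincreasing_cvg_mu => //.
  - by apply: le_lt_trans Hfin; rewrite le_measure ?inE//; move=> x [].
  - by rewrite Z0.
  - apply/nonincreasing_seqP => m; apply/subsetPset => x [Hx [Xx nx]].
    split => //; split => //; apply: contra_not nx; rewrite /= !in_itv/= => xm.
    apply: (lt_le_trans xm); rewrite lerD2l lerN2 ler_pM2l// lef_pV2 ?posrE ?exprn_gt0//.
    by rewrite ler_weXn2l ?ler1n.
rewrite Z0 measure0 in cvgZ.
have [m Zm] : exists m, mu (Z m) < e%:E.
  have : \forall m \near \oo, (mu \o Z) m < e%:E.
    by apply: (cvgZ [set x | x < e%:E]); apply: open_nbhs_nbhs; split;
      [exact: open_ereal_lt_ereal|rewrite /= lte_fin].
  by move=> [m _ Hm]; exists m; apply: Hm => /=.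
exists m, [set j | exists2 x, ix m x = j & (dcorner co a l m x i + l / 2 ^+ m <= c)%R].
set D := dunion _ _.
have inD x : H x -> D x <-> (dcorner co a l m x i + l / 2 ^+ m <= c)%R.
  move=> Hx; split => [[_ [y yx yc]]|xc]; last by split => //; exists x.
  suff -> : dcorner co a l m x i = dcorner co a l m y i by [].
  by move/dindexP : yx => /(_ i) yx; rewrite /dcorner yx.
have itv x : (dcorner co a l m x i <= co i x < dcorner co a l m x i + l / 2 ^+ m)%R.
  by apply/dfloor_itv.
have mD : measurable D by exact: measurable_dunion.
split.
  apply: le_trans (ltW Zm); rewrite le_measure ?inE//.
    by apply: measurableD => //; exact: measurableI.
  move=> x [[Xx Hx] nD]; split => //; split => //; rewrite /= in_itv/= => xm.
  apply: nD; apply/inD => //; have /andP[? ?] := itv x; lra.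
rewrite (_ : D `\` X = set0) ?measure0 ?lee_fin ?(ltW e0)//.
apply/seteqP; split => // x [Dx]; apply; rewrite /X/= in_itv/=.
have [Hx _] := Dx; move/(inD _ Hx) : Dx => Dx; have /andP[? ?] := itv x; lra.
Qed.

Lemma dapprox_sigma_algebra : sigma_algebra setT dapprox.
Proof.
split; first exact: dapprox0.
- by move=> X; rewrite setTD; exact: dapproxC.
- exact: dapprox_bigcup.
Qed.

Lemma dapprox_borel : g_sigma_preimage (co : 'I_n -> T -> measurableTypeR R) `<=` dapprox.
Proof.
apply: smallest_sub; first exact: dapprox_sigma_algebra.
move=> X; rewrite -bigcup_seq => -[i _ [B mB <-]]; rewrite setTI.
suff : (measurable : set (set (measurableTypeR R))) `<=`
    [set B | dapprox (co i @^-1` B)] by exact.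
rewrite RGenInftyO.measurableE; apply: smallest_sub.
  have [G0 GC GU] := dapprox_sigma_algebra; split => /=.
  - by rewrite preimage_set0.
  - by move=> Y /GC; rewrite !setTD.
  - by move=> Y HY; rewrite preimage_bigcup; exact: GU.
by move=> _ [c ->]; exact: dapprox_halfline.
Qed.

End dyadic_approximation.

Section lebesgue_approximation.
Context (R : realType) (n : nat).
Local Notation Rn := (euclidean R n).
Local Notation Bn := (n.-tuple (measurableTypeR R)).
Local Notation mu := (leb R n).

(** The completed measure is an infimum over countable covers by Borel
    sets. *)
Lemma leb_outer (A : set Rn) (e : R) : measurable A -> mu A < +oo -> (0 < e)%R ->
  exists B : set Bn, [/\ measurable B, A `<=` B & mu ((B : set Rn) `\` A) <= e%:E].
Proof.
move=> mA Afin e0.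
have Af : mu A \is a fin_num by rewrite ge0_fin_numE.
have [_ [F [mF AF] <-] FA] := lb_ereal_inf_adherent e0 Af.
pose B : set Bn := \bigcup_i F i.
have mB : measurable B by exact: bigcupT_measurable.
have mB' : measurable (B : set Rn) by exact: borel_euclidean.
exists B; split => //.
have Blt : mu B < mu A + e%:E.
  apply: le_lt_trans FA; rewrite leb_borel//.
  by apply: generalized_Boole_inequality.
have Bfin : mu B < +oo by rewrite (lt_trans Blt)// lte_add_pinfty// ltry.
rewrite measureD// (setIidr AF) leeBlDl//.
exact: ltW.
Qed.

Lemma leb_halfopen_fin (a : 'I_n -> R) l : (0 < l)%R ->
  leb R n (halfopen (@ecoord R n) a l) < +oo.
Proof.
move=> l0; apply: (@le_lt_trans _ _ (leb R n (cube (@ecoord R n) a l))).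
  apply: le_measure; rewrite ?inE.
  - exact: (measurable_halfopen (@measurable_ecoord R n)).
  - exact: (measurable_cube (@measurable_ecoord R n)).
  - exact: halfopen_cube.
by rewrite leb_cube ?ltry// ltW.
Qed.

Lemma leb_approx (a : 'I_n -> R) l : (0 < l)%R ->
  forall (A : set Rn) (e : R), measurable A -> A `<=` halfopen (@ecoord R n) a l ->
  (0 < e)%R -> exists m (S : set nat),
    mu (A `\` [set x | halfopen (@ecoord R n) a l x /\ S (dindex (@ecoord R n) a l m x)]) <= e%:E /\
    mu ([set x | halfopen (@ecoord R n) a l x /\ S (dindex (@ecoord R n) a l m x)] `\` A) <= e%:E.
Proof.
move=> l0 A e mA AH e0.
have e20 : (0 < e / 2)%R by exact: divr_gt0.
have mH : measurable (halfopen (@ecoord R n) a l).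
  exact: (measurable_halfopen (@measurable_ecoord R n)).
have Afin : mu A < +oo.
  apply: le_lt_trans (leb_halfopen_fin a l0).
  by apply: le_measure; rewrite ?inE.
have [B [mB AB BA]] := leb_outer mA Afin e20.
have mB' : measurable (B : set Rn) by exact: borel_euclidean.
have := @dapprox_borel _ Rn R n (@ecoord R n) (@measurable_ecoord R n) mu a l l0
  (leb_halfopen_fin a l0) B mB.
move=> [_ /(_ _ e20)[m [S [H1 H2]]]].
exists m, S; rewrite -/(dunion (@ecoord R n) a l m S).
have mD : measurable (dunion (@ecoord R n) a l m S).
  exact: (measurable_dunion (@measurable_ecoord R n)).
split.
  apply: (@le_trans _ _ (e / 2)%:E); last by rewrite lee_fin; lra.
  apply: le_trans H1; apply: le_measure; rewrite ?inE.
  - exact: measurableD.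
  - by apply: measurableD => //; exact: measurableI.
  - by move=> x [Ax nD]; split => //; split; [exact: AB|exact: AH].
have -> : e%:E = (e / 2)%:E + (e / 2)%:E by rewrite -EFinD -splitr.
apply: le_trans (leeD H2 BA); apply: le_trans (measureU2 _ _ _).
- apply: le_measure; rewrite ?inE.
  + exact: measurableD.
  + by apply: measurableU; exact: measurableD.
  + move=> x [Dx nA]; have [Bx|nB] := pselect (B x); first by right.
    by left.
- exact: measurableD.
- exact: measurableD.
Qed.

Lemma leb_halfopen_box (a : 'I_n -> R) l : (0 < l)%R ->
  mu (box (@ecoord R n) (fun i => `[a i, (a i + l)%R[%classic)) = (l ^+ n)%:E.
Proof.
move=> l0; apply: leb_box => i; first exact: measurable_itv.
by rewrite lebesgue_measure_itv/= lte_fin ltrDl l0 -EFinB; congr EFin; lra.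
Qed.

End lebesgue_approximation.

(** * Positive real representatives of weights *)

Section real_weights.
Context d (T : measurableType d) (R : realType) (mu : {measure set T -> \bar R}).

(** A weight may be changed on a null set so that its values become positive
    real numbers. *)
Lemma real_weight (w : T -> \bar R) : measurable_fun setT w ->
  (\forall x \ae mu, 0 < w x < +oo) ->
  exists wr : T -> R, [/\ measurable_fun setT wr, forall x, (0 < wr x)%R &
    \forall x \ae mu, w x = (wr x)%:E].
Proof.
move=> mw w0; pose wr x := if 0 < w x < +oo then fine (w x) else 1%R.
exists wr; split.
- apply: measurable_fun_ifT => //.
    apply: measurable_and; apply: measurable_fun_lte => //.
  exact: measurableT_comp.
- move=> x; rewrite /wr; case: ifPn => [|_]; last by [].
  exact: fine_gt0.
- apply: filterS w0 => x /[dup] wx /andP[w0 wy]; rewrite /wr wx fineK//.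
  by rewrite ge0_fin_numE// ltW.
Qed.

Lemma ae_eq_integral_of (f g : T -> \bar R) (A : set T) : measurable A ->
  measurable_fun A f -> measurable_fun A g -> (\forall x \ae mu, f x = g x) ->
  \int[mu]_(x in A) f x = \int[mu]_(x in A) g x.
Proof.
by move=> mA mf mg fg; apply: ae_eq_integral => //; apply: filterS fg => x + _.
Qed.

Variables (w : T -> \bar R) (wr : T -> R) (Q : set T) (L : R).
Hypotheses (mw : measurable_fun setT w) (mwr : measurable_fun setT wr).
Hypotheses (wr0 : forall x, (0 < wr x)%R) (wwr : \forall x \ae mu, w x = (wr x)%:E).
Hypotheses (mQ : measurable Q) (L0 : (0 < L)%R) (QL : mu Q = L%:E).

Let mwrE : measurable_fun Q (fun x => (wr x)%:E).
Proof. by apply/measurable_EFinP; exact: measurable_funTS. Qed.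

Let Q0 : 0 < mu Q. Proof. by rewrite QL lte_fin. Qed.

Let int_w : \int[mu]_(x in Q) w x = \int[mu]_(x in Q) (wr x)%:E.
Proof. by apply: ae_eq_integral_of => //; exact: measurable_funTS. Qed.

Lemma int_real_weight_gt0 : 0 < \int[mu]_(x in Q) (wr x)%:E.
Proof. by apply: integral_pos_gt0 => // x _; rewrite lte_fin. Qed.

Lemma real_weight_avg_fin : \int[mu]_(x in Q) w x / mu Q < +oo ->
  exists2 I : R, (0 < I)%R & \int[mu]_(x in Q) (wr x)%:E = I%:E.
Proof.
rewrite int_w QL => H; have I0 := int_real_weight_gt0.
have If : \int[mu]_(x in Q) (wr x)%:E \is a fin_num.
  rewrite ge0_fin_numE ?ltW//; move: H; apply: contraTT.
  rewrite -!leNgt !leye_eq => /eqP ->.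
  by rewrite inver (gt_eqF L0)/= mulyr gtr0_sg ?invr_gt0// mul1e.
by exists (fine (\int[mu]_(x in Q) (wr x)%:E)); rewrite ?fineK// fine_gt0// I0 ltey_eq If.
Qed.

Lemma RHinfty_cube (M : R) : (0 <= M)%R ->
  \int[mu]_(x in Q) w x / mu Q < +oo ->
  ess_sup mu (w \_ Q) / (\int[mu]_(x in Q) w x / mu Q) <= M%:E ->
  exists J : R, \int[mu]_(x in Q) (wr x)%:E = J%:E /\
    {ae mu, forall x, Q x -> (wr x <= M * (J / L))%R}.
Proof.
move=> M0 /real_weight_avg_fin[J J0 JE]; rewrite int_w JE QL => H.
exists J; split => //.
have JL0 : (0 < J / L)%R by exact: divr_gt0.
have {}H : ess_sup mu (w \_ Q) <= (M * (J / L))%:E.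
  move: H; rewrite inver (gt_eqF L0)/= -EFinM inver (gt_eqF JL0)/=.
  by rewrite lee_pdivrMr// EFinM.
have /ess_supP := H.
apply: filterS2 wwr => x wx + Qx; rewrite patchE mem_set// wx.
by rewrite lee_fin.
Qed.

(** Both averages are positive, so that neither of them can be infinite when
    the product is finite. *)
Lemma Aq_cube (q K : R) : (1 < q)%R -> (0 <= K)%R ->
  (\int[mu]_(x in Q) w x / mu Q) *
  (\int[mu]_(x in Q) (w x `^ (1 - q / (q - 1))) / mu Q) `^ (q - 1) <= K%:E ->
  exists I : R, [/\ (0 < I)%R, \int[mu]_(x in Q) (wr x)%:E = I%:E &
    \int[mu]_(x in Q) ((I / L / wr x) `^ (q - 1)^-1)%:E <= (K `^ (q - 1)^-1 * L)%:E].
Proof.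
move=> q1 K0 H.
have q10 : (0 < q - 1)%R by rewrite subr_gt0.
pose k := ((q - 1)^-1)%R; have k0 : (0 < k)%R by rewrite invr_gt0.
have kE : (1 - q / (q - 1) = - k)%R by rewrite /k; field; rewrite gt_eqF.
have mpk : measurable_fun setT (fun x => wr x `^ (- k))%R.
  exact: measurableT_comp (measurable_powR (- k)%R) mwr.
have mpkE : measurable_fun Q (fun x => (wr x `^ (- k))%:E).
  by apply/measurable_EFinP; exact: measurable_funTS.
have int_k : \int[mu]_(x in Q) (w x `^ (1 - q / (q - 1))) =
    \int[mu]_(x in Q) (wr x `^ (- k))%:E.
  apply: ae_eq_integral_of => //.
    apply: measurable_funTS; exact: measurableT_comp (measurable_poweR _) mw.
  by apply: filterS wwr => x ->; rewrite kE poweR_EFin.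
have S0 : 0 < \int[mu]_(x in Q) (wr x `^ (- k))%:E.
  by apply: integral_pos_gt0 => // x _; rewrite lte_fin powR_gt0.
have I0 := int_real_weight_gt0.
rewrite int_w int_k QL !inver (gt_eqF L0)/= in H.
set I := \int[mu]_(x in Q) (wr x)%:E in H I0 *.
set Sg := \int[mu]_(x in Q) _ in H S0.
have Li : (0 < L^-1)%R by rewrite invr_gt0.
have If : I \is a fin_num.
  rewrite ge0_fin_numE ?ltW// ltNge leye_eq; apply/negP => /eqP Iy.
  move: H; rewrite Iy mulyr gtr0_sg// mul1e gt0_mulye ?leye_eq//.
  by rewrite poweR_gt0// mule_gt0 ?lte_fin.
have Sf : Sg \is a fin_num.
  rewrite ge0_fin_numE ?ltW// ltNge leye_eq; apply/negP => /eqP Sy.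
  move: H; rewrite Sy mulyr gtr0_sg// mul1e poweRyr ?gt_eqF// gt0_muley ?leye_eq//.
  by rewrite mule_gt0 ?lte_fin.
pose i := fine I; pose s := fine Sg.
have iE : I = i%:E by rewrite /i fineK.
have sE : Sg = s%:E by rewrite /s fineK.
have i0 : (0 < i)%R by rewrite -lte_fin -iE.
have s0 : (0 < s)%R by rewrite -lte_fin -sE.
exists i; split => //.
rewrite iE sE -!EFinM lee_fin in H.
have iL0 : (0 < i / L)%R by exact: divr_gt0.
have sL0 : (0 < s / L)%R by exact: divr_gt0.
have -> : \int[mu]_(x in Q) ((i / L / wr x) `^ (q - 1)^-1)%:E =
    \int[mu]_(x in Q) (((i / L) `^ k)%:E * (wr x `^ (- k))%:E).
  apply: eq_integral => x _; rewrite -EFinM; congr EFin.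
  rewrite -/k powRM ?invr_ge0 ?(ltW iL0) ?(ltW (wr0 x))//.
  by rewrite -(powR_inv1 (ltW (wr0 x))) -powRrM mulN1r.
rewrite ge0_integralZl//; last 2 first.
- by move=> x _; rewrite lee_fin powR_ge0.
- by rewrite lee_fin powR_ge0.
rewrite -/Sg sE -EFinM lee_fin -/k -ler_pdivrMr//.
have : ((i / L * (s / L) `^ (q - 1)) `^ k <= K `^ k)%R.
  apply: ge0_ler_powR; rewrite ?nnegrE//; first exact: ltW.
  by apply: mulr_ge0; [exact: ltW|exact: powR_ge0].
rewrite powRM ?powR_ge0 ?(ltW iL0)// -(powRrM (s / L)) divff ?gt_eqF//.
by rewrite powRr1 ?(ltW sL0)// mulrA.
Qed.

(** An A_1 weight is an A_2 weight: its average divided by its value is almost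
    everywhere at most [K]. *)
Lemma A1_cube (K : R) : (0 < K)%R ->
  {ae mu, forall x, Q x -> \int[mu]_(x in Q) `|w x| / mu Q <= K%:E * w x} ->
  exists I : R, [/\ (0 < I)%R, \int[mu]_(x in Q) (wr x)%:E = I%:E &
    \int[mu]_(x in Q) ((I / L / wr x) `^ 1)%:E <= (K * L)%:E].
Proof.
move=> K0 H.
have int_abs : \int[mu]_(x in Q) `|w x| = \int[mu]_(x in Q) (wr x)%:E.
  apply: ae_eq_integral_of => //.
    by apply: measurable_funTS; exact: measurableT_comp.
  by apply: filterS wwr => x ->; rewrite gee0_abs// lee_fin ltW.
have I0 := int_real_weight_gt0.
rewrite int_abs QL !inver (gt_eqF L0)/= in H.
have {}H : {ae mu, forall x, Q x ->
    \int[mu]_(x in Q) (wr x)%:E * (L^-1)%:E <= (K * wr x)%:E}.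
  by apply: filterS2 wwr H => x -> /[apply]; rewrite EFinM.
have Li : (0 < L^-1)%R by rewrite invr_gt0.
have If : \int[mu]_(x in Q) (wr x)%:E \is a fin_num.
  rewrite ge0_fin_numE ?ltW// ltNge leye_eq; apply/negP => /eqP Iy.
  have [x _] := ae_exists mQ Q0 H.
  by rewrite Iy mulyr gtr0_sg// mul1e leye_eq.
pose i := fine (\int[mu]_(x in Q) (wr x)%:E).
have iE : \int[mu]_(x in Q) (wr x)%:E = i%:E by rewrite /i fineK.
exists i; split => //; first by rewrite -lte_fin -iE.
have i0 : (0 < i)%R by rewrite -lte_fin -iE.
rewrite EFinM -QL -integral_cst//; apply: ae_ge0_le_integral => //.
- by move=> x _; rewrite lee_fin powR_ge0.
- apply/measurable_EFinP; apply: measurable_funTS.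
  apply: measurableT_comp (measurable_powR 1%R) _; apply: measurable_funM => //.
  rewrite (_ : (fun _ => _) = (fun x => wr x `^ (-1))%R).
    exact: measurableT_comp (measurable_powR _) mwr.
  by apply/funext => x; rewrite powR_inv1// ltW.
- by move=> x _; rewrite lee_fin ltW.
apply: filterS H => x + Qx => /(_ Qx); rewrite iE -EFinM !lee_fin => H.
by rewrite powRr1 ?divr_ge0 ?(ltW (wr0 x)) ?(ltW i0) ?(ltW L0)// ler_pdivrMr.
Qed.

End real_weights.

(** * Muckenhoupt weights are doubling *)

Section Ap_doubling.
Context d (T : measurableType d) (R : realType) (n : nat).
Variables (co : 'I_n -> T -> R) (mco : forall i, measurable_fun setT (co i)).
Variable mu : {measure set T -> \bar R}.
Hypothesis mu_cube : forall a l, (0 < l)%R -> mu (cube co a l) = (l ^+ n)%:E.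

(** The condition A_q with q = 1 + 1 / [kap], where [I] is the integral of the
    weight over the cube. *)
Definition Ap_data (v : T -> R) (kap K : R) := forall a l, (0 < l)%R ->
  exists I : R, [/\ (0 < I)%R, \int[mu]_(x in cube co a l) (v x)%:E = I%:E &
  \int[mu]_(x in cube co a l) ((I / l ^+ n / v x) `^ kap)%:E <= (K * l ^+ n)%:E].

(** Let [m] be the average of [v] over the triple.  Pointwise 1 is at most
    (lam / m) v + (m / v)^kap / M; integrated over the small cube, the second
    term takes at most half of its volume when M is large.  So the integral of
    [v] over the small cube is at least a fixed fraction of that over the
    triple. *)
Lemma Ap_doubling (v : T -> R) (kap K : R) (mv : measurable_fun setT v)
  (v0 : forall x, (0 <= v x)%R) : (forall x, (0 < v x)%R) -> (0 < kap)%R -> (0 <= K)%R ->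
  Ap_data v kap K -> exists D : R, doubling co (density_measure mu mv v0) D.
Proof.
move=> vpos kap0 K0 HV.
have n30 : (0 < 3 ^+ n :> R)%R by exact: exprn_gt0.
pose M := (2 * K * 3 ^+ n + 1)%R; have M0 : (0 < M)%R.
  by rewrite ltr_wpDl// !mulr_ge0// ltW.
pose lam := (M `^ kap^-1)%R; have lam0 : (0 < lam)%R by exact: powR_gt0.
have lamk : (lam `^ kap = M)%R.
  by rewrite /lam -powRrM mulVf ?gt_eqF// powRr1// ltW.
have step a l : (0 < l)%R -> density_measure mu mv v0 (cube co (triple a l).1 (triple a l).2)
    <= (2 * lam * 3 ^+ n)%:E * density_measure mu mv v0 (cube co a l).
  move=> l0; rewrite !density_measureE.
  have [J [J0 JE _]] := HV a l l0; rewrite JE.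
  have l30 : (0 < (triple a l).2)%R by rewrite /= mulr_gt0.
  have [I [I0 IE HI]] := HV (triple a l).1 _ l30; rewrite IE.
  set Q := cube co a l in JE *; set Q' := cube co (triple a l).1 _ in IE HI.
  rewrite /= exprMn in HI.
  have mQ : measurable Q by exact: measurable_cube.
  have mQ' : measurable Q' by exact: measurable_cube.
  have QQ' : Q `<=` Q' by apply: subset_cube => i /=; split; lra.
  set L := (l ^+ n)%R in HI; have L0 : (0 < L)%R by exact: exprn_gt0.
  have QL : mu Q = L%:E by exact: mu_cube.
  set m := (I / (3 ^+ n * L))%R in HI.
  have m0 : (0 < m)%R by rewrite divr_gt0// mulr_gt0.
  have mVk : measurable_fun setT (fun x => (m / v x) `^ kap)%R.
    apply: measurableT_comp (measurable_powR kap) _; apply: measurable_funM => //.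
    rewrite (_ : (fun _ => _) = (fun x => v x `^ (-1))%R).
      exact: measurableT_comp (measurable_powR _) mv.
    by apply/funext => x; rewrite powR_inv1// ltW.
  have mE (f : T -> R) A : measurable_fun setT f -> measurable_fun A (fun x => (f x)%:E).
    by move=> mf; apply/measurable_EFinP; exact: measurable_funTS.
  have pt x : (1 <= lam / m * v x + M^-1 * (m / v x) `^ kap)%R.
    have [le1|lt1] := leP 1%R (lam / m * v x)%R.
      by apply: (le_trans le1); rewrite lerDl mulr_ge0 ?powR_ge0// invr_ge0 ltW.
    apply: (@le_trans _ _ (M^-1 * (m / v x) `^ kap)%R); last first.
      by rewrite lerDr !mulr_ge0 ?invr_ge0 ?(ltW lam0) ?(ltW m0).
    rewrite -ler_pdivrMl ?invr_gt0// invrK mulr1 -lamk.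
    apply: ge0_ler_powR; rewrite ?nnegrE; [exact: ltW|exact: ltW|by rewrite divr_ge0// ltW|].
    rewrite ler_pdivlMr//; move: lt1; rewrite mulrAC ltr_pdivrMr// mul1r; exact: ltW.
  have : (L%:E <= (lam / m)%:E * J%:E + (M^-1)%:E * (K * (3 ^+ n * L))%:E).
    rewrite -QL -(mul1e (mu Q)) -integral_cst//.
    apply: (@le_trans _ _ (\int[mu]_(x in Q) ((lam / m)%:E * (v x)%:E +
        (M^-1)%:E * ((m / v x) `^ kap)%:E))).
      apply: ge0_le_integral => //.
      - by apply: emeasurable_funD; apply: emeasurable_funM => //; exact: mE.
      - by move=> x _; rewrite -!EFinM -EFinD lee_fin; exact: pt.
    have lm0 : (0 <= lam / m)%R by rewrite divr_ge0// ltW.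
    have Mi0 : (0 <= M^-1)%R by rewrite invr_ge0 ltW.
    have p1 x : Q x -> 0 <= (v x)%:E by rewrite lee_fin.
    have p2 x : Q x -> 0 <= ((m / v x) `^ kap)%:E by rewrite lee_fin powR_ge0.
    have p3 x : Q x -> 0 <= (lam / m)%:E * (v x)%:E.
      by rewrite -EFinM lee_fin mulr_ge0.
    have p4 x : Q x -> 0 <= (M^-1)%:E * ((m / v x) `^ kap)%:E.
      by rewrite -EFinM lee_fin mulr_ge0 ?powR_ge0.
    have m1 := mE v Q mv; have m2 := mE _ Q mVk.
    have m3 : measurable_fun Q (fun x => (lam / m)%:E * (v x)%:E).
      exact: emeasurable_funM.
    have m4 : measurable_fun Q (fun x => (M^-1)%:E * ((m / v x) `^ kap)%:E).
      exact: emeasurable_funM.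
    rewrite ge0_integralD// ge0_integralZl// ge0_integralZl//.
    rewrite JE leeD2l// lee_pmul2l ?lte_fin ?invr_gt0//.
    apply: le_trans HI; apply: ge0_subset_integral => //; first exact: mE.
    by move=> x _; rewrite lee_fin powR_ge0.
  rewrite -!EFinM -EFinD !lee_fin => H.
  have half : (M^-1 * (K * (3 ^+ n * L)) <= L / 2)%R.
    rewrite ler_pdivrMl// /M.
    rewrite (_ : ((2 * K * 3 ^+ n + 1) * (L / 2) = K * (3 ^+ n * L) + L / 2)%R);
      last by field.
    by rewrite lerDl divr_ge0// ltW.
  have {}H : (L / 2 <= lam / m * J)%R by lra.
  have : (m * (L / 2) <= lam * J)%R.
    by rewrite -ler_pdivlMl// mulrA (mulrC m^-1%R).
  rewrite /m => H2.
  have E : (I / (3 ^+ n * L) * (L / 2) = I / (2 * 3 ^+ n))%R.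
    by field; rewrite !gt_eqF.
  rewrite E ler_pdivrMr ?mulr_gt0// in H2.
  by apply: (le_trans H2); rewrite le_eqVlt; apply/orP; left; apply/eqP; ring.
exists (Num.max 1 (2 * lam * 3 ^+ n))%R; split.
- by rewrite le_max lexx.
- move=> a l l0; have [I [I0 IE _]] := HV a l l0.
  by rewrite density_measureE IE lte_fin I0 ltry.
- move=> a l l0; apply: (le_trans (step a l l0)).
  by rewrite lee_wpmul2r// lee_fin le_max lexx orbT.
Qed.

End Ap_doubling.

Section euclidean_weights.
Context (R : realType) (n : nat).
Local Notation Rn := (euclidean R n).
Local Notation mu := (leb R n).
Local Notation cube := (cube (@ecoord R n)).

Lemma leb_cube_gt0 a (l : R) : (0 < l)%R -> mu (cube a l) = (l ^+ n)%:E.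
Proof. by move=> l0; rewrite leb_cube// ltW. Qed.

Lemma measurable_ecube a (l : R) : measurable (cube a l).
Proof. exact: (measurable_cube (@measurable_ecoord R n)). Qed.

Lemma cubes_cube a (l : R) : (0 < l)%R -> cubes (cube a l).
Proof. by move=> l0; exists a, l. Qed.

Lemma RHinfty_real (u : Rn -> \bar R) : RHinfty u -> exists ur : Rn -> R,
  [/\ measurable_fun setT ur, forall x, (0 < ur x)%R,
      \forall x \ae mu, u x = (ur x)%:E &
   exists eta K : R, [/\ (0 < eta)%R, (0 <= K)%R &
    forall (a : 'I_n -> R) l, (0 < l)%R -> exists2 S : R, (0 < S)%R &
    {ae mu, forall x, cube a l x -> (ur x <= S)%R} /\
    \int[mu]_(x in cube a l) ((S / ur x) `^ eta)%:E <= (K * l ^+ n)%:E]].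
Proof.
move=> [[mu_ u0] avgfin supfin].
have [ur [mur ur0 uur]] := real_weight mu_ u0.
exists ur; split; [exact: mur|exact: ur0|exact: uur|].
set s := ereal_sup _ in supfin.
pose C := Num.max 1%R (fine s).
have C1 : (1 <= C)%R by rewrite /C le_max lexx.
have sC : s <= C%:E.
  case: (s) supfin @C C1 => [r||] //= _ _; last by rewrite leNye.
  by rewrite lee_fin le_max lexx orbT.
apply: (@RHinfty_integral _ Rn R n (@ecoord R n) (@measurable_ecoord R n) mu
  leb_cube_gt0 (@leb_halfopen_box R n) (@leb_approx R n) ur C mur ur0 C1).
move=> a l l0; have L0 : (0 < l ^+ n)%R by exact: exprn_gt0.
have QL := leb_cube_gt0 a l0.
apply: (RHinfty_cube mu_ mur ur0 uur (measurable_ecube a l) L0 QL).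
- exact: le_trans C1.
- exact: avgfin (cubes_cube a l0).
- apply: le_trans sC; apply: ereal_sup_ubound.
  by exists (cube a l); [exact: cubes_cube|].
Qed.

Lemma Ainfty_real (v : Rn -> \bar R) : Ainfty v -> exists vr : Rn -> R,
  [/\ measurable_fun setT vr, forall x, (0 < vr x)%R,
      \forall x \ae mu, v x = (vr x)%:E &
   exists kap K : R, [/\ (0 < kap)%R, (0 <= K)%R & Ap_data (@ecoord R n) mu vr kap K]].
Proof.
move=> [[mv v0] [q [q1 qfin]]].
have [vr [mvr vr0 vvr]] := real_weight mv v0.
exists vr; split; [exact: mvr|exact: vr0|exact: vvr|].
have L0 l : (0 < l -> 0 < l ^+ n :> R)%R by exact: exprn_gt0.
move: qfin; rewrite /Ap_char; case: ifPn => [_|qN1].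
  rewrite unlock.
  have mT : 0 < mu [set: Rn].
    have l01 : (0 < 1 :> R)%R by [].
    apply: (@lt_le_trans _ _ (mu (cube (fun=> 0%R) 1%R))).
      by rewrite leb_cube_gt0// expr1n lte_fin.
    by apply: le_measure; rewrite ?inE; [exact: measurable_ecube|exact: measurableT|].
  rewrite mT; set s := ess_sup _ _ => sfin.
  pose K := Num.max 1%R (fine s).
  have K1 : (1 <= K)%R by rewrite /K le_max lexx.
  have K0 : (0 < K)%R by exact: lt_le_trans K1.
  have sK : s <= K%:E.
    case: (s) sfin @K K1 K0 => [r||] //= _ _ _; last by rewrite leNye.
    by rewrite lee_fin le_max lexx orbT.
  have /ess_supP H := sK.
  exists 1%R, K; split; [exact: ltr01|exact: ltW|].
  move=> a l l0; apply: (A1_cube mv mvr vr0 vvr (measurable_ecube a l) (L0 _ l0)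
    (leb_cube_gt0 a l0) K0).
  apply: filterS2 vvr H => x vx Hx Qx.
  have vrx := vr0 x.
  have : maximal v x / v x <= K%:E by apply: le_trans Hx; exact: lee_abs.
  rewrite vx inver (gt_eqF vrx) lee_pdivrMr// => Mx.
  apply: le_trans Mx; apply: ereal_sup_ubound.
  by exists (cube a l) => //; split => //; exact: cubes_cube.
have {}q1 : (1 < q)%R by rewrite lt_neqAle eq_sym qN1.
set s := ereal_sup _ => sfin.
pose K := Num.max 0%R (fine s).
have K0 : (0 <= K)%R by rewrite /K le_max lexx.
have sK : s <= K%:E.
  case: (s) sfin @K K0 => [r||] //= _ _; last by rewrite leNye.
  by rewrite lee_fin le_max lexx orbT.
exists (q - 1)^-1%R, (K `^ (q - 1)^-1)%R; split.
- by rewrite invr_gt0 subr_gt0.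
- exact: powR_ge0.
move=> a l l0; apply: (Aq_cube mv mvr vr0 vvr (measurable_ecube a l) (L0 _ l0)
    (leb_cube_gt0 a l0) q1 K0).
apply: le_trans sK; apply: ereal_sup_ubound.
by exists (cube a l); [exact: cubes_cube|].
Qed.

End euclidean_weights.

(** * Distribution estimate from one weighted inequality *)

Section exhaustion.
Context d (T : measurableType d) (R : realType) (n : nat).
Variables (co : 'I_n -> T -> R) (mco : forall i, measurable_fun setT (co i)).

Definition bigcube (k : nat) : set T := cube co (fun=> - k%:R)%R (k.*2%:R)%R.

Lemma bigcube_cover : \bigcup_k bigcube k = setT.
Proof.
apply/seteqP; split => // x _.
pose M := (\sum_(i < n) `|co i x|)%R.
exists (Num.bound M) => // i.
have M0 : (0 <= M)%R by exact: sumr_ge0.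
have xM : (`|co i x| <= M)%R by rewrite /M (bigD1 i)//= lerDl sumr_ge0.
have := archi_boundP M0 => Mb.
have /ler_normlP[? ?] := le_trans xM (ltW Mb).
by rewrite -muln2 natrM; apply/andP; split; lra.
Qed.

Lemma bigcube_nd : nondecreasing_seq bigcube.
Proof.
move=> k m km; apply/subsetPset; apply: subset_cube => i.
have : (k%:R <= m%:R :> R)%R by rewrite ler_nat.
by rewrite -!muln2 !natrM => ?; split; lra.
Qed.

Lemma measurable_bigcube k : measurable (bigcube k).
Proof. exact: measurable_cube. Qed.

End exhaustion.

Section level_set_estimate.
Context d (T : measurableType d) (R : realType) (n : nat).
Variables (co : 'I_n -> T -> R) (mco : forall i, measurable_fun setT (co i)).
Variable nu : {measure set T -> \bar R}.
Variable D : R.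
Hypothesis nuD : doubling co nu D.
Local Notation cmax := (cmax co nu).

(** The function itself is included in the maximum so that it is bounded by its
    envelope at every point, without a differentiation theorem. *)
Definition menv (g : T -> \bar R) (x : T) : \bar R := maxe (g x) (cmax g x).

Lemma measurable_menv g : measurable_fun setT g -> measurable_fun setT (menv g).
Proof. by move=> mg; apply: measurable_maxe => //; exact: measurable_cmax. Qed.

Let D1 : (1 <= D)%R. Proof. by case: nuD. Qed.
Let D0 : (0 < D)%R. Proof. exact: lt_le_trans D1. Qed.

Let mgt (h : T -> \bar R) y : measurable_fun setT h -> measurable [set x | y < h x].
Proof. exact: superlevel_measurable. Qed.

Lemma menv_weak g (y : R) : (forall x, 0 <= g x) -> measurable_fun setT g ->
  (0 < y)%R ->
  nu [set x | y%:E < menv g x] <=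
  nu [set x | y%:E < g x] + (D / y)%:E * \int[nu]_x g x.
Proof.
move=> g0 mg y0.
have mc : measurable_fun setT (cmax g) by exact: measurable_cmax.
apply: (@le_trans _ _ (nu [set x | y%:E < g x] + nu [set x | y%:E < cmax g x])).
  apply: le_trans (measureU2 _ _ _); try exact: mgt.
  rewrite le_measure ?inE//.
  - exact/mgt/measurable_menv.
  - by apply: measurableU; exact: mgt.
  - by move=> x; rewrite /menv/= lt_max => /orP.
rewrite leeD2l// (mulrC D) EFinM -muleA lee_pdivlMl//.
exact: (cmax_weak mco nuD g0 mg y0).
Qed.

Lemma cmax_gt0 g (k : nat) : (forall x, 0 <= g x) -> measurable_fun setT g ->
  0 < \int[nu]_(x in bigcube co k) g x -> forall x, 0 < cmax g x.
Proof.
move=> g0 mg Ig x.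
have [m _ xm] : (\bigcup_k bigcube co k) x by rewrite bigcube_cover.
pose K := (maxn k m).+1.
have kK : bigcube co k `<=` bigcube co K.
  by apply/subsetPset/bigcube_nd; rewrite ltnW// ltnS leq_maxl.
have mK : bigcube co m `<=` bigcube co K.
  by apply/subsetPset/bigcube_nd; rewrite ltnW// ltnS leq_maxr.
have K0 : (0 < K.*2%:R :> R)%R by rewrite ltr0n double_gt0.
have := int_cube_le mco nuD g0 mg K0 (mK _ xm) => H.
rewrite lt_neqAle cmax_ge0// andbT; apply/eqP => cx0.
move: H; rewrite -cx0 mule0 leNgt => /negP; apply; apply: (lt_le_trans Ig).
apply: ge0_subset_integral => //; try exact: measurable_bigcube.
exact: measurable_funTS.
Qed.

Variables (rho e : R).
Hypotheses (rho1 : (1 < rho)%R) (e0 : (0 < e <= 2^-1)%R).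

Let rho0 : (0 < rho)%R. Proof. exact: lt_trans rho1. Qed.

(** Below height 1 the distribution function of [g] is at most
    y^(-1/e) tau, and above height 1 at most y^-2 tau; the heights y are
    sampled along two geometric progressions. *)
Definition level_bounds (g : T -> \bar R) (tau : R) := forall k : nat,
  nu [set x | (rho `^ (- e * k%:R))%:E < g x] <= (rho ^+ k * tau)%:E /\
  nu [set x | (rho `^ (k%:R / 2))%:E < g x] <= (rho ^- k * tau)%:E.

Let q : R := (rho `^ (- 2^-1))%R.
Let q01 : (0 <= q < 1)%R.
Proof.
by rewrite /q powR_ge0/= -[ltRHS](powRr0 rho) gt1_ltr_powR// oppr_lt0 invr_gt0.
Qed.

Definition level_cst : R := (1 + rho / (1 - q))%R.
Let level_cst_gt0 : (0 < level_cst)%R.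
Proof.
rewrite /level_cst ltr_wpDr// divr_ge0 ?(ltW rho0)// subr_ge0 ltW//.
by case/andP: q01.
Qed.

(** Below the height rho^(-e K) the measure of [A] is used, above it the level
    bounds.  Since [e <= 1 / 2], the layers form a geometric series of ratio
    rho^(-1/2). *)
Lemma level_integral g tau (A : set T) (K : nat) : (forall x, 0 <= g x) ->
  measurable_fun setT g -> (0 < tau)%R -> level_bounds g tau -> measurable A ->
  nu A <= (rho ^+ K * tau)%:E ->
  \int[nu]_(x in A) g x <= (level_cst * rho `^ ((1 - e) * K%:R) * tau)%:E.
Proof.
move=> g0 mg tau0 lev mA nuA; have /andP[e_gt0 e_le] := e0.
pose y j := if (j <= K)%N then (rho `^ (- e * (K - j)%:R))%R
            else (rho `^ ((j - K)%:R / 2))%R.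
have y0 j : (0 <= y j)%R by rewrite /y; case: ifP; rewrite powR_ge0.
have yoo M : exists j, (M <= y j)%R.
  have r2 : (1 < rho `^ 2^-1)%R by rewrite -[ltLHS](powRr0 rho) gt1_ltr_powR// invr_gt0.
  have [j Mj] := exprn_unbounded r2 M; exists (K + j.+1)%N.
  rewrite /y leqNgt -{1}(addn0 K) ltn_add2l/= addKn.
  apply: (le_trans Mj); rewrite -powR_mulrn ?powR_ge0// -powRrM.
  rewrite ler_powR ?(ltW rho1)// mulrC ler_wpM2r// ?invr_ge0//.
  by rewrite ler_nat.
apply: (le_trans (integral_le_layers nu mA mg g0 y0 yoo)).
pose P := (rho * rho `^ ((1 - e) * K%:R) * tau)%R.
have P0 : (0 <= P)%R by rewrite !mulr_ge0 ?powR_ge0 ?(ltW rho0) ?(ltW tau0).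
have rX k : (rho ^+ k = rho `^ k%:R)%R by rewrite powR_mulrn// ltW.
have rM s t : (rho `^ s * rho `^ t = rho `^ (s + t))%R.
  by rewrite powRD//; apply/implyP => _; rewrite gt_eqF.
have qX j : (q ^+ j = rho `^ (- (j%:R / 2)))%R.
  by rewrite /q -powR_mulrn ?powR_ge0// -powRrM; congr (_ `^ _)%R; ring.
have PE j : (P * q ^+ j = rho `^ (1 + (1 - e) * K%:R - j%:R / 2) * tau)%R.
  transitivity (rho `^ 1 * rho `^ ((1 - e) * K%:R) * rho `^ (- (j%:R / 2)) * tau)%R.
    by rewrite powRr1 ?(ltW rho0)// /P qX; ring.
  by rewrite !rM.
have termE s k : (rho `^ s * (rho `^ k * tau) = rho `^ (s + k) * tau)%R.
  by rewrite mulrA rM.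
apply: (@le_trans _ _ ((rho `^ ((1 - e) * K%:R) * tau)%:E +
    \sum_(j <oo) (P * q ^+ j)%:E)).
  apply: leeD.
    apply: (@le_trans _ _ ((y 0%N)%:E * (rho ^+ K * tau)%:E)).
      by rewrite lee_wpmul2l// lee_fin.
    rewrite -EFinM lee_fin /y leq0n subn0 rX termE.
    by rewrite ler_pM2r// ler_powR ?(ltW rho1)//; lra.
  apply: lee_nneseries => [j _ _|j _].
    by rewrite mule_ge0// lee_fin.
  rewrite PE; have [jK|Kj] := ltnP j K.
    apply: (@le_trans _ _ ((y j.+1)%:E * (rho ^+ (K - j) * tau)%:E)).
      rewrite lee_wpmul2l ?lee_fin// /y (ltnW jK).
      apply: le_trans (lev (K - j)%N).1; rewrite le_measure ?inE//.
      - by apply: measurableI => //; exact: mgt.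
      - exact: mgt.
    rewrite -EFinM lee_fin /y jK rX termE ler_pM2r// ler_powR ?(ltW rho1)//.
    have Kj : (K - j = (K - j.+1).+1)%N by rewrite subnSK.
    have jK' : (j.+1%:R + (K - j.+1)%:R = K%:R :> R)%R by rewrite -natrD subnKC.
    rewrite Kj -natr1 -jK' -natr1; set X := ((K - j.+1)%:R)%R.
    have j0 : (0 <= j%:R :> R)%R by [].
    have X0 : (0 <= X)%R by exact: ler0n.
    have : (e * j%:R <= 2^-1 * j%:R)%R by rewrite ler_wpM2r.
    by lra.
  apply: (@le_trans _ _ ((y j.+1)%:E * (rho ^- (j - K) * tau)%:E)).
    rewrite lee_wpmul2l ?lee_fin//.
    apply: le_trans (lev (j - K)%N).2; rewrite le_measure ?inE//.
    - by apply: measurableI => //; exact: mgt.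
    - exact: mgt.
    - apply: subset_trans (@subIsetr _ _ _) _ => x /=.
      apply: le_lt_trans; rewrite lee_fin /y; case: ifPn => // jK.
      have -> : j = K by apply/eqP; rewrite eqn_leq jK Kj.
      by rewrite subnn mulr0 mul0r.
  rewrite -EFinM lee_fin /y leqNgt ltnS Kj/= rX -powRN termE.
  rewrite ler_pM2r// ler_powR ?(ltW rho1)// subSn//.
  have jK' : (K%:R + (j - K)%:R = j%:R :> R)%R by rewrite -natrD subnKC.
  rewrite -natr1 -jK'; set X := ((j - K)%:R)%R.
  have K0 : (0 <= K%:R :> R)%R by exact: ler0n.
  have X0 : (0 <= X)%R by exact: ler0n.
  have : (e * K%:R <= 2^-1 * K%:R)%R by rewrite ler_wpM2r.
  by lra.
have := geometric_nneseries P0 q01 => /(leeD2l (rho `^ ((1 - e) * K%:R) * tau)%:E) /le_trans.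
apply; rewrite -EFinD lee_fin le_eqVlt; apply/orP; left; apply/eqP.
by rewrite /P /level_cst; field; case/andP: q01 => _ ?; rewrite subr_eq0 gt_eqF.
Qed.

(** The part of [g] above height 1 has integral at most [level_cst] times
    [tau], which the weak type inequality applies to; the rest of max (g, 1) is
    bounded by 1 and adds at most 1 to the maximal function. *)
Lemma menv_tail (th : R) : (0 < th)%R -> exists2 kp : R, (1 < kp)%R &
  forall g tau, (forall x, 0 <= g x) -> measurable_fun setT g -> (0 < tau)%R ->
  level_bounds g tau ->
  nu [set x | kp%:E < menv (fun x => maxe (g x) 1) x] <= (th * tau)%:E.
Proof.
move=> th0.
have [j rj] := exprn_unbounded rho1 (2 / th)%R.
have rj0 : (0 < rho ^+ j)%R by exact: exprn_gt0.
pose y := (2 * D * level_cst / th)%R.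
have y0 : (0 < y)%R by rewrite divr_gt0// !mulr_gt0.
exists (1 + y + rho `^ (j%:R / 2))%R.
  by rewrite -addrA ltrDl addr_gt0// powR_gt0.
move=> g tau g0 mg tau0 lev; set kp := (1 + y + _)%R.
pose gt x := maxe (g x) 1; rewrite -/gt.
have pj0 : (0 < rho `^ (j%:R / 2))%R by exact: powR_gt0.
have gt0 x : 0 <= gt x by rewrite /gt le_max g0.
have mgt' : measurable_fun setT gt by exact: measurable_maxe.
pose A := [set x | 1%:E < g x].
have mA : measurable A by exact: mgt.
pose g1 := g \_ A.
have g10 x : 0 <= g1 x by rewrite /g1 patchE; case: ifP.
have mg1 : measurable_fun setT g1.
  by apply/(measurable_restrictT _ mA); exact: measurable_funTS.
have gg1 x : gt x <= g1 x + 1%:E.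
  rewrite /gt /g1 patchE; case: ifPn => [_|xA]; rewrite ge_max.
    by rewrite leeDl// leeDr.
  rewrite add0e lexx andbT leNgt; apply/negP => gx.
  by move: xA; rewrite notin_setE; apply.
have cm := cmax_leD mco nuD g10 mg1 gt0 mgt' ler01 gg1.
have nuA : nu A <= (rho ^+ 0 * tau)%:E.
  by have := (lev 0%N).1; rewrite mulr0 powRr0.
have IA : \int[nu]_x g1 x <= (level_cst * tau)%:E.
  have := level_integral g0 mg tau0 lev mA nuA.
  by rewrite mulr0 powRr0 mulr1 /g1 integral_mkcond.
have mcg1 : measurable_fun setT (cmax g1) by exact: measurable_cmax.
apply: (@le_trans _ _ (nu [set x | (rho `^ (j%:R / 2))%:E < g x] +
    nu [set x | y%:E < cmax g1 x])).
  apply: le_trans (measureU2 _ _ _); try exact: mgt.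
  rewrite le_measure ?inE//.
  - exact/mgt/measurable_menv.
  - by apply: measurableU; exact: mgt.
  - move=> x; rewrite /menv/= /gt => H; move: H; rewrite !lt_max => /orP[/orP[H|H]|H].
    + left; apply: lt_trans H; rewrite lte_fin /kp ltrDr addr_gt0//.
    + by move: H; rewrite lte_fin /kp -addrA gtrDl ltNge (ltW (addr_gt0 _ _)).
    + right; have := lt_le_trans H (cm x) => {}H.
      have : (1 + y)%:E < cmax g1 x + 1%:E.
        by apply: lt_trans H; rewrite lte_fin /kp ltrDl.
      by rewrite EFinD addeC lteD2rE.
have -> : (th * tau)%:E = (th / 2 * tau)%:E + (th / 2 * tau)%:E.
  by rewrite -EFinD; congr EFin; field.
apply: leeD.
  apply: le_trans (lev j).2 _; rewrite lee_fin ler_pM2r//.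
  rewrite -[leRHS]invrK invf_div lef_pV2 ?posrE ?divr_gt0//.
apply: (@le_trans _ _ ((D / y)%:E * \int[nu]_x g1 x)).
  rewrite (_ : (D / y)%:E = (y^-1)%:E * D%:E); last by rewrite -EFinM mulrC.
  rewrite -muleA lee_pdivlMl//; exact: (cmax_weak mco nuD g10 mg1 y0).
apply: (@le_trans _ _ ((D / y)%:E * (level_cst * tau)%:E)).
  by rewrite lee_wpmul2l// lee_fin divr_ge0 ?(ltW D0) ?(ltW y0).
rewrite -EFinM lee_fin /y le_eqVlt; apply/orP; left; apply/eqP.
by field; rewrite !gt_eqF.
Qed.

Variables (p0 r al K0 : R).
Hypotheses (p00 : (0 < p0)%R) (r0 : (0 < r < p0)%R) (al1 : (al < 1)%R).
Hypotheses (ale : (1 - e < al)%R) (K00 : (0 <= K0)%R).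

Let gam : R := ((p0 - r) / r)%R.

Let al0 : (0 < al)%R.
Proof. by have := ale; have /andP[_ ?] := e0; lra. Qed.

(** By the weak type inequality for the indicator of [E], the envelope [a]
    exceeds rho^-j on a set of measure at most a multiple of rho^j tau, on which
    [level_integral] bounds the integral of [g] by a multiple of
    rho^((1 - e) j) tau.  As [al > 1 - e], the powers a^al make the sum over j
    converge. *)
Lemma weighted_level_integral : exists2 C2 : R, (0 <= C2)%R &
  forall g tau (E : set T) (a : T -> R), (forall x, 0 <= g x) ->
    measurable_fun setT g -> (0 < tau)%R -> level_bounds g tau ->
    measurable E -> nu E = tau%:E -> measurable_fun setT a -> (forall x, (0 < a x)%R) ->
    (\forall x \ae nu, menv (fun x => (\1_E x)%:E) x = (a x)%:E) ->
    \int[nu]_x (g x * (a x `^ al)%:E) <= (C2 * tau)%:E.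
Proof.
have [J rJ] := exprn_unbounded rho1 (1 + D)%R.
pose w := (rho `^ (1 - e - al))%R.
have w01 : (0 <= w < 1)%R.
  rewrite /w powR_ge0/= -[ltRHS](powRr0 rho) gt1_ltr_powR//.
  by have := ale; lra.
pose P := (level_cst * rho `^ ((1 - e) * J.+1%:R))%R.
have P0 : (0 <= P)%R by rewrite mulr_ge0 ?powR_ge0 ?(ltW level_cst_gt0).
exists (P / (1 - w))%R.
  by rewrite divr_ge0// subr_ge0 ltW//; case/andP: w01.
move=> g tau E a g0 mg tau0 lev mE nuE ma a0 aE.
pose one x : \bar R := (\1_E x)%:E.
have one0 x : 0 <= one x by rewrite lee_fin.
have mone : measurable_fun setT one.
  by apply/measurable_EFinP; exact: measurable_indic.
have Ione : \int[nu]_x one x = tau%:E by rewrite /one integral_indic// setIT.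
have oneL x : one x <= 1 by rewrite lee_fin indicE; case: (_ \in _).
have mf1 x : menv one x <= 1.
  rewrite /menv ge_max oneL/=.
  have zz y : 0 <= (fun _ : T => 0 : \bar R) y by [].
  have := @cmax_leD _ _ _ _ _ mco nu _ nuD one (fun=> 0) 1%R zz
    (measurable_cst _) one0 mone ler01.
  move=> H; have := H (fun x => _) x; rewrite add0e => /(_ oneL) H1.
  apply: (le_trans H1); rewrite geeDr//.
  apply: ge_ereal_sup => _ [k _ <-].
  by rewrite integral0 mule0 mul0e.
pose S j := [set x | (rho ^- j.+1)%:E < menv one x].
have mmf := measurable_menv mone.
have mS j : measurable (S j) by exact: mgt.
have nuS j : nu (S j) <= (rho ^+ (J + j.+1) * tau)%:E.
  have rj0 : (0 < rho ^+ j.+1)%R by exact: exprn_gt0.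
  have rj0' : (0 < rho ^- j.+1)%R by rewrite invr_gt0.
  apply: (le_trans (menv_weak one0 mone rj0')).
  apply: (@le_trans _ _ (tau%:E + (D / rho ^- j.+1)%:E * tau%:E)).
    rewrite Ione leeD2r// -nuE le_measure ?inE//; first exact: mgt.
    move=> x /=; rewrite /one indicE; case: (boolP (x \in E)); rewrite ?inE//.
    by rewrite lte_fin ltNge (ltW rj0').
  rewrite -EFinM -EFinD lee_fin invrK exprD.
  have : (1 <= rho ^+ j.+1)%R by rewrite exprn_ege1// ltW.
  set X := (rho ^+ j.+1)%R in rj0 *; move=> X1.
  have : ((1 + D) * X * tau <= rho ^+ J * X * tau)%R by rewrite !ler_pM2r.
  apply: le_trans; rewrite mulrDl mul1r mulrDl lerD2r.
  by rewrite ler_peMl// ltW.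
have rX k : (rho ^+ k = rho `^ k%:R)%R by rewrite powR_mulrn// ltW.
have rM s t : (rho `^ s * rho `^ t = rho `^ (s + t))%R.
  by rewrite powRD//; apply/implyP => _; rewrite gt_eqF.
pose c j := (rho `^ (- al * j%:R))%R.
have c0 j : (0 <= c j)%R by exact: powR_ge0.
have mind j : measurable_fun setT (fun x => ((c j)%:E * (g \_ (S j)) x)).
  apply: emeasurable_funM => //.
  by apply/(measurable_restrictT _ (mS j)); exact: measurable_funTS.
have gS0 j x : 0 <= (g \_ (S j)) x by rewrite patchE; case: ifP.
have ind0 j x : 0 <= (c j)%:E * (g \_ (S j)) x.
  by rewrite mule_ge0// lee_fin.
have mapow : measurable_fun setT (fun x => (a x `^ al)%:E).
  by apply/measurable_EFinP; exact: measurableT_comp (measurable_powR al) ma.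
apply: (@le_trans _ _ (\int[nu]_x \sum_(j <oo) (c j)%:E * (g \_ (S j)) x)).
  apply: ae_ge0_le_integral => //.
  - by move=> x _; rewrite mule_ge0// lee_fin powR_ge0.
  - exact: emeasurable_funM.
  - by move=> x _; exact: nneseries_ge0.
  - exact: ge0_emeasurable_sum.
  apply: filterS aE => x ax _.
  have a1 : (a x <= 1)%R by rewrite -lee_fin -ax; exact: mf1.
  have ex : exists j, (rho ^- j.+1 < a x)%R.
    have [j Hj] := exprn_unbounded rho1 (a x)^-1%R; exists j.
    rewrite -[ltRHS]invrK ltf_pV2 ?posrE ?invr_gt0 ?exprn_gt0//.
    by apply: (le_lt_trans Hj); rewrite exprS ltr_pMl ?exprn_gt0.
  case: (ex_minnP ex) => j aj minj.
  have ajle : (a x <= rho ^- j)%R.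
    case: j aj minj => [|j] aj minj; first by rewrite expr0 invr1.
    by rewrite leNgt; apply/negP => /minj; rewrite ltnn.
  apply: (@le_trans _ _ ((c j)%:E * (g \_ (S j)) x)).
    rewrite patchE mem_set; last by rewrite /S/= ax lte_fin.
    rewrite muleC lee_wpmul2r// lee_fin /c.
    apply: (@le_trans _ _ ((rho ^- j) `^ al)%R).
      by rewrite ge0_ler_powR ?nnegrE ?(ltW al0) ?(ltW (a0 x))// invr_ge0 exprn_ge0// ltW.
    by rewrite rX -powRN -powRrM mulNr mulrC mulNr.
  by rewrite (nneseriesD1 (n := j))// leeDl// nneseries_ge0.
rewrite integral_nneseries//.
apply: (@le_trans _ _ (\sum_(j <oo) (P * tau * w ^+ j)%:E)).
  apply: lee_nneseries => [j _ _|j _]; first by apply: integral_ge0 => x _.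
  rewrite ge0_integralZl//; last 2 first.
  - by apply/(measurable_restrictT _ (mS j)); exact: measurable_funTS.
  - by rewrite lee_fin.
  rewrite -integral_mkcond.
  have := level_integral g0 mg tau0 lev (mS j) (nuS j) => H.
  apply: (@le_trans _ _ ((c j)%:E * (level_cst * rho `^ ((1 - e) * (J + j.+1)%:R) * tau)%:E)).
    by rewrite lee_wpmul2l// lee_fin.
  rewrite -EFinM lee_fin le_eqVlt; apply/orP; left; apply/eqP.
  rewrite /c /P /w -[in RHS]powR_mulrn ?powR_ge0// -[in RHS]powRrM.
  transitivity (level_cst * tau * (rho `^ (- al * j%:R) * rho `^ ((1 - e) * (J + j.+1)%:R)))%R.
    by ring.
  transitivity (level_cst * tau * (rho `^ ((1 - e) * J.+1%:R) * rho `^ ((1 - e - al) * j%:R)))%R;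
    last by ring.
  rewrite !rM; congr (_ * _ `^ _)%R.
  by rewrite natrD -!natr1; ring.
have Ptau : (0 <= P * tau)%R by rewrite mulr_ge0// ltW.
apply: (le_trans (geometric_nneseries Ptau w01)).
by rewrite lee_fin mulrAC.
Qed.

(** If {F > Cc} had measure greater than [tau], it would contain a set E of
    finite measure t > tau.  The inequality is tested on the envelopes a of the
    indicator of E and b of max (G^r, 1).  On the left, F > Cc and a >= 1 on E,
    and b <= kp on a part of E of measure at least t / 2.  On the right,
    G^p0 b^-gam <= G^r since b >= G^r, and [weighted_level_integral] applies.
    This contradicts the choice of Cc. *)
Lemma level_set_estimate : exists2 Cc : R, (0 < Cc)%R &
  forall F G : T -> \bar R,
    (forall x, 0 <= F x) -> measurable_fun setT F ->
    (forall x, 0 <= G x) -> measurable_fun setT G ->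
    (forall (g1 g2 : T -> \bar R) (a b : T -> R),
      (forall x, 0 <= g1 x) -> measurable_fun setT g1 ->
      (forall x, 0 <= g2 x) -> measurable_fun setT g2 ->
      measurable_fun setT a -> (forall x, (0 < a x)%R) ->
      measurable_fun setT b -> (forall x, (0 < b x)%R) ->
      (\forall x \ae nu, menv g1 x = (a x)%:E) ->
      (\forall x \ae nu, menv g2 x = (b x)%:E) ->
      \int[nu]_x (F x `^ p0 * (a x `^ al * b x `^ (- gam))%:E) <=
      K0%:E * \int[nu]_x (G x `^ p0 * (a x `^ al * b x `^ (- gam))%:E)) ->
    forall tau, (0 < tau)%R -> level_bounds (fun x => G x `^ r) tau ->
    nu [set x | Cc%:E < F x] <= tau%:E.
Proof.
have [C2 C20 HC2] := weighted_level_integral.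
have h2 : (0 < 2^-1 :> R)%R by [].
have [kp kp1 Hkp] := menv_tail h2.
have kp0 : (0 < kp)%R by apply: lt_trans kp1.
have /andP[r_gt0 r_lt] := r0.
have gam0 : (0 < gam)%R by rewrite divr_gt0// subr_gt0.
pose M := (2 * K0 * C2 * kp `^ gam + 1)%R.
have M0 : (0 < M)%R by rewrite ltr_wpDl// !mulr_ge0 ?powR_ge0.
pose Cc := (M `^ p0^-1)%R.
have Cc0 : (0 < Cc)%R by exact: powR_gt0.
have CcM : (Cc `^ p0 = M)%R.
  by rewrite /Cc -powRrM mulVf ?gt_eqF// powRr1// ltW.
exists Cc => // F G F0 mF G0 mG HP tau tau0 lev.
rewrite leNgt; apply/negP => big.
set S := [set x | Cc%:E < F x] in big.
have mS : measurable S by exact: mgt.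
pose E_ k := S `&` bigcube co k.
have mE_ k : measurable (E_ k) by apply: measurableI => //; exact: measurable_bigcube.
have UE : \bigcup_k E_ k = S by rewrite -setI_bigcupr bigcube_cover setIT.
have ndE : nondecreasing_seq E_.
  move=> k m km; apply/subsetPset; apply: setIS; apply/subsetPset.
  exact: bigcube_nd.
have cvgE : (nu \o E_) k @[k --> \oo] --> nu (\bigcup_k E_ k).
  by apply: nondecreasing_cvg_mu => //; rewrite UE.
rewrite UE in cvgE.
have [k Ek] : exists k, tau%:E < nu (E_ k).
  have : \forall k \near \oo, tau%:E < (nu \o E_) k.
    apply: (cvgE [set x | tau%:E < x]); apply: open_nbhs_nbhs; split;
      [exact: open_ereal_gt_ereal|exact: big].
  by move=> [k _ Hk]; exists k; apply: Hk => /=.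
have nuQ m : nu (bigcube co m) < +oo.
  have [_ H _] := nuD.
  apply: (@le_lt_trans _ _ (nu (bigcube co m.+1))).
    rewrite le_measure ?inE//; try exact: measurable_bigcube.
    by apply/subsetPset/bigcube_nd.
  by have /andP[] := H (fun=> - m.+1%:R)%R (m.+1.*2%:R)%R
    (ltac:(by rewrite ltr0n double_gt0)).
set E := E_ k in Ek; have mE : measurable E := mE_ k.
have Efin : nu E < +oo.
  apply: le_lt_trans (nuQ k); rewrite le_measure ?inE//; last exact: subIsetr.
  exact: measurable_bigcube.
pose t := fine (nu E).
have tE : nu E = t%:E by rewrite /t fineK// ge0_fin_numE.
have taut : (tau < t)%R by rewrite -lte_fin -tE.
have t0 : (0 < t)%R by apply: lt_trans taut.
pose g x := G x `^ r.
have g0 x : 0 <= g x by exact: poweR_ge0.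
have mg : measurable_fun setT g by exact: measurableT_comp (measurable_poweR r) mG.
have {}lev : level_bounds g t.
  move=> j; have [H1 H2] := lev j; split.
    by apply: (le_trans H1); rewrite lee_fin ler_pM2l ?exprn_gt0// ltW.
  by apply: (le_trans H2); rewrite lee_fin ler_pM2l ?invr_gt0 ?exprn_gt0// ltW.
pose one x : \bar R := (\1_E x)%:E.
have one0 x : 0 <= one x by rewrite lee_fin.
have mone : measurable_fun setT one.
  by apply/measurable_EFinP; exact: measurable_indic.
pose gt x := maxe (g x) 1.
have gt0 x : 0 <= gt x by rewrite /gt le_max g0.
have mgt' : measurable_fun setT gt by exact: measurable_maxe.
have meone : \forall x \ae nu, 0 < menv one x < +oo.
  apply: aeW => x; apply/andP; split.
    rewrite /menv lt_max; apply/orP; right; apply: (@cmax_gt0 _ k) => //.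
    rewrite /one integral_indic//; last exact: measurable_bigcube.
    by rewrite /E /E_ -setIA setIid -/(E_ k) -/E tE lte_fin.
  rewrite /menv gt_max; apply/andP; split.
    by apply: (@le_lt_trans _ _ 1); [rewrite lee_fin indicE; case: (_ \in _)|rewrite ltry].
  have := @cmax_leD _ _ _ _ _ mco nu _ nuD one (fun=> 0) 1%R (fun=> lexx _)
    (measurable_cst _) one0 mone ler01.
  have oneL y : one y <= 0 + 1%:E.
    by rewrite add0e lee_fin indicE; case: (_ \in _).
  move=> /(_ oneL x) /le_lt_trans; apply.
  rewrite (_ : cmax _ _ = 0) ?add0e ?ltry//.
  apply/eqP; rewrite eq_le cmax_ge0// andbT.
  apply: ge_ereal_sup => _ [m _ <-].
  by rewrite integral0 mule0 mul0e.
have [a [ma a0 aE]] := real_weight (measurable_menv mone) meone.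
have megt : \forall x \ae nu, 0 < menv gt x < +oo.
  exists [set x | menv gt x = +oo]; split.
  - rewrite -[X in measurable X]setTI.
    exact: (measurable_menv mgt' measurableT (emeasurable_set1 +oo)).
  - apply/eqP; rewrite eq_le measure_ge0 andbT.
    apply/lee_addgt0Pr => del del0; rewrite add0e.
    have th0 : (0 < del / t)%R by exact: divr_gt0.
    have [kp' _ /(_ g t g0 mg t0 lev)] := menv_tail th0.
    rewrite divfK ?gt_eqF//; apply: le_trans; rewrite le_measure ?inE//.
    + rewrite -[X in measurable X]setTI.
      exact: (measurable_menv mgt' measurableT (emeasurable_set1 +oo)).
    + exact/mgt/measurable_menv.
    + by move=> x /= ->; exact: ltry.
  - move=> x /= H; apply: contrapT => nH; apply: H.
    rewrite ltey; apply/andP; split; last by apply/eqP.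
    by apply: (@lt_le_trans _ _ 1) => //; rewrite /menv !le_max lexx orbT.
have [b [mb b0 bE]] := real_weight (measurable_menv mgt') megt.
have := HP one gt a b one0 mone gt0 mgt' ma a0 mb b0 aE bE.
pose w x := (a x `^ al * b x `^ (- gam))%R.
have w0 x : (0 <= w x)%R by rewrite mulr_ge0 ?powR_ge0.
have mpow (h : T -> R) s : measurable_fun setT h -> measurable_fun setT (fun x => h x `^ s)%R.
  by move=> mh; exact: measurableT_comp (measurable_powR s) mh.
have mw : measurable_fun setT (fun x => (w x)%:E).
  by apply/measurable_EFinP; apply: measurable_funM; exact: mpow.
have mFp : measurable_fun setT (fun x => F x `^ p0).
  exact: measurableT_comp (measurable_poweR p0) mF.
have mGp : measurable_fun setT (fun x => G x `^ p0).
  exact: measurableT_comp (measurable_poweR p0) mG.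
have UP : \int[nu]_x (G x `^ p0 * (w x)%:E) <= (C2 * t)%:E.
  apply: le_trans (HC2 g t E a g0 mg t0 lev mE tE ma a0 aE).
  have mapow : measurable_fun setT (fun x => (a x `^ al)%:E).
    by apply/measurable_EFinP; exact: mpow.
  apply: ae_ge0_le_integral => //.
  - by move=> x _; rewrite mule_ge0 ?poweR_ge0// lee_fin.
  - exact: emeasurable_funM.
  - by move=> x _; rewrite mule_ge0// lee_fin powR_ge0.
  - exact: emeasurable_funM.
  apply: filterS bE => x bx _.
  have gb : g x <= (b x)%:E by rewrite -bx /menv !le_max lexx.
  rewrite /w (mulrC (a x `^ al)%R) EFinM muleA lee_wpmul2r ?lee_fin ?powR_ge0//.
  have : G x < +oo.
    rewrite ltey; apply/eqP => Gy; move: gb; rewrite /g Gy poweRyr ?gt_eqF//.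
  rewrite /g in gb *; move: (G0 x) gb; case: (G x) => [y| |]// y0 gb _.
  rewrite lee_fin in y0; rewrite poweR_EFin lee_fin in gb; rewrite !poweR_EFin.
  rewrite -EFinM lee_fin.
  have [->|yn0] := eqVneq y 0%R; first by rewrite powR0 ?gt_eqF// mul0r powR_ge0.
  have yp : (0 < y)%R by rewrite lt_neqAle eq_sym yn0.
  rewrite powRN ler_pdivrMr ?powR_gt0//.
  apply: (@le_trans _ _ (y `^ r * (y `^ r) `^ gam)%R).
    rewrite -powRrM -powRD; last by rewrite yn0 implybT.
    by rewrite /gam mulrCA divff ?gt_eqF// mulr1 addrC subrK.
  rewrite ler_wpM2l ?powR_ge0//.
  by rewrite ge0_ler_powR ?nnegrE ?powR_ge0 ?(ltW gam0) ?(ltW (b0 x)).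
pose E' := E `&` [set x | menv gt x <= kp%:E].
have mle : measurable [set x | menv gt x <= kp%:E].
  rewrite -[X in measurable X]setTI.
  exact: emeasurable_fun_infty_c (measurable_menv mgt') _.
have mE' : measurable E' by exact: measurableI.
have E't : (t / 2)%:E <= nu E'.
  have H : nu E <= nu E' + (2^-1 * t)%:E.
    apply: le_trans (leeD2l _ (Hkp g t g0 mg t0 lev)).
    apply: le_trans (measureU2 _ _ _) => //; last exact/mgt/measurable_menv.
    rewrite le_measure ?inE//.
      by apply: measurableU => //; exact/mgt/measurable_menv.
    move=> x Ex; have [H|H] := leP (menv gt x) kp%:E; first by left; split.
    by right.
  have E'f : nu E' \is a fin_num.
    by rewrite ge0_fin_numE// (le_lt_trans _ Efin)// le_measure ?inE//; exact: subIsetl.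
  move: H; rewrite tE -(fineK E'f) -EFinD !lee_fin => H; lra.
have LOW : (M * kp `^ (- gam) * (t / 2))%:E <= \int[nu]_x (F x `^ p0 * (w x)%:E).
  apply: (@le_trans _ _ (\int[nu]_(x in E') (F x `^ p0 * (w x)%:E))); last first.
    apply: ge0_subset_integral => //; first exact: emeasurable_funM.
    by move=> x _; rewrite mule_ge0 ?poweR_ge0// lee_fin.
  apply: (@le_trans _ _ (\int[nu]_(x in E') (M * kp `^ (- gam))%:E)).
    rewrite integral_cst// EFinM lee_wpmul2l// lee_fin mulr_ge0 ?powR_ge0// ltW//.
  apply: ae_ge0_le_integral => //.
  - by move=> x _; rewrite lee_fin mulr_ge0 ?powR_ge0// ltW.
  - by move=> x _; rewrite mule_ge0 ?poweR_ge0// lee_fin.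
  - by apply: measurable_funTS; exact: emeasurable_funM.
  apply: filterS2 aE bE => x ax bx [Ex bk]; have [Sx _] := Ex.
  have bk' : (b x <= kp)%R by rewrite -lee_fin -bx.
  have a1 : (1 <= a x)%R.
    rewrite -lee_fin -ax /menv le_max; apply/orP; left.
    by rewrite /one indicE mem_set.
  rewrite EFinM; apply: lee_pmul.
  - by rewrite lee_fin ltW.
  - by rewrite lee_fin powR_ge0.
  - rewrite -CcM -poweR_EFin gt0_ler_poweR ?(ltW p00)//.
    + by rewrite in_itv/= leey lee_fin ltW.
    + by rewrite in_itv/= leey F0.
    + exact: ltW.
  rewrite lee_fin /w -[leLHS]mul1r; apply: ler_pM; rewrite ?powR_ge0//.
    rewrite (_ : 1 = 1 `^ al)%R; last by rewrite powR1.
    by rewrite ge0_ler_powR ?nnegrE ?(ltW al0) ?(ltW (a0 x)).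
  rewrite !powRN lef_pV2 ?posrE ?powR_gt0//.
  by rewrite ge0_ler_powR ?nnegrE ?(ltW gam0) ?(ltW (b0 x)) ?(ltW kp0).
move=> H; have := le_trans LOW (le_trans H _).
move=> /(_ (K0%:E * (C2 * t)%:E)).
have -> : K0%:E * \int[nu]_x (G x `^ p0 * (w x)%:E) <= K0%:E * (C2 * t)%:E.
  by rewrite lee_wpmul2l// lee_fin.
move=> /(_ isT); rewrite -EFinM lee_fin powRN mulrA.
rewrite (_ : (M / kp `^ gam * t / 2 = M * t / (2 * kp `^ gam))%R); last first.
  by field; rewrite gt_eqF// powR_gt0.
rewrite ler_pdivrMr ?mulr_gt0 ?powR_gt0// leNgt => /negP; apply.
rewrite (_ : (K0 * (C2 * t) * (2 * kp `^ gam) = 2 * K0 * C2 * kp `^ gam * t)%R); last by ring.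
by rewrite ltr_pM2r// /M ltrDl.
Qed.

End level_set_estimate.

(** * Uniform bounds for the test weights *)

Section density_null.
Context d (T : measurableType d) (R : realType) (mu : {measure set T -> \bar R}).
Variables (v : T -> R) (mv : measurable_fun setT v) (v0 : forall x, (0 <= v x)%R).
Hypothesis vpos : forall x, (0 < v x)%R.
Local Notation nu := (density_measure mu mv v0).

Let mvE (A : set T) : measurable_fun A (fun x => (v x)%:E).
Proof. by apply/measurable_EFinP; exact: measurable_funTS. Qed.

Lemma density_null (N : set T) : measurable N -> nu N = 0 <-> mu N = 0.
Proof.
move=> mN; rewrite density_measureE; split => [I0|N0].
  apply/eqP; rewrite eq_le measure_ge0 andbT leNgt; apply/negP => H.
  have := integral_pos_gt0 mN (@mvE N) (fun x _ => vpos x) H.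
  by rewrite I0 ltxx.
have -> : \int[mu]_(x in N) (v x)%:E = \int[mu]_(x in N) 0.
  apply: ae_eq_integral => //; exists N; split => // x /= H.
  by apply: contrapT => Nx; apply: H => /Nx.
by rewrite integral0.
Qed.

Lemma ae_density (P : T -> Prop) : {ae nu, forall x, P x} <-> {ae mu, forall x, P x}.
Proof.
by split=> -[N [mN N0 NP]]; exists N; split => //; apply/(density_null mN).
Qed.

End density_null.

Section A1_weights.
Context d (T : measurableType d) (R : realType) (n : nat).
Variables (co : 'I_n -> T -> R) (mco : forall i, measurable_fun setT (co i)).
Variable mu : {measure set T -> \bar R}.
Hypothesis mu_cube : forall a l, (0 < l)%R -> mu (cube co a l) = (l ^+ n)%:E.
Variables (u v : T -> R).
Variables (mu_ : measurable_fun setT u) (u0 : forall x, (0 < u x)%R).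
Variables (mv : measurable_fun setT v) (v0 : forall x, (0 <= v x)%R).
Hypothesis vpos : forall x, (0 < v x)%R.
Local Notation nu := (density_measure mu mv v0).
Variable D : R.
Hypothesis nuD : doubling co nu D.

Lemma A1_real (x : R) (g : T -> \bar R) (h : T -> R) : (0 < x < 1)%R ->
  (forall t, 0 <= g t) -> measurable_fun setT g ->
  measurable_fun setT h -> (forall t, (0 < h t)%R) ->
  {ae mu, forall t, menv co nu g t = (h t)%:E} ->
  forall a l I, (0 < l)%R -> \int[mu]_(t in cube co a l) (v t)%:E = I%:E ->
  {ae mu, forall y, cube co a l y ->
    \int[mu]_(t in cube co a l) (h t `^ x * v t)%:E <= (A1_cst D x * h y `^ x * I)%:E}.
Proof.
move=> x01 g0 mg mh h0 gh a l I l0 IE.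
have mQ : measurable (cube co a l) by exact: measurable_cube.
apply: filterS (gh) => y gy Qy.
have cy : cmax co nu g y <= (h y)%:E by rewrite -gy /menv le_max lexx orbT.
have := cmax_A1 mco nuD x01 g0 mg l0 (h0 y) Qy cy.
rewrite [X in _ <= _ * X]density_measureE IE -EFinM; apply: le_trans.
have mm : measurable_fun setT (fun t => menv co nu g t `^ x).
  have mme : measurable_fun setT (menv co nu g) by exact: measurable_menv.
  exact: measurableT_comp (measurable_poweR x) mme.
rewrite density_integral//; last 2 first.
- by move=> t; exact: poweR_ge0.
- exact: measurable_funTS.
have mvE : measurable_fun (cube co a l) (fun t => (v t)%:E).
  by apply/measurable_EFinP; exact: measurable_funTS.
rewrite le_eqVlt; apply/orP; left; apply/eqP.
apply: ae_eq_integral_of => //.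
- apply/measurable_EFinP; apply: measurable_funTS; apply: measurable_funM => //.
  exact: measurableT_comp (measurable_powR x) mh.
- by apply: emeasurable_funM => //; exact: measurable_funTS.
- by apply: filterS gh => t ght; rewrite -/(menv co nu g t) ght poweR_EFin EFinM.
Qed.

Variables (eta KU kap KV : R).
Hypotheses (eta0 : (0 < eta)%R) (KU0 : (0 <= KU)%R).
Hypotheses (kap0 : (0 < kap)%R) (KV0 : (0 <= KV)%R).
Hypothesis HU : forall (a : 'I_n -> R) l, (0 < l)%R -> exists2 S : R, (0 < S)%R &
  {ae mu, forall x, cube co a l x -> (u x <= S)%R} /\
  \int[mu]_(x in cube co a l) ((S / u x) `^ eta)%:E <= (KU * l ^+ n)%:E.
Hypothesis HV : Ap_data co mu v kap KV.

(** The negative power of [b] is written as the power [- 2 gam] of b^(1/2), as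
    only powers less than 1 of envelopes are A_1 weights.  The exponent [s] is
    chosen so small that the three exponents met in [weight_pointwise] are
    admissible; it depends on [p], [gam], [eta] and [kap] only. *)
Lemma product_weight_uniform (p al gam : R) : (0 < p)%R -> (0 < al < 1)%R ->
  (0 < gam)%R -> exists s K : R, [/\ (0 < s)%R, (0 <= K)%R &
  forall (g1 g2 : T -> \bar R) (a b : T -> R),
    (forall x, 0 <= g1 x) -> measurable_fun setT g1 ->
    (forall x, 0 <= g2 x) -> measurable_fun setT g2 ->
    measurable_fun setT a -> (forall x, (0 < a x)%R) ->
    measurable_fun setT b -> (forall x, (0 < b x)%R) ->
    {ae mu, forall x, menv co nu g1 x = (a x)%:E} ->
    {ae mu, forall x, menv co nu g2 x = (b x)%:E} ->
    let w := product_weight u v (fun x => a x `^ al)%R (fun x => b x `^ 2^-1)%R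
       p (2 * gam)%R in
    forall c l, (0 < l)%R -> exists c1 c2 : R,
      [/\ (0 <= c1)%R, (0 <= c2)%R,
      \int[mu]_(x in cube co c l) (w x)%:E <= (c1 * l ^+ n)%:E,
      \int[mu]_(x in cube co c l) (w x `^ (- s))%:E <= (c2 * l ^+ n)%:E &
      (c1 * c2 `^ s^-1 <= K)%R]].
Proof.
move=> p0 al01 gam0; have /andP[al0 al1] := al01.
pose m := Num.min eta (Num.min kap 1)%R.
have m0 : (0 < m)%R by rewrite !lt_min eta0 kap0 ltr01.
have meta : (m <= eta)%R by rewrite ge_min lexx.
have mkap : (m <= kap)%R by rewrite !ge_min lexx orbT.
have m1 : (m <= 1)%R by rewrite !ge_min lexx !orbT.
pose B := (p + 1 + 2 * gam)%R; have B0 : (0 < B)%R by rewrite /B; lra.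
pose s := (m / (3 * B))%R; have s0 : (0 < s)%R by rewrite divr_gt0// mulr_gt0.
have sB : (3 * s * B = m)%R by rewrite /s; field; rewrite gt_eqF.
have s_le c : (0 <= c)%R -> (c <= B)%R -> (3 * (c * s) <= m)%R.
  by move=> c0 cB; rewrite -sB -mulrA (mulrC c) ler_pM2l// ler_pM2l.
have D1 : (1 <= D)%R by case: nuD.
have h12 : (0 < (2^-1 : R) < 1)%R by apply/andP; split; lra.
have cst0 x : (0 < x < 1 -> 0 < A1_cst D x)%R.
  move=> x01; rewrite /A1_cst ltr_wpDr ?powR_ge0// mulr_gt0 ?kolmogorov_cst_gt0//.
  by rewrite powR_gt0// mulr_gt0 ?exprn_gt0//; lra.
pose CA := A1_cst D al; pose CB := A1_cst D 2^-1.
have CA0 : (0 < CA)%R by exact: cst0.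
have CB0 : (0 < CB)%R by exact: cst0.
exists s, (CB `^ (2 * gam) * CA * (4 + KU + KV) `^ s^-1)%R; split => //.
  by rewrite !mulr_ge0 ?powR_ge0// ltW.
move=> g1 g2 a b g10 mg1 g20 mg2 ma a0 mb b0 ga gb w c l l0.
have mQ : measurable (cube co c l) by exact: measurable_cube.
have L0 : (0 < l ^+ n)%R by exact: exprn_gt0.
have [S S0 [uS IU]] := HU c l0.
have [I [I0 IE IV]] := HV c l0.
have mpow (h : T -> R) t : measurable_fun setT h -> measurable_fun setT (fun x => h x `^ t)%R.
  by move=> mh; exact: measurableT_comp (measurable_powR t) mh.
have g20' : (0 <= 2 * gam)%R by lra.
have e1 : (3 * (p * s) <= eta)%R.
  by apply: (le_trans (s_le _ _ _)) => //; rewrite /B; lra.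
have e2 : (3 * (s + 2 * gam * s) <= kap)%R.
  rewrite (_ : s + 2 * gam * s = (1 + 2 * gam) * s)%R; last by ring.
  by apply: (le_trans (s_le _ _ _)) => //; rewrite /B; lra.
have e3 : (3 * (2 * gam * s) <= 1)%R.
  by apply: (le_trans (s_le _ _ _)) => //; rewrite /B; lra.
have HA := A1_real al01 g10 mg1 ma a0 ga l0 IE.
have HB := A1_real h12 g20 mg2 mb b0 gb l0 IE.
have pa x : (0 < a x `^ al)%R by exact: powR_gt0.
have pb x : (0 < b x `^ 2^-1)%R by exact: powR_gt0.
have := product_weight_bound mQ L0 (mu_cube c l0) mu_ mv (mpow a al ma)
  (mpow b 2^-1%R mb) u0 vpos pa pb (ltW p0) g20' s0 e1 e2 e3 S0 uS I0
  IU IV KU0 KV0 CA0 CB0 HA HB.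
exact.
Qed.

End A1_weights.

Section change_of_weight.
Context d (T : measurableType d) (R : realType) (mu : {measure set T -> \bar R}).

Lemma Ap_product_le (Q : set T) (L c1 c2 s : R) (w : T -> R) : (0 < L)%R ->
  mu Q = L%:E -> (0 <= c1)%R -> (0 <= c2)%R -> (0 < s)%R ->
  (forall x, (0 < w x)%R) ->
  \int[mu]_(x in Q) (w x)%:E <= (c1 * L)%:E ->
  \int[mu]_(x in Q) (w x `^ (- s))%:E <= (c2 * L)%:E ->
  (\int[mu]_(x in Q) (w x)%:E / mu Q) *
  (\int[mu]_(x in Q) ((w x)%:E `^ (- s)) / mu Q) `^ s^-1 <= (c1 * c2 `^ s^-1)%:E.
Proof.
move=> L0 QL c10 c20 s0 w0 I1 I2.
have avg_le I c : I <= (c * L)%:E -> I / mu Q <= c%:E.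
  by move=> H; rewrite QL inver (gt_eqF L0) lee_pdivrMr// -EFinM.
have avg_ge0 I : 0 <= I -> 0 <= I / mu Q.
  by move=> H; rewrite mule_ge0// QL inver (gt_eqF L0) lee_fin invr_ge0 ltW.
have I10 : 0 <= \int[mu]_(x in Q) (w x)%:E.
  by apply: integral_ge0 => x _; rewrite lee_fin ltW.
have I20 : 0 <= \int[mu]_(x in Q) (w x `^ (- s))%:E.
  by apply: integral_ge0 => x _; rewrite lee_fin powR_ge0.
rewrite EFinM -poweR_EFin; apply: lee_pmul.
- exact: avg_ge0.
- exact: poweR_ge0.
- exact: avg_le.
apply: gt0_ler_poweR; rewrite ?in_itv/= ?leey ?andbT.
- by rewrite invr_ge0 ltW.
- exact: avg_ge0.
- by rewrite lee_fin.
- exact: avg_le.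
Qed.

Variables (u v : T -> R) (mu_ : measurable_fun setT u) (u0 : forall x, (0 < u x)%R).
Variables (mv : measurable_fun setT v) (v0 : forall x, (0 <= v x)%R).
Local Notation nu := (density_measure mu mv v0).

Lemma integral_product_weight (f : T -> \bar R) (a b : T -> R) (p al gam lam : R) :
  measurable_fun setT f -> (forall x, 0 <= f x) ->
  measurable_fun setT a -> (forall x, (0 < a x)%R) ->
  measurable_fun setT b -> (forall x, (0 < b x)%R) -> (0 < lam)%R -> (0 < p)%R ->
  \int[nu]_x ((f x * (u x / lam)%:E) `^ p * (a x `^ al * b x `^ (- gam))%:E) =
  (lam `^ (- p))%:E * \int[mu]_x (f x `^ p * (product_weight u v
     (fun x => a x `^ al)%R (fun x => b x `^ 2^-1)%R p (2 * gam)%R x)%:E).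
Proof.
move=> mf f0 ma a0 mb b0 lam0 p0.
have mpow (h : T -> R) t : measurable_fun setT h -> measurable_fun setT (fun x => h x `^ t)%R.
  by move=> mh; exact: measurableT_comp (measurable_powR t) mh.
have mE (h : T -> R) : measurable_fun setT h -> measurable_fun setT (fun x => (h x)%:E).
  by move=> mh; exact/measurable_EFinP.
have mfp : measurable_fun setT (fun x => f x `^ p).
  exact: measurableT_comp (measurable_poweR p) mf.
have mfu : measurable_fun setT (fun x => (f x * (u x / lam)%:E) `^ p).
  apply: measurableT_comp (measurable_poweR p) _.
  by apply: emeasurable_funM => //; apply: mE; exact: measurable_funM.
have mw : measurable_fun setT (product_weight u v
     (fun x => a x `^ al)%R (fun x => b x `^ 2^-1)%R p (2 * gam)%R).
  by apply: measurable_funM; [apply: measurable_funM;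
    [apply: measurable_funM => //; exact: mpow|exact: mpow]|exact/mpow/mpow].
rewrite density_integral//; last 2 first.
- by move=> x; rewrite mule_ge0 ?poweR_ge0// lee_fin mulr_ge0 ?powR_ge0.
- by apply: emeasurable_funM => //; apply: mE; apply: measurable_funM; exact: mpow.
rewrite -ge0_integralZl//; last 3 first.
- by apply: emeasurable_funM => //; exact: mE.
- move=> x _; rewrite mule_ge0 ?poweR_ge0// lee_fin /product_weight.
  by rewrite !mulr_ge0 ?powR_ge0.
- by rewrite lee_fin powR_ge0.
apply: eq_integral => x _.
have ul0 : (0 <= u x / lam)%R by rewrite divr_ge0// ltW.
rewrite poweRM ?lee_fin// poweR_EFin muleCA -!muleA; congr (_ * _).
rewrite -!EFinM; congr EFin; rewrite /product_weight.
have -> : ((b x `^ 2^-1) `^ (- (2 * gam)) = b x `^ (- gam))%R.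
  by rewrite -powRrM; congr (_ `^ _)%R; field.
rewrite powRM ?(ltW (u0 x)) ?invr_ge0 ?(ltW lam0)//.
have -> : ((lam^-1) `^ p = lam `^ (- p))%R.
  by rewrite -(powR_inv1 (ltW lam0)) -powRrM mulN1r.
by ring.
Qed.

End change_of_weight.

Section distribution_estimate.
Context (R : realType) (n : nat).
Local Notation Rn := (euclidean R n).
Local Notation mu := (leb R n).
Local Notation co := (@ecoord R n).

Lemma Ap_char_le (w : Rn -> R) (s K : R) : (0 < s)%R -> (forall x, (0 < w x)%R) ->
  (forall c l, (0 < l)%R -> exists c1 c2 : R, [/\ (0 <= c1)%R, (0 <= c2)%R,
      \int[mu]_(x in cube co c l) (w x)%:E <= (c1 * l ^+ n)%:E,
      \int[mu]_(x in cube co c l) (w x `^ (- s))%:E <= (c2 * l ^+ n)%:E &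
      (c1 * c2 `^ s^-1 <= K)%R]) ->
  Ap_char (1 + s^-1)%R (EFin \o w) <= K%:E.
Proof.
move=> s0 w0 H; have si0 : (0 < s^-1)%R by rewrite invr_gt0.
rewrite /Ap_char ifF; last by apply/negbTE; rewrite gt_eqF// ltrDl.
apply: ge_ereal_sup => _ [_ [c [l [l0 ->]]] <-].
have [c1 [c2 [c10 c20 I1 I2 cK]]] := H c l l0.
rewrite (_ : 1 + s^-1 - 1 = s^-1)%R; last by ring.
rewrite (_ : 1 - (1 + s^-1) / s^-1 = - s)%R; last by field; rewrite !gt_eqF.
apply: (@le_trans _ _ (c1 * c2 `^ s^-1)%:E); last by rewrite lee_fin.
exact: (Ap_product_le (exprn_gt0 n l0) (leb_cube_gt0 c l0) c10 c20 s0 w0 I1 I2).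
Qed.

Variables (p0 : R) (p0_gt0 : (0 < p0)%R).
Variable FF : set ((Rn -> \bar R) * (Rn -> \bar R)).
Hypothesis FF_pairs : extrapolation_pairs FF.
Hypothesis FF_Lp0 : forall q K : R, (1 <= q)%R -> (1 <= K)%R ->
    exists C : R, (0 < C)%R /\
      forall w, weight w -> Ap_char q w <= K%:E ->
      forall f g, FF (f, g) -> wLp_norm p0 w f <= C%:E * wLp_norm p0 w g.

Lemma wLp_norm_le (w : Rn -> R) (f g : Rn -> \bar R) (C : R) : (0 < C)%R ->
  (forall x, 0 <= f x) -> (forall x, 0 <= g x) -> (forall x, (0 < w x)%R) ->
  wLp_norm p0 (EFin \o w) f <= C%:E * wLp_norm p0 (EFin \o w) g ->
  \int[mu]_x (f x `^ p0 * (w x)%:E) <= (C `^ p0)%:E * \int[mu]_x (g x `^ p0 * (w x)%:E).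
Proof.
move=> C0 f0 g0 w0; rewrite /wLp_norm /=.
under eq_integral do rewrite gee0_abs//.
under [X in _ <= _ * X `^ _]eq_integral do rewrite gee0_abs//.
set I := \int[mu]_x _; set J := \int[mu]_x _ => H.
have I0 : 0 <= I by apply: integral_ge0 => x _; rewrite mule_ge0 ?poweR_ge0// lee_fin ltW.
have J0 : 0 <= J by apply: integral_ge0 => x _; rewrite mule_ge0 ?poweR_ge0// lee_fin ltW.
have root X : 0 <= X -> (X `^ p0^-1) `^ p0 = X.
  by move=> X0; rewrite -poweRrM mulVf ?gt_eqF// poweRe1.
rewrite -[I]root// -[J in leRHS]root// -poweR_EFin -poweRM ?poweR_ge0 ?lee_fin ?(ltW C0)//.
apply: gt0_ler_poweR; rewrite ?in_itv/= ?leey ?andbT ?poweR_ge0//; first exact: ltW.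
by rewrite mule_ge0 ?poweR_ge0// lee_fin ltW.
Qed.

Variables (u v : Rn -> R).
Variables (mu_ : measurable_fun setT u) (u0 : forall x, (0 < u x)%R).
Variables (mv : measurable_fun setT v) (v0 : forall x, (0 <= v x)%R).
Hypothesis vpos : forall x, (0 < v x)%R.
Local Notation nu := (density_measure mu mv v0).
Variable D : R.
Hypothesis nuD : doubling co nu D.
Variables (eta KU kap KV : R).
Hypotheses (eta0 : (0 < eta)%R) (KU0 : (0 <= KU)%R).
Hypotheses (kap0 : (0 < kap)%R) (KV0 : (0 <= KV)%R).
Hypothesis HU : forall (a : 'I_n -> R) l, (0 < l)%R -> exists2 S : R, (0 < S)%R &
  {ae mu, forall x, cube co a l x -> (u x <= S)%R} /\
  \int[mu]_(x in cube co a l) ((S / u x) `^ eta)%:E <= (KU * l ^+ n)%:E.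
Hypothesis HV : Ap_data co mu v kap KV.

(** [level_set_estimate] for F / lam and G / lam.  The inequality that it
    requires is the hypothesis for a test weight whose characteristic is
    bounded independently of the pair, of [lam] and of [tau].  The exponent
    alpha = 1 - e / 2 lies between 1 - e and 1. *)
Lemma distribution_estimate (rho e r : R) : (1 < rho)%R -> (0 < e <= 2^-1)%R ->
  (0 < r < p0)%R -> exists2 Cc : R, (0 < Cc)%R &
  forall f g, FF (f, g) -> forall lam tau : R, (0 < lam)%R -> (0 < tau)%R ->
    level_bounds nu rho e (fun x => (g x * (u x / lam)%:E) `^ r) tau ->
    nu [set x | (Cc * lam)%:E < f x * (u x)%:E] <= tau%:E.
Proof.
move=> rho1 e01 r01; have /andP[e0 eh] := e01; have /andP[r0 rp] := r01.
pose al := (1 - e / 2)%R; pose gam := ((p0 - r) / r)%R.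
have al01 : (0 < al < 1)%R by rewrite /al; apply/andP; split; lra.
have al1 : (al < 1)%R by case/andP: al01.
have ale : (1 - e < al)%R by rewrite /al; lra.
have gam0 : (0 < gam)%R by rewrite divr_gt0// subr_gt0.
have [s [K [s0 K0 HW]]] := product_weight_uniform (@measurable_ecoord R n)
  (@leb_cube_gt0 R n) mu_ u0 vpos nuD eta0 KU0 kap0 KV0 HU HV p0_gt0 al01 gam0.
have q1 : (1 <= 1 + s^-1)%R by rewrite lerDl invr_ge0 ltW.
have K11 : (1 <= Num.max 1 K)%R by rewrite le_max lexx.
have [C [C0 HC]] := FF_Lp0 q1 K11.
have CK0 : (0 <= C `^ p0)%R by exact: powR_ge0.
have [Cc Cc0 Hcore] := level_set_estimate (@measurable_ecoord R n) nuD rho1 e01 p0_gt0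
  r01 ale CK0.
exists Cc => // f g fg lam tau lam0 tau0 lev.
have [mf mg f0 g0] := FF_pairs fg.
have mul x : (0 <= u x / lam)%R by apply/ltW/divr_gt0.
have mulE : measurable_fun setT (fun x => (u x / lam)%:E).
  by apply/measurable_EFinP; apply: measurable_funM => //; exact: measurable_cst.
pose F x := f x * (u x / lam)%:E; pose G x := g x * (u x / lam)%:E.
have F0 x : 0 <= F x by rewrite mule_ge0// lee_fin.
have G0 x : 0 <= G x by rewrite mule_ge0// lee_fin.
have mF : measurable_fun setT F by exact: emeasurable_funM.
have mG : measurable_fun setT G by exact: emeasurable_funM.
have -> : [set x | (Cc * lam)%:E < f x * (u x)%:E] = [set x | Cc%:E < F x].
  apply/seteqP; split => x /=;
    by rewrite /F [(u x / lam)%:E]EFinM muleA lte_pdivlMr// -EFinM.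
apply: (Hcore F G F0 mF G0 mG _ tau tau0 lev).
move=> g1 g2 a b g10 mg1 g20 mg2 ma a0 mb b0 ga gb.
rewrite (integral_product_weight mu mu_ u0 mv v0 al gam mf f0 ma a0 mb b0 lam0 p0_gt0).
rewrite (integral_product_weight mu mu_ u0 mv v0 al gam mg g0 ma a0 mb b0 lam0 p0_gt0).
rewrite muleCA; apply: lee_wpmul2l; first by rewrite lee_fin powR_ge0.
set w := product_weight _ _ _ _ _ _.
have ga' : {ae mu, forall x, menv co nu g1 x = (a x)%:E}.
  exact: (proj1 (@ae_density _ _ _ mu v mv v0 vpos _) ga).
have gb' : {ae mu, forall x, menv co nu g2 x = (b x)%:E}.
  exact: (proj1 (@ae_density _ _ _ mu v mv v0 vpos _) gb).
have w0 x : (0 < w x)%R.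
  by rewrite /w /product_weight !mulr_gt0 ?powR_gt0.
have mpow (h : Rn -> R) t : measurable_fun setT h -> measurable_fun setT (fun x => h x `^ t)%R.
  by move=> mh; exact: measurableT_comp (measurable_powR t) mh.
have mw : measurable_fun setT w.
  apply: measurable_funM; last exact/mpow/mpow.
  apply: measurable_funM; last exact: mpow.
  by apply: measurable_funM; [exact: mpow|exact: mv].
have Ww : weight (EFin \o w).
  split; first by apply/measurable_EFinP; exact: mw.
  by apply: aeW => x; rewrite /= lte_fin w0 ltry.
have Aw : Ap_char (1 + s^-1)%R (EFin \o w) <= (Num.max 1%R K)%:E.
  apply: (@le_trans _ _ K%:E); last by rewrite lee_fin le_max lexx orbT.
  apply: (Ap_char_le s0 w0).
  exact: (HW g1 g2 a b g10 mg1 g20 mg2 ma a0 mb b0 ga' gb').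
exact: (wLp_norm_le C0 f0 g0 w0 (HC _ Ww Aw f g fg)).
Qed.

End distribution_estimate.

(** * Dilations of the half-line *)

Section halfline.
Context (R : realType).
Local Notation RL := (real_line R).
Local Notation mx := (mu_ext (wlength (@idfun R))).
Implicit Types (A : set R) (t : R).

Lemma wlength_scale t (I : set R) : (0 < t)%R -> ocitv I ->
  ocitv [set s : R | I (s / t)%R] /\
  wlength (@idfun R) [set s | I (s / t)%R] = t%:E * wlength (@idfun R) I.
Proof.
move=> t0 /ocitvP[->|[[a b]/= ab ->]].
  by rewrite (_ : [set s | _] = set0)// wlength0 mule0; split => //; exact: ocitv0.
have -> : [set s : R | `]a, b]%classic (s / t)%R] = `](a * t)%R, (b * t)%R]%classic.
  by apply/seteqP; split => s /=; rewrite !in_itv/= ltr_pdivlMr// ler_pdivrMr.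
split; first exact: is_ocitv.
rewrite !wlength_itv_bnd ?(ltW ab)//=; last by rewrite ler_pM2r// ltW.
by rewrite -EFinM; congr (_%:E); ring.
Qed.

(** Dilating a cover by half-open intervals multiplies its total length. *)
Lemma outer_scale_le t A : (0 < t)%R -> mx [set s | A (s / t)%R] <= t%:E * mx A.
Proof.
move=> t0; rewrite -lee_pdivrMl//.
apply: le_ereal_inf_tmp => _ [F [mF AF] <-]; rewrite lee_pdivrMl//.
apply: ereal_inf_lbound; exists (fun k => [set s | F k (s / t)%R]).
  split=> [i|s /= /AF[k _ Fk]]; first exact: (wlength_scale t0 (mF i)).1.
  by exists k.
rewrite -nneseriesZl; last by move=> i _; exact: (@wlength_ge0 R [the cumulative R R of @idfun R]).
by apply: eq_eseriesr => i _; rewrite (wlength_scale t0 (mF i)).2.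
Qed.

Lemma outer_scale t A : (0 < t)%R -> mx [set s | A (s / t)%R] = t%:E * mx A.
Proof.
move=> t0; apply/eqP; rewrite eq_le outer_scale_le//=.
have ti0 : (0 < t^-1)%R by rewrite invr_gt0.
rewrite -lee_pdivlMl//; apply: le_trans (outer_scale_le _ ti0).
apply: le_mu_ext => s As /=.
by rewrite invrK mulfK// gt_eqF.
Qed.

Lemma measurable_scale t (A : set RL) : (0 < t)%R -> measurable A ->
  measurable ([set s : R | A (s / t)%R] : set RL).
Proof.
move=> t0 mA.
suff H : caratheodory_measurable mx [set s : R | A (s / t)%R] by exact: H.
move=> X.
have t1 : t != 0%R by rewrite gt_eqF.
pose Y : set R := [set s | X (s * t)%R].
have XE : X = [set s | Y (s / t)%R].
  by apply/funext => s; rewrite /Y/= divfK.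
have YE : mx Y = mx (Y `&` A) + mx (Y `&` ~` A) by exact: (mA Y).
have E1 : X `&` [set s : R | A (s / t)%R] = [set s | (Y `&` A) (s / t)%R].
  by rewrite [in LHS]XE.
have E2 : X `&` ~` [set s : R | A (s / t)%R] = [set s | (Y `&` ~` A) (s / t)%R].
  by rewrite [in LHS]XE.
change (mx X = mx (X `&` [set s : R | A (s / t)%R]) +
  mx (X `&` ~` [set s : R | A (s / t)%R])).
rewrite E1 E2 !outer_scale// [in LHS]XE outer_scale// YE.
by rewrite ge0_muleDr//; exact: mu_ext_ge0.
Qed.

Lemma halfline_scale t (A : set RL) : (0 < t)%R ->
  leb_halfline R [set s : R | A (s / t)%R] = t%:E * leb_halfline R A.
Proof.
move=> t0; rewrite -[RHS]outer_scale//; congr mx.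
apply/seteqP; split => s /= [As s0]; split=> //.
  by rewrite divr_ge0// ltW.
by have := mulr_ge0 s0 (ltW t0); rewrite divfK// gt_eqF.
Qed.

Lemma halfline_itv (i : interval R) : measurable ([set` i] : set RL).
Proof.
have : (measurable : set (set (measurableTypeR R))) [set` i].
  exact: measurable_itv.
exact: sub_caratheodory.
Qed.

Lemma halfline_itvE (i : interval R) :
  leb_halfline R [set` i] = lebesgue_measure ([set` i] `&` `[0%R, +oo[).
Proof. by rewrite set_itvcy. Qed.

Lemma halfline_bnd (x y : bool) (a b : R) : (0 <= a)%R -> (a <= b)%R ->
  leb_halfline R [set` Interval (BSide x a) (BSide y b)] = (b - a)%:E.
Proof.
move=> a0 ab; rewrite halfline_itvE setIidl; last first.
  move=> s /=; rewrite !in_itv/= andbT => /andP[].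
  by case: x => /= as_ _; apply: (le_trans a0); rewrite // ltW.
rewrite lebesgue_measure_itv/= lte_fin lt_neqAle ab andbT -EFinD.
by case: (eqVneq a b) => //= ->; rewrite subrr.
Qed.

Lemma halfline_setT : leb_halfline R setT = +oo.
Proof.
have := halfline_itvE `]-oo, +oo[; rewrite set_itvNyy setTI => ->.
by rewrite lebesgue_measure_itv/= ltry.
Qed.

Lemma measurable_dilation t (f : RL -> \bar R) : (0 < t)%R ->
  measurable_fun setT f -> measurable_fun setT (dilation t f).
Proof.
move=> t0 mf _ Y mY; rewrite setTI.
have mA : measurable (f @^-1` Y) by rewrite -[X in measurable X]setTI; exact: mf.
exact: (measurable_scale t0 mA).
Qed.

Lemma dist_fun_dilation t (f : RL -> \bar R) l : (0 < t)%R ->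
  dist_fun (leb_halfline R) (dilation t f) l =
  t%:E * dist_fun (leb_halfline R) f l.
Proof. by move=> t0; rewrite /dist_fun -halfline_scale. Qed.
End halfline.

(** * Decreasing rearrangements *)

Section rearrangement.
Context (R : realType).
Local Notation RL := (real_line R).
Implicit Types (D : R -> \bar R) (l : R).

(** What makes [rearr] a generalized inverse: the last clause is
    right-continuity, and yields [rearr_gt]. *)
Definition distribution_like D : Prop :=
  [/\ forall l, 0 <= D l,
      forall l l', (0 <= l)%R -> (l <= l')%R -> D l' <= D l &
      forall l s, (0 <= l)%R -> s%:E < D l ->
        exists2 l', (l < l')%R & s%:E < D l'].

Lemma dist_fun_like d (T : measurableType d) (mu : {measure set T -> \bar R})
  (f : T -> \bar R) : measurable_fun setT f -> distribution_like (dist_fun mu f).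
Proof.
move=> mf.
have mF l : measurable [set x | l%:E < `|f x|].
  exact: abse_superlevel_measurable.
split=> [l|l l' _ ll'|l s l0 sD]; first exact: measure_ge0.
  apply: le_measure; rewrite ?inE//; apply: subset_trans (@subset_refl _ _) => x /=.
  by apply: le_lt_trans; rewrite lee_fin.
have near_l y : l%:E < y -> exists k : nat, (l + k.+1%:R^-1)%:E < y.
  case: y => [r| |]//; last by exists 0%N; rewrite ltry.
  rewrite lte_fin => lr; have r0 : (0 < r - l)%R by rewrite subr_gt0.
  have [k _ /(_ k (leqnn k))/= kr] := near_infty_natSinv_lt (PosNum r0).
  by exists k; rewrite lte_fin -ltrBrDl.
pose A (k : nat) := [set x | (l + k.+1%:R^-1)%:E < `|f x|].
have AE : \bigcup_k A k = [set x | l%:E < `|f x|].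
  apply/seteqP; split => x /=.
    by case=> k _; apply: le_lt_trans; rewrite lee_fin lerDl.
  by move=> /near_l[k kl]; exists k.
have cvgA : (mu \o A) k @[k --> \oo] --> mu (\bigcup_k A k).
  apply: nondecreasing_cvg_mu .
  - by move=> k; exact: mF.
  - by have := mF l; rewrite -AE.
  - move=> k m km; apply/subsetPset => x; apply: le_lt_trans.
    by rewrite lee_fin lerD2l lef_pV2 ?posrE// ler_nat.
rewrite AE in cvgA.
have : \forall k \near \oo, s%:E < (mu \o A) k.
  apply: (cvgA [set x | s%:E < x]); apply: open_nbhs_nbhs; split;
    [exact: open_ereal_gt_ereal|exact: sD].
move=> [k _ Hk]; exists (l + k.+1%:R^-1)%R; first by rewrite ltrDl.
exact: (Hk k (leqnn k)).
Qed.

Section rearr_like.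
Variables (D : R -> \bar R).
Hypothesis hD : distribution_like D.

Lemma rearr_gt l (s : R) : (0 <= l)%R -> (l%:E < rearr D s) = (s%:E < D l).
Proof.
have [D0 Dd Dr] := hD => l0; apply/idP/idP.
  apply: contraTT; rewrite -!leNgt => sD.
  by apply: ereal_inf_lbound; exists l.
move=> /Dr[]// l' ll' sD; apply: (@lt_le_trans _ _ l'%:E); first by rewrite lte_fin.
apply: le_ereal_inf_tmp => _ [m [m0 Dm] <-]; rewrite lee_fin leNgt.
apply/negP => ml'.
have := lt_le_trans sD (le_trans (Dd _ _ m0 (ltW ml')) Dm).
by rewrite ltxx.
Qed.

Lemma rearr_ge0 (s : RL) : 0 <= rearr D s.
Proof. by apply: le_ereal_inf_tmp => _ [m [m0 Dm] <-]; rewrite lee_fin. Qed.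

Lemma rearr_nonincreasing (s s' : R) : (s <= s')%R -> rearr D s' <= rearr D s.
Proof.
move=> ss'; apply: ereal_inf_le_tmp => _ [m [m0 Dm] <-]; exists m => //; split=> //.
by rewrite (le_trans Dm)// lee_fin.
Qed.

Lemma measurable_below (y : \bar R) : measurable ([set s : R | s%:E < y] : set RL).
Proof.
case: y => [r| |].
- rewrite (_ : [set _ | _] = `]-oo, r[%classic); first exact: halfline_itv.
  by apply/seteqP; split => s /=; rewrite in_itv/= lte_fin.
- rewrite (_ : [set _ | _] = `]-oo, +oo[%classic); first exact: halfline_itv.
  by apply/seteqP; split => s /=; rewrite in_itv/= ltry.
- rewrite (_ : [set _ | _] = `]0%R, 0%R[%classic); first exact: halfline_itv.
  by rewrite set_itvoo0; apply/seteqP; split => s /=; rewrite ltNge leNye.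
Qed.

Lemma halfline_below (y : \bar R) : 0 <= y ->
  leb_halfline R [set s : R | s%:E < y] = y.
Proof.
case: y => [r| |]//.
- rewrite lee_fin => r0; rewrite (_ : [set _ | _] = `]-oo, r[%classic); last first.
    by apply/seteqP; split => s /=; rewrite in_itv/= lte_fin.
  rewrite -[RHS](_ : leb_halfline R `[0%R, r[%classic = _).
    rewrite !halfline_itvE; congr lebesgue_measure.
    apply/seteqP; split => s /=; rewrite !in_itv/= !andbT; first by move=> [-> ->].
    by move=> [/andP[-> ->]].
  by rewrite halfline_bnd// subr0.
- move=> _; rewrite (_ : [set _ | _] = setT) ?halfline_setT//.
  by apply/seteqP; split => s //=; rewrite ltry.
Qed.

Lemma measurable_rearr : measurable_fun setT (rearr D).
Proof.
have H l : measurable ([set s : RL | l%:E < rearr D s] : set RL).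
  have [l0|l0] := leP 0%R l.
    rewrite (_ : [set _ | _] = [set s : R | s%:E < D l]); first exact: measurable_below.
    by apply/funext => s /=; rewrite rearr_gt.
  rewrite (_ : [set _ | _] = `]-oo, +oo[%classic); first exact: halfline_itv.
  apply/seteqP; split => s //= _; rewrite ?in_itv//=.
  by rewrite (lt_le_trans _ (rearr_ge0 _))// lte_fin.
exact: (measurable_superlevel H).
Qed.

Lemma dist_fun_rearr l : (0 <= l)%R ->
  dist_fun (leb_halfline R) (rearr D) l = D l.
Proof.
have [D0 _ _] := hD => l0; rewrite -[RHS]halfline_below//; congr (leb_halfline R _).
by apply/funext => s /=; rewrite gee0_abs ?rearr_ge0// rearr_gt.
Qed.
End rearr_like.
End rearrangement.

(** * Rearrangement invariant norms and dilations *)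

Section ri_norm.
Context (R : realType).
Local Notation RL := (real_line R).
Local Notation L := (leb_halfline R).
Local Notation mfun f := (measurable_fun [set: RL] f).
Variable Y : (RL -> \bar R) -> \bar R.
Hypothesis Yn : function_norm L Y.
Hypothesis Yri : rearrangement_invariant L Y.
Implicit Types (f g : RL -> \bar R).

Lemma fnorm_rearr f : mfun f -> Y f = Y (rearr (dist_fun L f)).
Proof.
move=> mf; have Df := dist_fun_like L mf.
apply: (Yri mf); first exact: (measurable_rearr Df).
by move=> l l0; rewrite (dist_fun_rearr Df).
Qed.

(** Both norms are those of the decreasing rearrangements, which are ordered
    pointwise. *)
Lemma ri_le f g : mfun f -> mfun g ->
  (forall l, (0 <= l)%R -> dist_fun L f l <= dist_fun L g l) -> Y f <= Y g.
Proof.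
move=> mf mg fg; rewrite (fnorm_rearr mf) (fnorm_rearr mg).
have Df := dist_fun_like L mf; have Dg := dist_fun_like L mg.
apply: (fnorm_le Yn); [exact: (measurable_rearr Df)|exact: (measurable_rearr Dg)|].
apply: aeW => s; rewrite !gee0_abs ?rearr_ge0//.
apply: ereal_inf_le_tmp => _ [m [m0 Dm] <-]; exists m => //; split=> //.
exact: le_trans (fg _ m0) Dm.
Qed.

Lemma dilation_le t f : (0 < t <= 1)%R -> mfun f -> Y (dilation t f) <= Y f.
Proof.
move=> /andP[t0 t1] mf; apply: (ri_le (measurable_dilation t0 mf) mf).
move=> l l0; rewrite dist_fun_dilation// -[leRHS]mul1e.
by apply: lee_wpmul2r; rewrite ?lee_fin//; exact: measure_ge0.
Qed.

Lemma dilationM a b f : dilation a (dilation b f) = dilation (a * b) f.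
Proof.
by apply/funext => s; rewrite /dilation; congr f; rewrite invfM mulrA.
Qed.

Lemma dilation1 f : dilation 1 f = f.
Proof. by apply/funext => s; rewrite /dilation divr1. Qed.

Lemma dilationX_le (t c : R) f : (0 < t)%R -> (0 <= c)%R ->
  (forall g, mfun g -> (forall s, 0 <= g s) ->
     (forall s s' : R, (s <= s')%R -> g s' <= g s) ->
     Y (dilation t g) <= c%:E * Y g) ->
  mfun f -> (forall s, 0 <= f s) ->
  (forall s s' : R, (s <= s')%R -> f s' <= f s) ->
  forall k, Y (dilation (t ^+ k) f) <= (c ^+ k)%:E * Y f.
Proof.
move=> t0 c0 H mf f0 fd; elim=> [|k IH].
  by rewrite !expr0 dilation1 mul1e.
have tk0 : (0 < t ^+ k)%R by rewrite exprn_gt0.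
rewrite !exprS -dilationM; apply: (@le_trans _ _ (c%:E * Y (dilation (t ^+ k) f))).
  apply: H; first exact: measurable_dilation.
    by move=> s; exact: f0.
  by move=> s s' ss'; apply: fd; rewrite ler_pM2r// invr_gt0.
by rewrite EFinM -muleA; apply: lee_wpmul2l; rewrite ?lee_fin.
Qed.

(** A quotient less than +oo at [t] means that the dilation norm differs from
    1, and it is at most 1 by [dilation_le].  The midpoint between the norm
    and 1 is taken for [h], to have [h] positive. *)
Lemma boyd_contraction : upper_boyd_index Y < +oo ->
  exists t h, [/\ (0 < t < 1)%R, (0 < h < 1)%R &
    forall f, mfun f -> Y (dilation t f) <= h%:E * Y f].
Proof.
move=> /ereal_inf_lt[_ [t /andP[t0 t1] <-]] qt.
have m0 : mfun (cst 0 : RL -> \bar R) by exact: measurable_cst.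
have Y0 : Y (cst 0) = 0 by apply/(fnorm_eq0 Yn m0); exact: aeW.
have d0 : 0 <= dilation_norm Y t.
  apply: ereal_sup_ubound; exists (cst 0); last by rewrite -[RHS]Y0.
  by split=> //; rewrite Y0.
have d1 : dilation_norm Y t < 1.
  rewrite lt_neqAle; apply/andP; split.
    by apply/negP => d1; move: qt; rewrite /boyd_quotient d1.
  apply: ge_ereal_sup => _ [f [mf f1] <-]; apply: le_trans f1.
  by apply: dilation_le; rewrite // t0 ltW.
case dE : (dilation_norm Y t) d0 d1 => [e| |]//.
rewrite lee_fin lte_fin => e0 e1.
exists t, ((e + 1) / 2)%R; split; [by rewrite t0|by lra|] => f mf.
have h0 : (0 < (e + 1) / 2)%R by lra.
have mdf := measurable_dilation t0 mf.
have Yf0 := fnorm_ge0 Yn mf.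
have [Yf1|Yf1] := eqVneq (Y f) 0.
  by rewrite Yf1 mule0 -Yf1; apply: dilation_le; rewrite // t0 ltW.
have [Yf2|Yf2] := eqVneq (Y f) +oo.
  by rewrite Yf2 gt0_muley ?lte_fin// leey.
have YfE : (fine (Y f))%:E = Y f by rewrite fineK// ge0_fin_numE// ltey.
have c0 : (0 < fine (Y f))%R by rewrite -lte_fin YfE lt_neqAle eq_sym Yf1.
rewrite -YfE; move: (fine (Y f)) c0 YfE => c c0 cE.
have cV : (c^-1 * c = 1)%R by rewrite mulVf// gt_eqF.
have mg : mfun (fun s => c^-1%:E * f s).
  by apply: measurable_funeM.
have H : Y (dilation t (fun s => c^-1%:E * f s)) <= e%:E.
  rewrite -dE; apply: ereal_sup_ubound; exists (fun s => c^-1%:E * f s) => //.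
  split=> //; rewrite (fnormZ Yn)// ger0_norm ?invr_ge0 ?(ltW c0)//.
  by rewrite -cE -EFinM cV.
move: (fnormZ Yn c^-1 mdf); rewrite ger0_norm ?invr_ge0 ?(ltW c0)// => E.
have : c^-1%:E * Y (dilation t f) <= e%:E by rewrite -E; exact: H.
rewrite lee_pdivrMl// => /le_trans; apply; rewrite -EFinM lee_fin mulrC.
by rewrite ler_pM2r//; lra.
Qed.
End ri_norm.

Section shells.
Context (R : realType).
Local Notation RL := (real_line R).
Local Notation L := (leb_halfline R).

Definition shell (k : int) : set RL := `[4 `^ k%:~R, 2 * 4 `^ k%:~R[%classic%R.

(** Both this set and its complement leave out a fixed fraction of every
    interval [0, y). *)
Definition shells : set RL := \bigcup_k shell k.

Lemma measurable_shells : measurable shells.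
Proof.
apply: countable_bigcupT_measurable; first exact: (@cardinality.countableP int).
by move=> k; exact: halfline_itv.
Qed.

Lemma powR4S (k : int) : (4 `^ (k + 1)%:~R = 4 * 4 `^ k%:~R :> R)%R.
Proof. by rewrite intrD powRD ?powRr1 1?mulrC ?(@pnatr_eq0 R 4)//= implybT. Qed.

Lemma shellsC (k : int) :
  `[(2 * 4 `^ k%:~R)%R, (4 `^ (k + 1)%:~R)%R[%classic `<=` ~` shells.
Proof.
move=> s /=; rewrite in_itv/= => /andP[ks sk] [j _]; rewrite /shell/= in_itv/= => /andP[js sj].
have [jk|kj] := leP j k.
  have : (4 `^ j%:~R <= 4 `^ k%:~R :> R)%R by rewrite ler_powR ?ler_int//; lra.
  lra.
have : (4 `^ (k + 1)%:~R <= 4 `^ j%:~R :> R)%R.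
  by rewrite ler_powR ?ler_int ?lezD1//; lra.
lra.
Qed.

Lemma shell_index (y : R) : (0 < y)%R ->
  exists k : int, (4 * 4 `^ k%:~R <= y < 16 * 4 `^ k%:~R)%R.
Proof.
move=> y0; have l4 : (0 < ln (4 : R))%R by apply: ln_gt0; lra.
pose k := Num.floor (ln y / ln 4).
have yE : (y = 4 `^ (ln y / ln 4))%R.
  by rewrite /powR ifF ?divfK ?lnK ?gt_eqF//.
exists (k - 1)%R.
have -> : (16 * 4 `^ (k - 1)%:~R = 4 * (4 * 4 `^ (k - 1)%:~R) :> R)%R by ring.
rewrite -powR4S subrK -powR4S yE ler_powR ?gt1_ltr_powR ?ge_floor ?floorD1_gt//=; lra.
Qed.

Lemma disjoint_part d (T : measurableType d) (mu : {measure set T -> \bar R})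
  (I A C : set T) : measurable I -> measurable A -> measurable C ->
  C `<=` I -> C `<=` ~` A -> mu (I `&` A) + mu C <= mu I.
Proof.
move=> mI mA mC CI CA; have mIA : measurable (I `&` A) by exact: measurableI.
rewrite -measureU//; last by apply/seteqP; split => // x [[_ Ax] /CA].
apply: le_measure; rewrite ?inE//; first exact: measurableU.
by move=> x [[]//|/CI].
Qed.

Lemma down_set_ge (I : set RL) (y : R) : measurable I ->
  (forall s s' : R, (s <= s')%R -> I s' -> I s) -> y%:E <= L I ->
  forall s : R, (0 <= s < y)%R -> I s.
Proof.
move=> mI dI yI s /andP[s0 sy]; apply: contrapT => nIs.
have : L I <= L `[0%R, s[%classic.
  apply: (@le_trans _ _ (L `]-oo, s[%classic)).
    apply: le_measure; rewrite ?inE//; first exact: halfline_itv.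
    move=> s' Is' /=; rewrite in_itv/= ltNge; apply/negP => ss'; apply: nIs.
    exact: dI ss' Is'.
  rewrite !halfline_itvE; apply: le_measure; rewrite ?inE; try exact: measurableI.
  by move=> s'/=; rewrite !in_itv/= andbT => -[-> ->].
rewrite halfline_bnd// subr0 => /(le_trans yI); rewrite lee_fin.
by rewrite leNgt sy.
Qed.

(** With y the measure of [I], the interval [0, y) is contained in [I].  If
    4 4^k <= y < 16 4^k, it contains the interval [a, b), which misses [A] and
    has length at least 4^k > y / 16. *)
Lemma shells_fraction (I A : set RL) : measurable I -> measurable A ->
  (forall s s' : R, (s <= s')%R -> I s' -> I s) ->
  (forall k : int, exists a b : R, [/\ (4 `^ k%:~R <= a)%R,
    (b <= 4 * 4 `^ k%:~R)%R, (4 `^ k%:~R <= b - a)%R &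
    `[a, b[%classic `<=` ~` A]) ->
  L (I `&` A) <= (15 / 16)%:E * L I.
Proof.
move=> mI mA dI hA.
have LI0 : 0 <= L I by exact: measure_ge0.
case yE : (L I) => [y| |]; last 2 first.
- by rewrite gt0_muley ?lte_fin ?divr_gt0// leey.
- by move: LI0; rewrite yE.
have y0 : (0 <= y)%R by rewrite -lee_fin -yE.
move: y0; rewrite le_eqVlt => /orP[/eqP y0|y0].
  have mIA : measurable (I `&` A) by exact: measurableI.
  apply: (@le_trans _ _ (L I)); last by rewrite yE -y0 mule0.
  by apply: le_measure; rewrite ?inE// => s [].
have [k /andP[ky yk]] := shell_index y0.
have [a [b [ka bk kab CA]]] := hA k.
have k0 : (0 <= 4 `^ k%:~R :> R)%R by exact: powR_ge0.
have CI : `[a, b[%classic `<=` I.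
  move=> s /=; rewrite in_itv/= => /andP[as_ sb].
  by apply: (@down_set_ge _ y mI dI); [rewrite yE|lra].
have H : L (I `&` A) + L `[a, b[%classic <= L I.
  exact: (disjoint_part L mI mA (halfline_itv _) CI CA).
rewrite yE halfline_bnd in H; [|lra|lra].
move: H; rewrite -leeBrDr// => /le_trans; apply.
rewrite -EFinM -EFinD lee_fin; lra.
Qed.

End shells.

Section up_dilation.
Context (R : realType).
Local Notation RL := (real_line R).
Local Notation L := (leb_halfline R).
Local Notation mfun f := (measurable_fun [set: RL] f).
Variable Y : (RL -> \bar R) -> \bar R.
Hypothesis Yn : function_norm L Y.
Hypothesis Yri : rearrangement_invariant L Y.
Implicit Types (f g : RL -> \bar R).

Lemma shell_restrict_le f (A : set RL) : mfun f -> measurable A ->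
  (forall s, 0 <= f s) -> (forall s s' : R, (s <= s')%R -> f s' <= f s) ->
  (forall k : int, exists a b : R, [/\ (4 `^ k%:~R <= a)%R,
    (b <= 4 * 4 `^ k%:~R)%R, (4 `^ k%:~R <= b - a)%R &
    `[a, b[%classic `<=` ~` A]) ->
  mfun (f \_ A) /\ Y (f \_ A) <= Y (dilation (15 / 16) f).
Proof.
move=> mf mA f0 fd hA.
have mfA : mfun (f \_ A).
  by apply/(measurable_restrictT _ mA); exact: measurable_funS mf.
have c0 : (0 < 15 / 16 :> R)%R by rewrite divr_gt0.
split; first exact: mfA.
apply: (ri_le Yn Yri mfA (measurable_dilation c0 mf)).
move=> l l0; rewrite dist_fun_dilation ?divr_gt0//.
rewrite {1}/dist_fun.
have -> : [set s | l%:E < `|(f \_ A) s|] = [set s | l%:E < `|f s|] `&` A.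
  apply/seteqP; split => s /=; rewrite patchE.
    case: ifPn => [/set_mem//|_]; rewrite abse0 lte_fin => /(le_lt_trans l0).
    by rewrite ltxx.
  by move=> [fl As]; rewrite mem_set.
apply: (shells_fraction (abse_superlevel_measurable _ mf) mA _ hA).
move=> s s' ss' /=; rewrite !gee0_abs// => /lt_le_trans; apply; exact: fd.
Qed.

(** Split [f] according to [shells]: each part has a distribution function of
    at most 15 / 16 times that of [f]. *)
Lemma up_dilation_step f : mfun f ->
  (forall s, 0 <= f s) -> (forall s s' : R, (s <= s')%R -> f s' <= f s) ->
  Y f <= 2%:E * Y (dilation (15 / 16) f).
Proof.
move=> mf f0 fd.
have mS := @measurable_shells R.
have [m1 le1] : mfun (f \_ (@shells R)) /\ Y (f \_ (@shells R)) <= Y (dilation (15 / 16) f).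
  apply: shell_restrict_le => // k; exists (2 * 4 `^ k%:~R)%R, (4 * 4 `^ k%:~R)%R.
  have k0 : (0 <= 4 `^ k%:~R :> R)%R by exact: powR_ge0.
  split; [lra|lra|lra|].
  by rewrite -powR4S; exact: shellsC.
have [m2 le2] : mfun (f \_ (~` @shells R)) /\ Y (f \_ (~` @shells R)) <= Y (dilation (15 / 16) f).
  apply: shell_restrict_le => //; first exact: measurableC.
  move=> k; exists (4 `^ k%:~R)%R, (2 * 4 `^ k%:~R)%R.
  have k0 : (0 <= 4 `^ k%:~R :> R)%R by exact: powR_ge0.
  split; [lra|lra|lra|].
  by rewrite setCK => s sk; exists k.
have -> : 2%:E * Y (dilation (15 / 16) f) = Y (dilation (15 / 16) f) + Y (dilation (15 / 16) f).
  by rewrite -[in RHS](mul1e (Y _)) -ge0_muleDl// -EFinD.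
apply: le_trans (leeD le1 le2); apply: le_trans (fnormD Yn m1 m2).
apply: (fnorm_le Yn mf (emeasurable_funD m1 m2)).
apply: aeW => s; rewrite !patchE in_setC.
by case: (s \in _); rewrite /= ?adde0 ?add0e.
Qed.

(** [up_dilation_step] is applied until the dilation factor
    (15 / 16)^N rho is at most 1. *)
Lemma up_dilation rho : (0 < rho)%R -> exists2 B : R, (0 < B)%R &
  forall f, mfun f ->
  (forall s, 0 <= f s) -> (forall s s' : R, (s <= s')%R -> f s' <= f s) ->
  Y (dilation rho f) <= B%:E * Y f.
Proof.
move=> rho0.
have [N HN] := @exprn_unbounded R (16 / 15) ltac:(lra) rho.
exists (2 ^+ N)%R => [|f mf f0 fd]; first by rewrite exprn_gt0.
pose c : R := (15 / 16)%R.
have c0 : (0 < c)%R by rewrite divr_gt0.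
have step j : Y (dilation rho f) <= (2 ^+ j)%:E * Y (dilation (c ^+ j * rho) f).
  elim: j => [|j IH]; first by rewrite !expr0 mul1e mul1r.
  have x0 : (0 < c ^+ j * rho)%R by rewrite mulr_gt0// exprn_gt0.
  apply: (le_trans IH); rewrite exprSr EFinM -muleA exprS -mulrA -(dilationM c).
  apply: lee_wpmul2l; first by rewrite lee_fin exprn_ge0.
  apply: up_dilation_step; first exact: measurable_dilation.
    by move=> s; exact: f0.
  by move=> s s' ss'; apply: fd; rewrite ler_pM2r// invr_gt0.
apply: (le_trans (step N)); apply: lee_wpmul2l; first by rewrite lee_fin exprn_ge0.
apply: (dilation_le Yn Yri) => //; apply/andP; split.
  by rewrite mulr_gt0// exprn_gt0.
have cE : (c = (16 / 15)^-1)%R by rewrite /c invf_div.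
by rewrite cE exprVn mulrC ler_pdivrMr ?mul1r// exprn_gt0//; lra.
Qed.

Lemma fnorm_nneseries (F : nat -> RL -> \bar R) (c : \bar R) :
  (forall k, mfun (F k)) -> (forall k s, 0 <= F k s) ->
  (forall N, \sum_(k < N) Y (F k) <= c) ->
  Y (fun s => \sum_(k <oo) F k s) <= c.
Proof.
move=> mF F0 Fc.
pose S (N : nat) (s : RL) := \sum_(0 <= k < N) F k s.
have mS N : mfun (S N) by exact: emeasurable_sum.
have S0 N s : 0 <= S N s by exact: sume_ge0.
have YS N : Y (S N) <= \sum_(k < N) Y (F k).
  elim: N => [|N IH].
    rewrite big_ord0 le_eqVlt; apply/orP; left; apply/eqP/(fnorm_eq0 Yn (mS 0%N)).
    by apply: aeW => s; rewrite /S big_nil.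
  rewrite big_ord_recr/=; apply: le_trans (leeD2r _ IH).
  apply: le_trans (fnormD Yn (mS N) (mF N)).
  apply: (fnorm_le Yn (mS N.+1) (emeasurable_funD (mS N) (mF N))).
  by apply: aeW => s; rewrite /S/= big_nat_recr.
have mT : mfun (fun s => \sum_(k <oo) F k s) by apply: ge0_emeasurable_sum.
have [_ cvgY] : nondecreasing_seq (fun j => Y (S j)) /\
    Y (S j) @[j --> \oo] --> Y (fun s => \sum_(k <oo) F k s).
  apply: (fnorm_fatou Yn mS mT); apply: aeW => s; split.
    move=> i j ij; rewrite !gee0_abs//; exact: lee_sum_nneg_natr.
  rewrite gee0_abs; last exact: nneseries_ge0.
  under eq_fun do rewrite gee0_abs//.
  exact: is_cvg_nneseries.
rewrite -(cvg_lim _ cvgY)//; apply: lime_le; first by apply/cvg_ex; eexists; exact: cvgY.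
by apply: nearW => N; apply: le_trans (YS N) (Fc N).
Qed.
End up_dilation.

(** * Comparison of rearrangements *)

Lemma nneseries_ge_term (R : realType) (f : nat -> \bar R) (k : nat) :
  (forall j, 0 <= f j) -> f k <= \sum_(j <oo) f j.
Proof.
move=> f0; rewrite (nneseriesD1 (n := k))//.
by rewrite leeDl//; apply: nneseries_ge0 => j _ _; exact: f0.
Qed.

Section rearr_comparison.
Context (R : realType).
Local Notation RL := (real_line R).
Local Notation L := (leb_halfline R).
Local Notation mfun f := (measurable_fun [set: RL] f).
Variable Y : (RL -> \bar R) -> \bar R.
Hypothesis Yn : function_norm L Y.
Implicit Types (f g phi : RL -> \bar R).

Lemma sum_geometric_le (q : R) (y : \bar R) N : (0 <= q < 1)%R -> 0 <= y ->
  \sum_(k < N) ((q ^+ k)%:E * y) <= ((1 - q)^-1)%:E * y.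
Proof.
move=> /andP[q0 q1] y0; rewrite -ge0_sume_distrl//; last first.
  by move=> k _; rewrite lee_fin exprn_ge0.
apply: lee_wpmul2r => //; rewrite sumEFin lee_fin.
have p0 : (0 < 1 - q)%R by rewrite subr_gt0.
rewrite -[leRHS]mul1r ler_pdivlMr//.
suff -> : ((\sum_(k < N) q ^+ k) * (1 - q) = 1 - q ^+ N)%R by rewrite gerBl exprn_ge0.
elim: N => [|N IH]; first by rewrite big_ord0 mul0r expr0 subrr.
by rewrite big_ord_recr/= mulrDl IH exprS; ring.
Qed.

Lemma dilation_series_le (t a h : R) phi : (0 < t)%R -> (0 < a)%R ->
  (0 <= a * h < 1)%R -> mfun phi -> (forall s, 0 <= phi s) ->
  (forall k, Y (dilation (t ^+ k) phi) <= (h ^+ k)%:E * Y phi) ->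
  let S s := \sum_(k <oo) (a ^+ k)%:E * dilation (t ^+ k) phi s in
  mfun S /\ Y S <= ((1 - a * h)^-1)%:E * Y phi.
Proof.
move=> t0 a0 ah mphi phi0 H S.
have ak k : (0 <= a ^+ k)%R by rewrite exprn_ge0// ltW.
have mF k : mfun (fun s => (a ^+ k)%:E * dilation (t ^+ k) phi s).
  by apply: measurable_funeM; apply: measurable_dilation; rewrite ?exprn_gt0.
have F0 k s : 0 <= (a ^+ k)%:E * dilation (t ^+ k) phi s.
  by rewrite mule_ge0 ?lee_fin//; exact: phi0.
split; first by apply: ge0_emeasurable_sum.
apply: (fnorm_nneseries Yn mF F0) => N.
apply: (le_trans _ (sum_geometric_le N ah (fnorm_ge0 Yn mphi))).
apply: lee_sum => k _; rewrite (fnormZ Yn); last first.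
  by apply: measurable_dilation; rewrite ?exprn_gt0.
by rewrite ger0_norm// exprMn EFinM -muleA lee_wpmul2l// lee_fin.
Qed.

Lemma ae_halfline (P : RL -> Prop) : (forall s : R, (0 < s)%R -> P s) ->
  {ae L, forall s, P s}.
Proof.
move=> H; exists `]-oo, 0%R]%classic; split.
- exact: halfline_itv.
- have -> : L `]-oo, 0%R]%classic = L `[0%R, 0%R]%classic.
    rewrite !halfline_itvE; congr lebesgue_measure; apply/seteqP; split => s /=;
    rewrite !in_itv/= !andbT; first by move=> [-> ->].
    by move=> [/andP[-> ->]].
  by rewrite halfline_bnd// subr0.
- move=> s /= nP; rewrite in_itv/= leNgt; apply/negP => s0; exact/nP/H.
Qed.

(** For [s > 0] the hypothesis is applied with [tau = s] and with [lam] slightly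
    above the sum of the terms a^k G^*(rho^k s) and b^-k G^*(rho^-k s): each
    term is then less than [lam], which is one of the required bounds on [DG].
    So [rearr DF s] is at most [Cc] times this sum, whose norm is bounded by two
    geometric series. *)
Lemma rearr_comparison (DF DG : R -> \bar R) (rho a b Cc h B : R) :
  distribution_like DF -> distribution_like DG ->
  (1 < rho)%R -> (0 < a)%R -> (0 < b)%R -> (0 < Cc)%R -> (0 <= h)%R -> (0 <= B)%R ->
  (a * h < 1)%R -> (b^-1 * B < 1)%R ->
  (forall f, mfun f -> Y (dilation rho^-1 f) <= h%:E * Y f) ->
  (forall f, mfun f ->
    (forall s, 0 <= f s) -> (forall s s' : R, (s <= s')%R -> f s' <= f s) ->
    Y (dilation rho f) <= B%:E * Y f) ->
  (forall lam tau : R, (0 < lam)%R -> (0 < tau)%R ->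
    (forall k : nat, DG (lam * a ^- k)%R <= (rho ^+ k * tau)%:E /\
       DG (lam * b ^+ k)%R <= (rho ^- k * tau)%:E) ->
    DF (Cc * lam)%R <= tau%:E) ->
  Y (rearr DF) <= (Cc * ((1 - a * h)^-1 + (1 - b^-1 * B)^-1))%:E * Y (rearr DG).
Proof.
move=> hF hG rho1 a0 b0 Cc0 h0 B0 ah bB Hh HB H.
have rho0 : (0 < rho)%R by exact: lt_trans rho1.
have bi0 : (0 < b^-1)%R by rewrite invr_gt0.
have ri0 : (0 < rho^-1)%R by rewrite invr_gt0.
set phi := rearr DG; set psi := rearr DF.
have mphi : mfun phi by exact: measurable_rearr.
have mpsi : mfun psi by exact: measurable_rearr.
have phi0 s : 0 <= phi s by exact: rearr_ge0.
have phid (s s' : R) : (s <= s')%R -> phi s' <= phi s by exact: rearr_nonincreasing.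
have down k : Y (dilation (rho^-1 ^+ k) phi) <= (h ^+ k)%:E * Y phi.
  by apply: dilationX_le => // g mg _ _; exact: Hh.
have up k : Y (dilation (rho ^+ k) phi) <= (B ^+ k)%:E * Y phi.
  by apply: dilationX_le.
have ah01 : (0 <= a * h < 1)%R by rewrite mulr_ge0// ltW.
have bB01 : (0 <= b^-1 * B < 1)%R by rewrite mulr_ge0// ltW.
have [mS1 YS1] := dilation_series_le ri0 a0 ah01 mphi phi0 down.
have [mS2 YS2] := dilation_series_le rho0 bi0 bB01 mphi phi0 up.
set S1 := (fun s : RL => _) in mS1 YS1; set S2 := (fun s : RL => _) in mS2 YS2.
have term1 k s : 0 <= (a ^+ k)%:E * dilation (rho^-1 ^+ k) phi s.
  by rewrite mule_ge0 ?lee_fin ?exprn_ge0 ?(ltW a0)//; exact: phi0.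
have term2 k s : 0 <= (b^-1 ^+ k)%:E * dilation (rho ^+ k) phi s.
  by rewrite mule_ge0 ?lee_fin ?exprn_ge0 ?(ltW bi0)//; exact: phi0.
have S10 s : 0 <= S1 s by apply: nneseries_ge0 => k _ _; exact: term1.
have S20 s : 0 <= S2 s by apply: nneseries_ge0 => k _ _; exact: term2.
have mS : mfun (S1 \+ S2) by exact: (emeasurable_funD mS1 mS2).
have SS0 s : 0 <= (S1 \+ S2) s by rewrite /= adde_ge0.
have key (s : R) : (0 < s)%R -> psi s <= Cc%:E * (S1 \+ S2) s.
  move=> s0.
  case SE : ((S1 \+ S2) s) => [S| |]; last 2 first.
  - by rewrite gt0_muley ?lte_fin// leey.
  - by have := SS0 s; rewrite SE.
  have S0 : (0 <= S)%R by rewrite -lee_fin -SE; exact: SS0.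
  apply/lee_addgt0Pr => eps eps0.
  pose lam := (S + eps / Cc)%R.
  have lam0 : (0 < lam)%R by rewrite ltr_wpDl// divr_gt0.
  have Slam : (S <= lam)%R by rewrite lerDl ltW// divr_gt0.
  have -> : Cc%:E * S%:E + eps%:E = (Cc * lam)%:E.
    by rewrite -EFinM -EFinD; congr EFin; rewrite /lam; field; rewrite gt_eqF.
  rewrite leNgt rearr_gt//; last by rewrite mulr_ge0// ltW.
  rewrite -leNgt; apply: H => // k.
  have ak0 : (0 < a ^+ k)%R by rewrite exprn_gt0.
  have bk0 : (0 < b ^+ k)%R by rewrite exprn_gt0.
  split; rewrite leNgt -rearr_gt ?mulr_ge0 ?invr_ge0 ?(ltW lam0) ?(ltW ak0) ?(ltW bk0)// -leNgt.
    rewrite EFinM lee_pdivlMr//.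
    apply: (@le_trans _ _ S%:E); last by rewrite lee_fin.
    rewrite -SE; apply: (@le_trans _ _ (S1 s)); last by rewrite leeDl.
    rewrite muleC.
    apply: le_trans (nneseries_ge_term k (fun k => term1 k s)).
    by rewrite /dilation exprVn invrK mulrC.
  rewrite EFinM -lee_pdivrMr//.
  apply: (@le_trans _ _ S%:E); last by rewrite lee_fin.
  rewrite -SE; apply: (@le_trans _ _ (S2 s)); last by rewrite leeDr.
  rewrite muleC.
  apply: le_trans (nneseries_ge_term k (fun k => term2 k s)).
  by rewrite /dilation exprVn mulrC.
apply: (@le_trans _ _ (Y (fun s => Cc%:E * (S1 \+ S2) s))).
  apply: (fnorm_le Yn mpsi); first exact: (measurable_funeM Cc%:E mS).
  apply: ae_halfline => s s0; rewrite !gee0_abs ?rearr_ge0//; first exact: key.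
  by rewrite mule_ge0 ?lee_fin ?(ltW Cc0)// adde_ge0.
rewrite (fnormZ Yn)// ger0_norm ?(ltW Cc0)// EFinM -muleA.
apply: lee_wpmul2l; first by rewrite lee_fin ltW.
apply: (le_trans (fnormD Yn mS1 mS2)).
rewrite EFinD ge0_muleDl ?lee_fin ?invr_ge0 ?subr_ge0 ?(ltW ah) ?(ltW bB)//.
exact: leeD.
Qed.

End rearr_comparison.

(** * Extrapolation *)

Section weighted_distribution.
Context d (T : measurableType d) (R : realType) (mu : {measure set T -> \bar R}).

Lemma density_dist_fun (v f g : T -> \bar R) (vr : T -> R)
  (mvr : measurable_fun setT vr) (vr0 : forall x, (0 <= vr x)%R) (l : R) :
  measurable_fun setT v -> measurable_fun setT f -> measurable_fun setT g ->
  (\forall x \ae mu, v x = (vr x)%:E) -> (\forall x \ae mu, f x = g x) ->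
  \int[mu]_(x in [set x | l%:E < `|f x|]) v x =
  dist_fun (density_measure mu mvr vr0) g l.
Proof.
move=> mv mf mg vE fg; rewrite /dist_fun density_measureE.
have mA (h : T -> \bar R) : measurable_fun setT h -> measurable [set x | l%:E < `|h x|].
  exact: abse_superlevel_measurable.
rewrite integral_mkcond [RHS]integral_mkcond.
apply: ae_eq_integral_of => //.
- by apply/(measurable_restrictT _ (mA _ mf)); exact: measurable_funTS.
- apply/(measurable_restrictT _ (mA _ mg)); apply: measurable_funTS.
  exact/measurable_EFinP.
- apply: filterS2 vE fg => x vx fx; rewrite !patchE.
  have -> : (x \in [set x | l%:E < `|f x|]) = (x \in [set x | l%:E < `|g x|]).
    by apply/idP/idP => /set_mem /=; rewrite ?fx -?fx => xl; rewrite mem_set//= ?fx// -fx.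
  by case: ifP.
Qed.

End weighted_distribution.

Section level_rescaling.
Context (R : realType).

Lemma powR_level (y : \bar R) (c r u lam : R) : (0 < c)%R -> (0 < r)%R ->
  (0 < u)%R -> (0 < lam)%R -> 0 <= y ->
  (c `^ r)%:E < (y * (u / lam)%:E) `^ r -> (lam * c)%:E < y * u%:E.
Proof.
move=> c0 r0 u0 lam0 y0; apply: contraTT; rewrite -!leNgt => H.
have ul : (0 <= u / lam)%R by rewrite ltW// divr_gt0.
rewrite -poweR_EFin; apply: gt0_ler_poweR; rewrite ?in_itv/= ?leey ?andbT ?(ltW r0) ?lee_fin ?(ltW c0)//.
  by rewrite mule_ge0.
by rewrite EFinM muleA lee_pdivrMr// -EFinM mulrC.
Qed.

Lemma exprn_powR (rho sigma : R) (k : nat) :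
  (rho `^ (sigma * k%:R) = (rho `^ sigma) ^+ k)%R.
Proof. by rewrite powRrM powR_mulrn// powR_ge0. Qed.

Lemma measurable_poweR_rescaled d (T : measurableType d) (g : T -> \bar R)
  (u : T -> R) (r lam : R) : measurable_fun setT g -> measurable_fun setT u ->
  measurable_fun setT (fun x => (g x * (u x / lam)%:E) `^ r).
Proof.
move=> mg mu_; apply: (measurableT_comp (measurable_poweR r)).
apply: emeasurable_funM => //; apply/measurable_EFinP.
exact: measurable_funM.
Qed.

(** The growth [rho `^ sigma] at low heights is dictated by [h] and the decay
    [rho `^ lambda] at high heights by [B].  Passing to the power [r] of the
    functions, with [r] small, brings both into the range required by
    [level_bounds]. *)
Lemma level_exponents (rho h B p0 : R) : (1 < rho)%R -> (0 < h < 1)%R -> (0 < B)%R ->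
  (0 < p0)%R -> exists r sigma lambda : R,
  [/\ (0 < r < p0)%R, (0 < sigma * r <= 2^-1)%R, (lambda * r = 2^-1)%R,
      (rho `^ sigma * h < 1)%R & ((rho `^ lambda)^-1 * B < 1)%R].
Proof.
move=> rho1 /andP[h0 h1] B0 p00.
have rho0 : (0 < rho)%R by exact: lt_trans rho1.
have lr0 : (0 < ln rho)%R by exact: ln_gt0.
have lh0 : (ln h < 0)%R by rewrite ln_lt0// h0.
(* [rho `^ sigma] is the power -1/2 of [h]; [rho `^ L0] is at least [2 * B]. *)
pose sigma := (- ln h / (2 * ln rho))%R.
have sigma0 : (0 < sigma)%R by rewrite divr_gt0 ?oppr_gt0// mulr_gt0.
pose L0 := Num.max 1%R (ln (2 * B) / ln rho)%R.
have L00 : (0 < L0)%R by rewrite lt_max ltr01.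
pose r := Num.min (Num.min (2 * L0)^-1 (2 * sigma)^-1)%R (p0 / 2)%R.
have L2 : (0 < 2 * L0)%R by rewrite mulr_gt0.
have s2 : (0 < 2 * sigma)%R by rewrite mulr_gt0.
have r0 : (0 < r)%R by rewrite /r !lt_min !invr_gt0 L2 s2 divr_gt0.
have rL : (r <= (2 * L0)^-1)%R by rewrite /r !ge_min lexx.
have rs : (r <= (2 * sigma)^-1)%R by rewrite /r !ge_min lexx orbT.
have rp : (r <= p0 / 2)%R by rewrite /r !ge_min lexx orbT.
exists r, sigma, (2 * r)^-1%R; split.
- by rewrite r0/=; lra.
- rewrite mulr_gt0//= mulrC -ler_pdivlMr//; apply: (le_trans rs).
  by rewrite invfM.
- by field; rewrite gt_eqF.
- have hE : (h = rho `^ (ln h / ln rho))%R.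
    by rewrite /powR gt_eqF// divfK ?gt_eqF// lnK.
  rewrite [X in (_ * X < _)%R]hE -powRD; last by apply/implyP => _; rewrite gt_eqF.
  rewrite -[ltRHS](powRr0 rho) gt1_ltr_powR// /sigma.
  have -> : (- ln h / (2 * ln rho) + ln h / ln rho = ln h / (2 * ln rho))%R.
    by field; rewrite gt_eqF.
  by rewrite pmulr_llt0// invr_gt0 mulr_gt0.
- have LB : (2 * B <= rho `^ (2 * r)^-1)%R.
    have BE : (2 * B = rho `^ (ln (2 * B) / ln rho))%R.
      by rewrite /powR gt_eqF// divfK ?gt_eqF// lnK// posrE mulr_gt0.
    rewrite [leLHS]BE ler_powR ?(ltW rho1)//; apply: (@le_trans _ _ L0).
      by rewrite le_max lexx orbT.
    by rewrite -[leLHS]invrK lef_pV2 ?posrE ?invr_gt0 ?mulr_gt0//; move: rL; rewrite invfM; lra.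
  have P0 : (0 < rho `^ (2 * r)^-1)%R by rewrite powR_gt0.
  by rewrite mulrC ltr_pdivrMr// mul1r; lra.
Qed.

End level_rescaling.

Theorem theorem1p5 (R : realType) (n : nat) (n_gt0 : (0 < n)%N)
  (F : set ((euclidean R n -> \bar R) * (euclidean R n -> \bar R)))
  (F_pairs : extrapolation_pairs F)
  (X : (euclidean R n -> \bar R) -> \bar R)
  (X_norm : function_norm (leb R n) X)
  (X_ri : rearrangement_invariant (leb R n) X)
  (Xbar : (real_line R -> \bar R) -> \bar R)
  (X_Xbar : luxemburg X Xbar)
  (X_boyd : upper_boyd_index Xbar < +oo)
  (p0 : R) (p0_gt0 : (0 < p0)%R)
  (F_Lp0 : forall q K : R, (1 <= q)%R -> (1 <= K)%R ->
    exists C : R, (0 < C)%R /\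
      forall w, weight w -> Ap_char q w <= K%:E ->
      forall f g, F (f, g) -> wLp_norm p0 w f <= C%:E * wLp_norm p0 w g) :
  forall u v, RHinfty u -> Ainfty v ->
    exists C : R, (0 < C)%R /\
      forall f g, F (f, g) ->
        weighted_norm Xbar v (f \* u) <= C%:E * weighted_norm Xbar v (g \* u).
Proof.
move=> u v RHu Av; have [Yn Yri _] := X_Xbar.
have [[mu_ _] _ _] := RHu; have [[mv _] _] := Av.
have [ur [mur ur0 uE [eta [KU [eta0 KU0 HU]]]]] := RHinfty_real RHu.
have [vr [mvr vr0 vE [kap [KV [kap0 KV0 HV]]]]] := Ainfty_real Av.
have vr0' x : (0 <= vr x)%R by exact: ltW.
have [D nuD] := Ap_doubling (@measurable_ecoord R n) (@leb_cube_gt0 R n) mvr vr0' vr0 kap0 KV0 HV.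
have [t [h [/andP[t0 t1] h01 Hh]]] := boyd_contraction Yn Yri X_boyd.
have rho0 : (0 < t^-1)%R by rewrite invr_gt0.
have rho1 : (1 < t^-1)%R by rewrite invf_gt1.
have [B B0 HB] := up_dilation Yn Yri rho0.
have [r [sigma [lambda [r01 sr lr ah bB]]]] := level_exponents rho1 h01 B0 p0_gt0.
have [Cc Cc0 Hdist] := distribution_estimate p0_gt0 F_pairs F_Lp0 mur ur0 vr0 nuD
  eta0 KU0 kap0 KV0 HU HV rho1 sr r01.
have [h0 h1] := andP h01; have [r0 _] := andP r01.
exists (Cc * ((1 - t^-1 `^ sigma * h)^-1 + (1 - (t^-1 `^ lambda)^-1 * B)^-1))%R.
split; first by rewrite mulr_gt0// addr_gt0// invr_gt0 subr_gt0.
move=> f g fg; have [mf mg f0 g0] := F_pairs _ _ fg.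
have mfu (k : euclidean R n -> \bar R) : measurable_fun setT k ->
    measurable_fun setT (k \* u) /\ measurable_fun setT (fun x => k x * (ur x)%:E).
  move=> mk; split; apply: emeasurable_funM; [exact: mk|exact: mu_|exact: mk|].
  exact/measurable_EFinP.
have dE (k : euclidean R n -> \bar R) : measurable_fun setT k ->
    wdist_fun v (k \* u) = dist_fun (density_measure (leb R n) mvr vr0') (fun x => k x * (ur x)%:E).
  move=> mk; apply/funext => l; have [m1 m2] := mfu _ mk.
  apply: (density_dist_fun mvr vr0' l mv m1 m2 vE).
  by apply: filterS uE => x /= ->.
rewrite /weighted_norm dE// dE//.
have [_ mF] := mfu _ mf; have [_ mG] := mfu _ mg.
have hF := dist_fun_like (density_measure (leb R n) mvr vr0') mF.
have hG := dist_fun_like (density_measure (leb R n) mvr vr0') mG.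
have Hh' k : measurable_fun setT k -> Xbar (dilation t^-1^-1 k) <= h%:E * Xbar k.
  by move=> mk; rewrite invrK; exact: Hh.
apply: (rearr_comparison Yn hF hG rho1
  (powR_gt0 _ rho0) (powR_gt0 _ rho0) Cc0 (ltW h0) (ltW B0) ah bB Hh' HB).
move=> lam tau lam0 tau0 Hlev.
have FE (k : euclidean R n -> \bar R) c : (forall x, 0 <= k x) ->
    [set x | c%:E < `|k x * (ur x)%:E|] = [set x | c%:E < k x * (ur x)%:E].
  move=> k0; apply/funext => x /=.
  by rewrite gee0_abs// mule_ge0// lee_fin ltW.
rewrite /dist_fun FE//; apply: (Hdist f g fg lam tau lam0 tau0) => k.
have mlev c : measurable [set x | c%:E < g x * (ur x)%:E].
  exact: (superlevel_measurable _ mG).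
have level c : (0 < c)%R -> density_measure (leb R n) mvr vr0'
      [set x | (c `^ r)%:E < (g x * (ur x / lam)%:E) `^ r] <=
    density_measure (leb R n) mvr vr0' [set x | (lam * c)%:E < g x * (ur x)%:E].
  move=> c0; apply: le_measure; rewrite ?inE.
  - exact: (superlevel_measurable _ (measurable_poweR_rescaled r lam mg mur)).
  - exact: mlev.
  - by move=> x /=; apply: powR_level.
have [H1 H2] := Hlev k; rewrite /dist_fun !FE// in H1 H2.
split.
- rewrite (_ : t^-1 `^ (- (sigma * r) * k%:R) = ((t^-1 `^ sigma) ^- k) `^ r)%R.
    apply: (le_trans (level _ _) H1).
    by rewrite invr_gt0 exprn_gt0// powR_gt0.
  by rewrite -exprn_powR// -powRN -powRrM; congr (_ `^ _)%R; ring.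
- rewrite (_ : t^-1 `^ (k%:R / 2) = ((t^-1 `^ lambda) ^+ k) `^ r)%R.
    apply: (le_trans (level _ _) H2).
    by rewrite exprn_gt0// powR_gt0.
  by rewrite -exprn_powR// -powRrM; congr (_ `^ _)%R; rewrite mulrAC lr; ring.
Qed.
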